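(* Let $k$ be a number field, let $E/k$ be an elliptic curve, let $v$ be a non-archimedean place of $k$, and let $\Delta_v\in\mathcal{O}_v$ be the discriminant of a minimal Weierstrass equation for $E/k_v$. If $Z=\{P_1,\dots,P_N\}\subset E(k_v)$ is a set of $N$ distinct $k_v$-rational points, then \[ \Lambda_v(Z)\geq\Big(\frac{1}{c_v^2}-\frac{1}{N}\Big)\frac{1}{12}\log|1/\Delta_v|_v, \] where $\Lambda_v(Z)=\frac{1}{N^2}\sum_{1\le i,j\le N,\, i\neq j}\lambda_v(P_i-P_j)$.
   Context: $k_v$ is the completion of $k$ at $v$, $\mathcal{O}_v$ its ring of integers, and $|\cdot|_v$ is the absolute value on $k_v$ whose restriction to $\mathbb{Q}$ is the usual $p$-adic absolute value, $p$ the prime below $v$. $\lambda_v:E(k_v)\setminus\{O\}\to\mathbb{R}$ is the Néron local height function, normalized as in Silverman, Advanced Topics in the Arithmetic of Elliptic Curves, Ch. VI (independent of the Weierstrass equation; in particular $\lambda_v(P)\ge \frac1{12}\log|1/\Delta_v|_v$ for $P\neq O$ with nonsingular reduction). $E_0(k_v)$ is the subgroup of points of $E(k_v)$ whose reduction modulo a minimal Weierstrass equation is nonsingular, and $c_v=|E(k_v)/E_0(k_v)|$. *)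

(* Defs.v *)
From HB Require Import structures.
From mathcomp Require Import all_boot all_order all_algebra all_field.
From mathcomp Require Import reals exp.
Set Implicit Arguments. Unset Strict Implicit. Unset Printing Implicit Defensive.
Import Order.TTheory GRing.Theory Num.Theory.
Local Open Scope ring_scope.

Record wcoef (F : Type) := WCoef { wa1 : F; wa2 : F; wa3 : F; wa4 : F; wa6 : F }.

Definition map_wcoef (F G : Type) (f : F -> G) (W : wcoef F) : wcoef G :=
  WCoef (f (wa1 W)) (f (wa2 W)) (f (wa3 W)) (f (wa4 W)) (f (wa6 W)).

Section Weierstrass.
Variable K : fieldType.
Implicit Types (W : wcoef K).

Definition wb2 W := wa1 W ^+ 2 + 4%:R * wa2 W.
Definition wb4 W := 2%:R * wa4 W + wa1 W * wa3 W.
Definition wb6 W := wa3 W ^+ 2 + 4%:R * wa6 W.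
Definition wb8 W := wa1 W ^+ 2 * wa6 W + 4%:R * wa2 W * wa6 W - wa1 W * wa3 W * wa4 W
                    + wa2 W * wa3 W ^+ 2 - wa4 W ^+ 2.
Definition disc W := - wb2 W ^+ 2 * wb8 W - 8%:R * wb4 W ^+ 3 - 27%:R * wb6 W ^+ 2
                     + 9%:R * wb2 W * wb4 W * wb6 W.

(** points of E(K): [None] is the point at infinity O, [Some (x,y)] an affine point *)
Definition on_curve W (P : option (K * K)) : bool :=
  match P with
  | None => true
  | Some (x, y) => y ^+ 2 + wa1 W * x * y + wa3 W * y ==
                   x ^+ 3 + wa2 W * x ^+ 2 + wa4 W * x + wa6 W
  end.

(** group law (Silverman, AEC, III.2.3) *)
Definition negpt W (P : option (K * K)) : option (K * K) :=
  match P with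
  | None => None
  | Some (x, y) => Some (x, - y - wa1 W * x - wa3 W)
  end.

Definition addpt W (P Q : option (K * K)) : option (K * K) :=
  match P, Q with
  | None, _ => Q
  | _, None => P
  | Some (x1, y1), Some (x2, y2) =>
    if (x1 == x2) && (y1 + y2 + wa1 W * x2 + wa3 W == 0) then None
    else
      let l := if x1 != x2 then (y2 - y1) / (x2 - x1)
               else (3%:R * x1 ^+ 2 + 2%:R * wa2 W * x1 + wa4 W - wa1 W * y1)
                    / (2%:R * y1 + wa1 W * x1 + wa3 W) in
      let n := if x1 != x2 then (y1 * x2 - y2 * x1) / (x2 - x1)
               else (- x1 ^+ 3 + wa4 W * x1 + 2%:R * wa6 W - wa3 W * y1)
                    / (2%:R * y1 + wa1 W * x1 + wa3 W) in
      let x3 := l ^+ 2 + wa1 W * l - wa2 W - x1 - x2 in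
      Some (x3, - (l + wa1 W) * x3 - n - wa3 W)
  end.

(** change of variables  x = u^2 x' + r,  y = u^3 y' + s u^2 x' + t  (Silverman, Table 3.1) *)
Definition chg W (u r s t : K) : wcoef K :=
  WCoef ((wa1 W + 2%:R * s) / u)
        ((wa2 W - s * wa1 W + 3%:R * r - s ^+ 2) / u ^+ 2)
        ((wa3 W + r * wa1 W + 2%:R * t) / u ^+ 3)
        ((wa4 W - s * wa3 W + 2%:R * r * wa2 W - (t + r * s) * wa1 W
          + 3%:R * r ^+ 2 - 2%:R * s * t) / u ^+ 4)
        ((wa6 W + r * wa4 W + r ^+ 2 * wa2 W + r ^+ 3 - t * wa3 W - t ^+ 2
          - r * t * wa1 W) / u ^+ 6).

Definition chg_pt (u r s t : K) (P : option (K * K)) : option (K * K) :=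
  match P with
  | None => None
  | Some (x, y) => Some ((x - r) / u ^+ 2, (y - s * (x - r) - t) / u ^+ 3)
  end.

End Weierstrass.

Section Valued.
Variables (R : realType) (K : fieldType) (abs : K -> R).
Implicit Types (W : wcoef K).

Definition is_nonarch_abs : Prop :=
  [/\ forall x, 0 <= abs x,
      forall x, abs x = 0 <-> x = 0,
      forall x y, abs (x * y) = abs x * abs y &
      forall x y, abs (x + y) <= Num.max (abs x) (abs y)].

Definition abs_complete : Prop :=
  forall f : nat -> K,
    (forall e : R, 0 < e -> exists n0, forall m n, (n0 <= m)%N -> (n0 <= n)%N ->
        abs (f m - f n) < e) ->
    exists l, forall e : R, 0 < e -> exists n0, forall n, (n0 <= n)%N -> abs (f n - l) < e.

Definition abs_dense (k : Type) (iota : k -> K) : Prop :=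
  forall x (e : R), 0 < e -> exists a, abs (x - iota a) < e.

Definition integral_model W : Prop :=
  [/\ abs (wa1 W) <= 1, abs (wa2 W) <= 1, abs (wa3 W) <= 1, abs (wa4 W) <= 1 &
      abs (wa6 W) <= 1].

(** the change of variables (u,r,s,t) turns W into a minimal Weierstrass equation
    (integral coefficients, |Delta| maximal i.e. v(Delta) minimal) *)
Definition is_minimal_change W (u r s t : K) : Prop :=
  [/\ u != 0, integral_model (chg W u r s t) &
      forall u' r' s' t', u' != 0 -> integral_model (chg W u' r' s' t') ->
        abs (disc (chg W u' r' s' t')) <= abs (disc (chg W u r s t))].

(** P lies in E_0(K): its reduction modulo the minimal equation (chg W u r s t)
    is nonsingular (P reduces to O, or the two partial derivatives do not both
    vanish modulo the maximal ideal at the reduction of P). *)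
Definition in_E0 W (u r s t : K) (P : option (K * K)) : Prop :=
  match chg_pt u r s t P with
  | None => True
  | Some (x, y) =>
    let M := chg W u r s t in
    1 < abs x \/
    ~ (abs (2%:R * y + wa1 M * x + wa3 M) < 1 /\
       abs (3%:R * x ^+ 2 + 2%:R * wa2 M * x + wa4 M - wa1 M * y) < 1)
  end.

(** c = |E(K)/E_0(K)| : cardinality of a complete set of coset representatives *)
Definition is_tamagawa W (u r s t : K) (c : nat) : Prop :=
  exists reps : seq (option (K * K)),
    [/\ size reps = c, all (on_curve W) reps,
        (forall i j, (i < c)%N -> (j < c)%N -> i != j ->
           ~ in_E0 W u r s t (addpt W (nth None reps i) (negpt W (nth None reps j)))) &
        forall P, on_curve W P -> exists2 Q, Q \in reps & in_E0 W u r s t (addpt W P (negpt W Q))].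

Definition lamE (lam : K * K -> R) (P : option (K * K)) : R :=
  match P with None => 0 | Some q => lam q end.

(** Néron local height, via Silverman ATAEC Thm VI.1.1 (with v(x) = - log|x|):
    (a) continuous on E(K)\{O}, bounded away from any neighbourhood of O;
    (b) lim_{P -> O} (lam P - 1/2 log|x(P)|) exists;
    (c) lam(2P) = 4 lam(P) - log|2y+a1x+a3| + 1/4 log|Delta| whenever 2P <> O. *)
Definition is_neron_local_height W (lam : K * K -> R) : Prop :=
  [/\ (forall x0 y0, on_curve W (Some (x0, y0)) -> forall e : R, 0 < e ->
         exists2 d : R, 0 < d & forall x y, on_curve W (Some (x, y)) ->
           abs (x - x0) < d -> abs (y - y0) < d -> `|lam (x, y) - lam (x0, y0)| < e),
      (forall M : R, exists B : R, forall x y, on_curve W (Some (x, y)) ->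
           abs x <= M -> `|lam (x, y)| <= B),
      (exists L : R, forall e : R, 0 < e -> exists M : R, forall x y,
           on_curve W (Some (x, y)) -> M < abs x ->
           `|lam (x, y) - 2%:R^-1 * ln (abs x) - L| < e) &
      (forall x y, on_curve W (Some (x, y)) ->
         addpt W (Some (x, y)) (Some (x, y)) != None ->
         lamE lam (addpt W (Some (x, y)) (Some (x, y))) =
           4%:R * lam (x, y) - ln (abs (2%:R * y + wa1 W * x + wa3 W))
           + 4%:R^-1 * ln (abs (disc W)))].

Definition Lambda W (lam : K * K -> R) (Z : seq (option (K * K))) : R :=
  (size Z)%:R ^- 2 *
  \sum_(i < size Z) \sum_(j < size Z | i != j)
     lamE lam (addpt W (nth None Z i) (negpt W (nth None Z j))).

End Valued.

(* Main.v *)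
Require Import Defs.
From HB Require Import structures.
From mathcomp Require Import all_boot all_order all_algebra all_field.
From mathcomp Require Import boolp reals exp.
From mathcomp Require Import ring lra.
Set Implicit Arguments. Unset Strict Implicit. Unset Printing Implicit Defensive.
Import Order.TTheory GRing.Theory Num.Theory.
Local Open Scope ring_scope.

(* Write D = -log|disc| for the minimal discriminant. On E_0 one has lam >= D/12, and
   by Cauchy-Schwarz at least N^2/c of the pairs (i, j) have P_i - P_j in E_0.

   If |j| <= 1 then lam >= 0 everywhere, and this is enough. If |j| > 1 then c_4 is a square
   in K, so the x-line of E can be brought over K to that of the Tate curve
   y^2 + xy = x^3 + b, even though E itself need not be split multiplicative. With
   V = -log|b| <= D and m(P) = -log|x(P)| clamped to [0, V/2] one has
   lam(P) >= V/2 * B_2(m(P)/V), and m satisfies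
   {m(P+Q), m(P-Q)} = {|m(P)-m(Q)|, min(m(P)+m(Q), V-m(P)-m(Q))}. Hence m takes the form
   d(k, nZ) * V/n on a cyclic quotient Z/n of E(K)/E_0(K), and the kernel B_2(d/n) on Z/n is
   positive semidefinite off the constants, with mean B_2(0)/n^2; since n <= c this gives the
   bound.

   The Neron height is bounded below without constructing it: a function l with
   l(2P) >= 4 l(P) - log|2y+a_1x+a_3| + log|disc|/4, bounded by lam up to a constant, satisfies
   l <= lam, by iterating the duplication formula. *)

(** * The group law *)

(** The duplication formula says nothing where 2P = O, so at 2-torsion the bound l <= lam is carried
    over from nearby points by continuity; producing such points uses the completeness of K. Working
    on the x-line rather than on E has two gains. The b-invariants allow x to be scaled by any
    nonzero k, so the twist relating E to the Tate curve never requires a field extension. And the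
    residue characteristics 2 and 3 need no separate treatment: quadratic equations are solved in
    the form w^2 + w = f, and singular reduction at x means that b_6 and b_8, translated to x, are
    both small. The sum is estimated through lam(P) >= [P in E_0] (D - V)/12 + V/2 B_2(m(P)/V) for P
    != O. Over all pairs the kernel contributes at least N^2 V/(12 c^2), and counting gives the
    remaining D - V at least the weight N^2/c >= N^2/c^2. The diagonal terms of the right-hand side
    equal D/12 each, and discarding them is the origin of -1/N. The case |j| <= 1 is the same
    estimate with V = 0 and no kernel. *)

Section GroupLaw.
Variables (K : fieldType) (W : wcoef K).
Local Notation a1 := (wa1 W).
Local Notation a2 := (wa2 W).
Local Notation a3 := (wa3 W).
Local Notation a4 := (wa4 W).
Local Notation a6 := (wa6 W).

Lemma singular_disc0 x y : on_curve W (Some (x, y)) ->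
  2%:R * y + a1 * x + a3 = 0 ->
  3%:R * x ^+ 2 + 2%:R * a2 * x + a4 - a1 * y = 0 -> disc W = 0.
Proof.
move=> /eqP C h3 h4.
rewrite /disc /wb8 /wb6 /wb4 /wb2.
have e3 : a3 = - (2%:R * y + a1 * x) by apply/eqP; rewrite -addr_eq0 -h3; apply/eqP; ring.
have e4 : a4 = a1 * y - 3%:R * x ^+ 2 - 2%:R * a2 * x.
  by apply/eqP; rewrite -subr_eq0 -h4; apply/eqP; ring.
have e6 : a6 = y ^+ 2 + a1 * x * y + a3 * y - (x ^+ 3 + a2 * x ^+ 2 + a4 * x).
  by rewrite C; ring.
rewrite e6 e4 e3; ring.
Qed.

(** Chord and tangent at once, without division: the second equation is the difference of the two
    curve equations divided by Q.1 - P.1, which at P = Q becomes the tangent condition. *)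
Definition is_slope (P Q : K * K) (l : K) : Prop :=
  Q.2 - P.2 = l * (Q.1 - P.1) /\
  l * (P.2 + Q.2 + a1 * Q.1 + a3) =
    P.1 ^+ 2 + P.1 * Q.1 + Q.1 ^+ 2 + a2 * (P.1 + Q.1) + a4 - a1 * P.2.

(** The sum itself, that is, the reflection of the third intersection point of the line with the
    curve. *)
Definition third (P Q : K * K) (l : K) : K * K :=
  let x3 := l ^+ 2 + a1 * l - a2 - P.1 - Q.1 in
  (x3, - (l + a1) * x3 - (P.2 - l * P.1) - a3).

(** A slope excludes the value O: if the sum were O, the two slope equations would force P = Q and
    make P a singular point. *)
Lemma slope_addpt P Q l : disc W != 0 ->
  on_curve W (Some P) -> on_curve W (Some Q) -> is_slope P Q l ->
  addpt W (Some P) (Some Q) = Some (third P Q l).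
Proof.
case: P Q => [x1 y1] [x2 y2] D0 C1 C2 [/= s1 s2].
case: eqP => [e|/eqP ne] /=; last first.
  have d0 : x2 - x1 != 0 by rewrite subr_eq0 eq_sym.
  have -> : l = (y2 - y1) / (x2 - x1) by rewrite s1; field.
  by rewrite /third /=; congr (Some (_, _)); field.
move: s1 s2 C2; rewrite e subrr mulr0 => /eqP; rewrite subr_eq0 => /eqP -> s2 _.
case: eqP => [e0|/eqP ne0] /=.
  case/eqP: D0; apply: (singular_disc0 C1); first by rewrite -e0 e; ring.
  rewrite e; move: s2; rewrite e0 mulr0 => s2; rewrite s2; ring.
have p0 : 2%:R * y1 + a1 * x2 + a3 != 0.
  by apply: contra ne0 => /eqP h; rewrite -h; apply/eqP; ring.
have -> : l = (3%:R * x2 ^+ 2 + 2%:R * a2 * x2 + a4 - a1 * y1) / (2%:R * y1 + a1 * x2 + a3).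
  apply: (mulIf p0); rewrite divfK //.
  have -> : 2%:R * y1 + a1 * x2 + a3 = y1 + y1 + a1 * x2 + a3 by ring.
  by rewrite s2; ring.
move: C1 => /eqP; rewrite e => C1.
have e6 : a6 = y1 ^+ 2 + a1 * x2 * y1 + a3 * y1 - (x2 ^+ 3 + a2 * x2 ^+ 2 + a4 * x2).
  by rewrite C1; ring.
by rewrite /third /=; congr (Some (_, _)); rewrite ?e6; field.
Qed.

Lemma addpt_slope P Q : on_curve W (Some P) -> on_curve W (Some Q) ->
  addpt W (Some P) (Some Q) = None \/ exists l, is_slope P Q l.
Proof.
case: P Q => [x1 y1] [x2 y2] /eqP C1 /eqP C2 /=.
case: eqP => [e|/eqP ne] /=; last first.
  right; have d0 : x2 - x1 != 0 by rewrite subr_eq0 eq_sym.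
  exists ((y2 - y1) / (x2 - x1)); split => /=; first by field.
  apply: (mulIf d0).
  transitivity ((y2 - y1) * (y1 + y2 + a1 * x2 + a3)); first by field.
  transitivity (y2 ^+ 2 + a1 * x2 * y2 + a3 * y2 - (y1 ^+ 2 + a1 * x1 * y1 + a3 * y1)
     - a1 * y1 * (x2 - x1)); first by ring.
  by rewrite C1 C2; ring.
case: eqP => [e0|/eqP ne0] /=; [by left | right].
have/eqP: (y1 - y2) * (y1 + y2 + a1 * x2 + a3) = 0.
  transitivity ((y1 ^+ 2 + a1 * x1 * y1 + a3 * y1) - (y2 ^+ 2 + a1 * x2 * y2 + a3 * y2)).
    by rewrite e; ring.
  by rewrite C1 C2 e; ring.
rewrite mulf_eq0 (negPf ne0) orbF subr_eq0 => /eqP ey.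
exists ((3%:R * x2 ^+ 2 + 2%:R * a2 * x2 + a4 - a1 * y1) / (y1 + y2 + a1 * x2 + a3)).
by split => /=; [rewrite e ey; ring | rewrite divfK // e; ring].
Qed.

(** The hypotheses are linear in a4 and a6, so these are eliminated instead of the coordinates, and
    a polynomial identity remains. The other slope identities are obtained in the same way. *)
Lemma third_on_curve P Q l : on_curve W (Some P) -> is_slope P Q l ->
  on_curve W (Some (third P Q l)).
Proof.
case: P Q => [x1 y1] [x2 y2] /eqP C1 [/= s1 s2]; apply/eqP.
have ey : y2 = y1 + l * (x2 - x1) by rewrite -s1; ring.
have e4 : a4 = l * (y1 + y2 + a1 * x2 + a3) -
   (x1 ^+ 2 + x1 * x2 + x2 ^+ 2 + a2 * (x1 + x2) - a1 * y1) by rewrite s2; ring.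
have e6 : a6 = y1 ^+ 2 + a1 * x1 * y1 + a3 * y1 - (x1 ^+ 3 + a2 * x1 ^+ 2 + a4 * x1).
  by rewrite C1; ring.
rewrite e6 e4 ey; ring.
Qed.

Lemma addpt0 P : addpt W P None = P.
Proof. by case: P => [[x y]|]. Qed.

Lemma addpt_on_curve P Q : disc W != 0 -> on_curve W P -> on_curve W Q ->
  on_curve W (addpt W P Q).
Proof.
case: P Q => [P|] [Q|]; rewrite ?addpt0 // => D0 CP CQ.
have [-> //|[l Hl]] := addpt_slope CP CQ.
by rewrite (slope_addpt D0 CP CQ Hl); apply: third_on_curve.
Qed.

Lemma negpt_on_curve P : on_curve W P -> on_curve W (negpt W P).
Proof. by case: P => [[x y]|] //= /eqP C; apply/eqP; rewrite -C; ring. Qed.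

Lemma negptK : involutive (negpt W).
Proof. by case=> [[x y]|] //=; congr (Some (_, _)); ring. Qed.

Lemma addpt_negl P : addpt W (negpt W P) P = None.
Proof.
by case: P => [[x y]|] //=; rewrite eqxx; case: eqP => //; case; ring.
Qed.

Lemma addpt_None P Q : on_curve W P -> on_curve W Q -> addpt W P Q = None -> Q = negpt W P.
Proof.
case: P Q => [[x1 y1]|] [[x2 y2]|] //= _ _; case: ifP => // /andP[/eqP-> /eqP e] _.
by congr (Some (_, _)); apply/eqP; rewrite -subr_eq0 -e; apply/eqP; ring.
Qed.

Lemma is_slope_sym P Q l : is_slope P Q l -> is_slope Q P l.
Proof.
case: P Q => [x1 y1] [x2 y2] [/= s1 s2]; split => /=.
  by rewrite -(opprB y2) s1; ring.
have -> : y1 = y2 - l * (x2 - x1) by rewrite -s1; ring.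
have -> : a4 = l * (y1 + y2 + a1 * x2 + a3) -
   (x1 ^+ 2 + x1 * x2 + x2 ^+ 2 + a2 * (x1 + x2) - a1 * y1) by rewrite s2; ring.
have -> : y1 = y2 - l * (x2 - x1) by rewrite -s1; ring.
ring.
Qed.

Lemma addptC P Q : disc W != 0 -> on_curve W P -> on_curve W Q ->
  addpt W P Q = addpt W Q P.
Proof.
case: P Q => [P|] [Q|]; rewrite ?addpt0 // => D0 CP CQ.
have [e|[l Hl]] := addpt_slope CP CQ.
  by rewrite e (addpt_None CP CQ e) addpt_negl.
rewrite (slope_addpt D0 CP CQ Hl) (slope_addpt D0 CQ CP (is_slope_sym Hl)).
case: P Q Hl {CP CQ} => [x1 y1] [x2 y2] [/= s1 _]; rewrite /third /=.
have -> : y2 = y1 + l * (x2 - x1) by rewrite -s1; ring.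
by congr (Some (_, _)); ring.
Qed.

(** Reflection sends a line of slope l to one of slope - l - a1. *)
Lemma is_slope_neg P Q l : is_slope P Q l ->
  is_slope (P.1, - P.2 - a1 * P.1 - a3) (Q.1, - Q.2 - a1 * Q.1 - a3) (- l - a1).
Proof.
case: P Q => [x1 y1] [x2 y2] [/= s1 s2]; split => /=.
  have -> : y2 = y1 + l * (x2 - x1) by rewrite -s1; ring.
  ring.
have e4 : a4 = l * (y1 + y2 + a1 * x2 + a3) -
   (x1 ^+ 2 + x1 * x2 + x2 ^+ 2 + a2 * (x1 + x2) - a1 * y1) by rewrite s2; ring.
rewrite e4.
have -> : y2 = y1 + l * (x2 - x1) by rewrite -s1; ring.
ring.
Qed.

Lemma negptD P Q : disc W != 0 -> on_curve W P -> on_curve W Q ->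
  negpt W (addpt W P Q) = addpt W (negpt W P) (negpt W Q).
Proof.
case: P Q => [P|] [Q|]; rewrite ?addpt0 // => D0 CP CQ.
have CP' := negpt_on_curve CP; have CQ' := negpt_on_curve CQ.
have [e|[l Hl]] := addpt_slope CP CQ.
  by rewrite e (addpt_None CP CQ e) negptK addpt_negl.
rewrite (slope_addpt D0 CP CQ Hl).
case: P Q Hl CP CQ CP' CQ' => [x1 y1] [x2 y2] /is_slope_neg Hl CP CQ CP' CQ'.
rewrite (slope_addpt D0 CP' CQ' Hl) /third /=.
by congr (Some (_, _)); ring.
Qed.

(** The line through P, Q and -(P + Q), once reflected, passes through P + Q and -Q. *)
Lemma is_slope_cancel P Q l : is_slope P Q l ->
  is_slope (third P Q l) (Q.1, - Q.2 - a1 * Q.1 - a3) (- l - a1).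
Proof.
case: P Q => [x1 y1] [x2 y2] [/= s1 s2]; rewrite /third; split => /=.
  have -> : y2 = y1 + l * (x2 - x1) by rewrite -s1; ring.
  ring.
have e4 : a4 = l * (y1 + y2 + a1 * x2 + a3) -
   (x1 ^+ 2 + x1 * x2 + x2 ^+ 2 + a2 * (x1 + x2) - a1 * y1) by rewrite s2; ring.
rewrite e4.
have -> : y2 = y1 + l * (x2 - x1) by rewrite -s1; ring.
ring.
Qed.

Lemma addptK P Q : disc W != 0 -> on_curve W P -> on_curve W Q ->
  addpt W (addpt W P Q) (negpt W Q) = P.
Proof.
case: Q => [Q|] D0 CP CQ; last by rewrite !addpt0.
case: P CP => [P|] CP; last first.
  by rewrite [addpt W None _]/= (addptC D0 CQ (negpt_on_curve CQ)) addpt_negl.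
have CQ' := negpt_on_curve CQ.
have [e|[l Hl]] := addpt_slope CP CQ.
  by rewrite e (addpt_None CP CQ e) negptK.
rewrite (slope_addpt D0 CP CQ Hl).
have CS := third_on_curve CP Hl.
case: P Q Hl CP CQ CQ' CS => [x1 y1] [x2 y2] Hl CP CQ CQ' CS.
rewrite (slope_addpt D0 CS CQ' (is_slope_cancel Hl)).
case: Hl => /= s1 _; rewrite /third /=.
congr (Some (_, _)); first ring.
have -> : y1 = y2 - l * (x2 - x1) by rewrite -s1; ring.
ring.
Qed.

(* In the coordinates where B is the origin and AB is the x-axis this reads
   [x T - x A = l * (m + a1)]; it makes the whole configuration polynomial in
   the three slopes. *)
Lemma assoc_slope_eq A B T e l m : disc W != 0 -> on_curve W (Some B) ->
  is_slope A B e -> is_slope B T l -> is_slope (third A B e) T m ->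
  T.1 - A.1 = (l - e) * (m + e + a1).
Proof.
case: A B T => [xA yA] [xB yB] [xT yT] D0 CB [/= h1 h2] [/= h3 h4] [].
rewrite /third /=; set xS := _ - xA - xB => h5 h6.
have eA : yA = yB - e * (xB - xA) by rewrite -h1; ring.
have eT : yT = yB + l * (xT - xB) by rewrite -h3; ring.
have e2 : a2 = e ^+ 2 + a1 * e - xA - xB - xS by rewrite /xS; ring.
have e3 : a3 = m * (xT - xS) - yT - (e + a1) * xS - yA + e * xA by rewrite -h5; ring.
have e4 : a4 = e * (yA + yB + a1 * xB + a3) -
   (xA ^+ 2 + xA * xB + xB ^+ 2 + a2 * (xA + xB) - a1 * yA) by rewrite h2; ring.
clearbody xS.
have Z1 : (xT - xS) * (xT - xA - (l - e) * (m + e + a1)) = 0.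
  transitivity (xB ^+ 2 + xB * xT + xT ^+ 2 + a2 * (xB + xT) + a4 - a1 * yB
     - l * (yB + yT + a1 * xT + a3)); last by rewrite h4; ring.
  by rewrite e4 e2 e3 eT eA; ring.
have Z2 : (xT - xB) * (xT - xA - (l - e) * (m + e + a1)) = 0.
  move/eqP: h6; rewrite -subr_eq0 => /eqP h6; rewrite -[RHS]oppr0 -h6.
  by rewrite e4 e2 e3 eT eA; ring.
apply/eqP; rewrite -subr_eq0; apply/eqP.
move/eqP: Z1; rewrite mulf_eq0 => /orP[/eqP zS|/eqP //].
move/eqP: Z2; rewrite mulf_eq0 => /orP[/eqP zB|/eqP //].
(* T = B = S would force B to be singular *)
have eTB : xT = xB by apply/eqP; rewrite -subr_eq0 zB.
have eTS : xS = xB by rewrite -eTB; apply/esym/eqP; rewrite -subr_eq0 zS.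
case/eqP: D0; apply: (singular_disc0 CB).
  by rewrite e3 eT eA eTS eTB; ring.
have e3' : a3 = - (2%:R * yB + a1 * xB) by rewrite e3 eT eA eTS eTB; ring.
move/eqP: h4; rewrite eq_sym -subr_eq0 => /eqP <-.
by rewrite eT eTB e3'; ring.
Qed.

(** The slopes used by the two bracketings have the same sum e + m, whence the slope m - l + e. Over
    the complex numbers this is the cocycle relation for zeta(z + w) - zeta(z) - zeta(w), which is
    the slope up to normalization. *)
Lemma assoc_slope A B T e l m : disc W != 0 -> on_curve W (Some B) ->
  is_slope A B e -> is_slope B T l -> is_slope (third A B e) T m ->
  is_slope A (third B T l) (m - l + e) /\
  third A (third B T l) (m - l + e) = third (third A B e) T m.
Proof.
move=> D0 CB sAB sBT sST; have := assoc_slope_eq D0 CB sAB sBT sST.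
case: A B T sAB sBT sST CB => [xA yA] [xB yB] [xT yT] [/= h1 h2] [/= h3 h4] [].
rewrite /third /=; set xS := _ - xA - xB => h5 h6 _ h7.
have eA : yA = yB - e * (xB - xA) by rewrite -h1; ring.
have eT : yT = yB + l * (xT - xB) by rewrite -h3; ring.
have e2 : a2 = e ^+ 2 + a1 * e - xA - xB - xS by rewrite /xS; ring.
have e3 : a3 = m * (xT - xS) - yT - (e + a1) * xS - yA + e * xA by rewrite -h5; ring.
have e4 : a4 = e * (yA + yB + a1 * xB + a3) -
   (xA ^+ 2 + xA * xB + xB ^+ 2 + a2 * (xA + xB) - a1 * yA) by rewrite h2; ring.
have ex : xA = xT - (l - e) * (m + e + a1) by rewrite -h7; ring.
clearbody xS.
split; first split => /=.
- by rewrite e3 e2 eT eA ex; ring.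
- by rewrite e4 e3 e2 eT eA ex; ring.
- by congr (_, _); rewrite ?e3 e2 ?eT ?eA ex; ring.
Qed.

(** Slopes are compared only when A + B, B + T and (A + B) + T are all affine; if one of these is O,
    the cancellation law [addptK] suffices. *)
Lemma addptA P Q T : disc W != 0 -> on_curve W P -> on_curve W Q -> on_curve W T ->
  addpt W P (addpt W Q T) = addpt W (addpt W P Q) T.
Proof.
move=> D0 CP CQ CT; have CPQ := addpt_on_curve D0 CP CQ.
have CQT := addpt_on_curve D0 CQ CT.
case: P CP CPQ => [A|] // CA CAB.
case: Q CQ CQT CAB => [B|] CB CBT CAB; last by rewrite addpt0.
case: T CT CBT => [T|] CT CBT; last by rewrite !addpt0.
have [e0|[e sAB]] := addpt_slope CA CB.
  have eB := addpt_None CA CB e0.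
  rewrite e0 (addptC D0 CA CBT) (addptC D0 CB CT).
  have -> : Some A = negpt W (Some B) by rewrite eB negptK.
  by rewrite addptK.
have [e0|[l sBT]] := addpt_slope CB CT.
  by rewrite e0 (addpt_None CB CT e0) addptK // addpt0.
move: CAB; rewrite (slope_addpt D0 CA CB sAB) => CS.
have [e0|[m sST]] := addpt_slope CS CT.
  rewrite e0 (addpt_None CS CT e0) -(slope_addpt D0 CA CB sAB).
  have CN : on_curve W (addpt W (Some A) (Some B)) by apply: addpt_on_curve.
  have -> : addpt W (Some B) (negpt W (addpt W (Some A) (Some B))) = negpt W (Some A).
    rewrite -{1}[Some B]negptK -negptD ?negpt_on_curve //.
    by rewrite (addptC D0 (negpt_on_curve CB) CN) addptK.
  by rewrite -{1}[Some A]negptK addpt_negl.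
rewrite (slope_addpt D0 CS CT sST) (slope_addpt D0 CB CT sBT).
have [s1 <-] := assoc_slope D0 CB sAB sBT sST.
by rewrite (slope_addpt D0 CA (third_on_curve CB sBT) s1).
Qed.

End GroupLaw.

(** * Non-archimedean fields *)

Lemma exprn_small (R : realType) (q e : R) : 0 <= q -> q < 1 -> 0 < e ->
  exists n, forall m, (n <= m)%N -> q ^+ m < e.
Proof.
move=> q0 q1 e0.
(* Bernoulli's inequality, in a form that does not invert q and so covers q = 0. *)
have bern n : q ^+ n * (1 + n%:R * (1 - q)) <= 1.
  elim: n => [|n IHn]; first by rewrite expr0 mul0r; lra.
  apply: le_trans IHn; rewrite exprSr -mulrA ler_wpM2l ?exprn_ge0 //.
  have n0 : 0 <= n%:R :> R by [].
  rewrite -subr_ge0 -natr1.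
  have -> : 1 + n%:R * (1 - q) - q * (1 + (n%:R + 1) * (1 - q)) =
    (1 - q) ^+ 2 * (1 + n%:R) by ring.
  by rewrite mulr_ge0 ?sqr_ge0 ?addr_ge0.
have d0 : 0 < e * (1 - q) by nra.
exists (Num.bound (e * (1 - q))^-1) => m Hm.
have hb : 1 < e * (1 - q) * m%:R.
  rewrite mulrC -ltr_pdivrMr // mul1r.
  apply: lt_le_trans (archi_boundP _) _; first by rewrite invr_ge0 ltW.
  by rewrite ler_nat.
have := bern m; have := exprn_ge0 m q0; set Q := q ^+ m => Q0 hQ.
have m0 : 0 <= m%:R :> R by [].
rewrite ltNge; apply/negP => eQ; nra.
Qed.

Lemma ler_ltM (R : realType) (a b c d : R) : 0 < b -> 0 <= c -> a <= b -> c < d ->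
  a * c < b * d.
Proof.
by move=> b0 c0 ab cd; apply: le_lt_trans (ler_wpM2r c0 ab) _; rewrite ltr_pM2l.
Qed.

Section ValuedField.
Variables (R : realType) (K : fieldType) (abs : K -> R).
Hypothesis na : is_nonarch_abs abs.
Implicit Types x y z : K.

Lemma abs_ge0 x : 0 <= abs x. Proof. by case: na. Qed.
Lemma absM x y : abs (x * y) = abs x * abs y. Proof. by case: na. Qed.
Lemma abs_eq0 x : (abs x == 0) = (x == 0).
Proof. by case: na => _ h _ _; apply/eqP/eqP => /h. Qed.
Lemma abs0 : abs 0 = 0. Proof. by apply/eqP; rewrite abs_eq0. Qed.
Lemma abs_gt0 x : (0 < abs x) = (x != 0).
Proof. by rewrite lt_neqAle abs_ge0 andbT eq_sym abs_eq0. Qed.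
Lemma abs1 : abs 1 = 1.
Proof.
have h : abs 1 != 0 by rewrite abs_eq0 oner_eq0.
by apply: (mulIf h); rewrite -absM !mul1r.
Qed.
Lemma absX x n : abs (x ^+ n) = abs x ^+ n.
Proof. by elim: n => [|n IHn]; rewrite ?expr0 ?abs1 // !exprS absM IHn. Qed.
Lemma absN x : abs (- x) = abs x.
Proof.
have h : abs (-1) ^+ 2 == 1 by rewrite -absX sqrrN expr1n abs1.
have h1 : abs (-1) = 1.
  move: h; rewrite sqrf_eq1 => /orP[/eqP //|/eqP h].
  by have := abs_ge0 (-1); rewrite h ler0N1.
by rewrite -mulN1r absM h1 mul1r.
Qed.
Lemma absB x y : abs (x - y) = abs (y - x).
Proof. by rewrite -absN opprB. Qed.
Lemma absV x : abs x^-1 = (abs x)^-1.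
Proof.
have [->|x0] := eqVneq x 0; first by rewrite invr0 abs0 invr0.
have h : abs x != 0 by rewrite abs_eq0.
by apply: (mulIf h); rewrite -absM !mulVf // abs1.
Qed.

Lemma absD_le c x y : abs x <= c -> abs y <= c -> abs (x + y) <= c.
Proof.
move=> hx hy; case: na => _ _ _ h; apply: le_trans (h x y) _.
by rewrite ge_max hx hy.
Qed.
Lemma absB_le c x y : abs x <= c -> abs y <= c -> abs (x - y) <= c.
Proof. by move=> hx hy; apply: absD_le; rewrite ?absN. Qed.
Lemma absD_lt c x y : abs x < c -> abs y < c -> abs (x + y) < c.
Proof.
move=> hx hy; case: na => _ _ _ h; apply: le_lt_trans (h x y) _.
by rewrite gt_max hx hy.
Qed.
Lemma absB_lt c x y : abs x < c -> abs y < c -> abs (x - y) < c.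
Proof. by move=> hx hy; apply: absD_lt; rewrite ?absN. Qed.
Lemma absDl x y : abs y < abs x -> abs (x + y) = abs x.
Proof.
move=> h; apply/eqP; rewrite eq_le absD_le ?(ltW h) //= leNgt; apply/negP => h2.
have : abs (x + y - y) < abs x by apply: absB_lt.
by rewrite addrK ltxx.
Qed.
Lemma absBl x y : abs y < abs x -> abs (x - y) = abs x.
Proof. by move=> h; apply: absDl; rewrite absN. Qed.
Lemma absDr x y : abs y < abs x -> abs (y + x) = abs x.
Proof. by rewrite addrC; apply: absDl. Qed.
Lemma absBr x y : abs y < abs x -> abs (y - x) = abs x.
Proof. by rewrite absB; apply: absBl. Qed.
Lemma abs_nat n : abs n%:R <= 1.
Proof.
by elim: n => [|n IHn]; rewrite ?abs0 // -natr1; apply: absD_le; rewrite ?abs1.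
Qed.
Lemma abs_natM n x : abs (n%:R * x) <= abs x.
Proof. by rewrite absM; apply: ler_piMl; rewrite ?abs_ge0 ?abs_nat. Qed.
Lemma abs_natM_le n x c : abs x <= c -> abs (n%:R * x) <= c.
Proof. exact: le_trans (abs_natM n x). Qed.
Lemma abs_natM_lt n x c : abs x < c -> abs (n%:R * x) < c.
Proof. exact: le_lt_trans (abs_natM n x). Qed.

Lemma abs_close x y : abs (x - y) < abs y -> abs x = abs y.
Proof. by move=> h; rewrite -[in LHS](subrK y x) absDr. Qed.

Hypothesis cpl : abs_complete abs.

(* Fixed point iteration for [w |-> f - w ^+ 2]. *)
Lemma artin_schreier_root f : abs f < 1 -> exists w, w ^+ 2 + w = f /\ abs w <= abs f.
Proof.
move=> f1; pose s n := iter n (fun w => f - w ^+ 2) 0.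
have sS n : s n.+1 = f - s n ^+ 2 by [].
have sle n : abs (s n) <= abs f.
  elim: n => [|n IHn]; first by rewrite abs0 abs_ge0.
  rewrite sS; apply: absB_le => //; rewrite absX expr2.
  have := abs_ge0 (s n); nra.
have sd n : abs (s n.+1 - s n) <= abs f ^+ n.
  elim: n => [|n IHn]; first by rewrite expr0 absB_le // ltW // (le_lt_trans (sle _)).
  rewrite sS [s n.+1 in X in _ - X]sS.
  have -> : f - s n.+1 ^+ 2 - (f - s n ^+ 2) = - ((s n.+1 + s n) * (s n.+1 - s n)) by ring.
  rewrite absN absM exprS; apply: ler_pM; rewrite ?abs_ge0 //.
  exact: absD_le.
have sdk n k : abs (s (n + k)%N - s n) <= abs f ^+ n.
  elim: k => [|k IHk]; first by rewrite addn0 subrr abs0 exprn_ge0 ?abs_ge0.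
  rewrite addnS -(subrK (s (n + k)%N) (s (n + k).+1)) -addrA.
  apply: absD_le => //; apply: le_trans (sd _) _.
  by rewrite ler_wiXn2l ?abs_ge0 ?(ltW f1) ?leq_addr.
have [|w Hw] := cpl (f := s).
  move=> e e0; have [n Hn] := exprn_small (abs_ge0 f) f1 e0.
  exists n => i j ni nj; wlog ij : i j ni nj / (i <= j)%N.
    by move=> H; case/orP: (leq_total i j) => ?; [|rewrite absB]; apply: H.
  rewrite absB -(subnKC ij); apply: le_lt_trans (sdk _ _) _; exact: Hn.
have wf : abs w <= abs f.
  rewrite leNgt; apply/negP => h.
  have w0 : 0 < abs w by apply: le_lt_trans h; apply: abs_ge0.
  have [n Hn] := Hw _ w0; have := Hn n (leqnn n) => /abs_close hn.
  by have := sle n; rewrite hn leNgt h.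
exists w; split => //; apply/eqP; rewrite -subr_eq0 -abs_eq0; apply/eqP.
apply/eqP; rewrite eq_le abs_ge0 andbT leNgt; apply/negP => h.
have [n Hn] := Hw _ h.
have h1 := Hn n (leqnn n); have h2 := Hn n.+1 (leqnSn n).
have : abs (w ^+ 2 + w - f) < abs (w ^+ 2 + w - f); last by rewrite ltxx.
rewrite [X in abs X < _](_ : _ = - ((s n + w) * (s n - w) + (s n.+1 - w))); last first.
  by rewrite sS; ring.
rewrite absN; apply: absD_lt => //; rewrite absM.
have h3 : abs (s n + w) <= abs f by apply: absD_le.
have := abs_ge0 (s n - w); have := abs_ge0 (s n + w); nra.
Qed.

End ValuedField.

(** * The b-invariants under affine changes of x *)

Record bcoef (K : Type) := BCoef { c2 : K; c4 : K; c6 : K; c8 : K }.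

Section Bcoef.
Variable K : fieldType.
Implicit Types (B : bcoef K) (x : K).

(** The invariants after moving x to the origin. As functions of x, [c6] becomes the square of the
    2-division polynomial psi_2 and [c8] the 3-division polynomial psi_3. *)
Definition bshift B x := BCoef (c2 B + 12%:R * x)
  (c4 B + c2 B * x + 6%:R * x ^+ 2)
  (c6 B + 2%:R * c4 B * x + c2 B * x ^+ 2 + 4%:R * x ^+ 3)
  (c8 B + 3%:R * c6 B * x + 3%:R * c4 B * x ^+ 2 + c2 B * x ^+ 3 + 3%:R * x ^+ 4).

Lemma c2_shift B x : c2 (bshift B x) = c2 B + 12%:R * x. Proof. by []. Qed.
Lemma c4_shift B x : c4 (bshift B x) = c4 B + c2 B * x + 6%:R * x ^+ 2.
Proof. by []. Qed.
Lemma c6_shift B x : c6 (bshift B x) =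
  c6 B + 2%:R * c4 B * x + c2 B * x ^+ 2 + 4%:R * x ^+ 3.
Proof. by []. Qed.
Lemma c8_shift B x : c8 (bshift B x) =
  c8 B + 3%:R * c6 B * x + 3%:R * c4 B * x ^+ 2 + c2 B * x ^+ 3 + 3%:R * x ^+ 4.
Proof. by []. Qed.

Definition bscale B k := BCoef (c2 B / k) (c4 B / k ^+ 2) (c6 B / k ^+ 3) (c8 B / k ^+ 4).

Definition bdisc B := - c2 B ^+ 2 * c8 B - 8%:R * c4 B ^+ 3 - 27%:R * c6 B ^+ 2
                     + 9%:R * c2 B * c4 B * c6 B.

(** The numerator of x(2P), with denominator [c6 (bshift B x)]. *)
Definition bnum B x := x ^+ 4 - c4 B * x ^+ 2 - 2%:R * c6 B * x - c8 B.

(** With [bprod], the numerators over (x - y)^2 of the sum and the product of x(P + Q) and x(P - Q);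
    the x-line determines these two values only up to order. *)
Definition bsum B x y :=
  2%:R * x * y * (x + y) + c2 B * x * y + c4 B * (x + y) + c6 B.
Definition bprod B x y :=
  x ^+ 2 * y ^+ 2 - c4 B * x * y - c6 B * (x + y) - c8 B.

Definition brel B := 4%:R * c8 B = c2 B * c6 B - c4 B ^+ 2.

Lemma brel_shift B x : brel B -> brel (bshift B x).
Proof.
rewrite /brel /bshift /= => h.
transitivity (4%:R * c8 B + 4%:R * (3%:R * c6 B * x + 3%:R * c4 B * x ^+ 2 + c2 B * x ^+ 3 + 3%:R * x ^+ 4)); first ring.
rewrite h; ring.
Qed.

Lemma brel_scale B k : k != 0 -> brel B -> brel (bscale B k).
Proof.
rewrite /brel /bscale /= => k0 h.
transitivity ((4%:R * c8 B) / k ^+ 4); first by field.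
by rewrite h; field.
Qed.

Lemma bdisc_shift B x : brel B -> bdisc (bshift B x) = bdisc B.
Proof.
rewrite /brel /bdisc /bshift /= => h.
apply/eqP; rewrite -subr_eq0; apply/eqP.
transitivity ((4%:R * c8 B - (c2 B * c6 B - c4 B ^+ 2)) *
  (- 6%:R * (c2 B * x + 6%:R * x ^+ 2))); first ring.
by rewrite h subrr mul0r.
Qed.

Lemma bdisc_scale B k : k != 0 -> bdisc (bscale B k) = bdisc B / k ^+ 6.
Proof. by rewrite /bdisc /bscale /= => k0; field. Qed.

Lemma bshift_affine B r k x : k != 0 ->
  bshift (bscale (bshift B r) k) x = bscale (bshift B (r + k * x)) k.
Proof. by rewrite /bshift /bscale /= => k0; congr BCoef; field. Qed.

Lemma bnum_affine B r k x : k != 0 ->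
  bnum (bscale (bshift B r) k) x =
  (bnum B (r + k * x) - r * c6 (bshift B (r + k * x))) / k ^+ 4.
Proof. by rewrite /bnum /bshift /bscale /= => k0; field. Qed.

Lemma bsum_affine B r k x y : k != 0 ->
  bsum (bscale (bshift B r) k) x y =
  (bsum B (r + k * x) (r + k * y) - 2%:R * r * (k * (x - y)) ^+ 2) / k ^+ 3.
Proof. by rewrite /bsum /bshift /bscale /= => k0; field. Qed.

Lemma bprod_affine B r k x y : k != 0 ->
  bprod (bscale (bshift B r) k) x y =
  (bprod B (r + k * x) (r + k * y) - r * bsum B (r + k * x) (r + k * y)
   + r ^+ 2 * (k * (x - y)) ^+ 2) / k ^+ 4.
Proof. by rewrite /bprod /bsum /bshift /bscale /= => k0; field. Qed.

End Bcoef.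

Arguments c2 : simpl never.
Arguments c4 : simpl never.
Arguments c6 : simpl never.
Arguments c8 : simpl never.

(** * Heights on the x-line *)

Section Kummer.
Variables (R : realType) (K : fieldType) (abs : K -> R).
Hypothesis na : is_nonarch_abs abs.
Variables (G : zmodType) (lam : G -> R).
Implicit Types (B : bcoef K) (X : G -> option K) (P Q : G) (x y z w : K).

(* The x-coordinate and the local height of an elliptic curve, stripped of the
   y-coordinate: unlike a Weierstrass equation, this data can be rescaled by
   [x = r + k x'] even when [k] is not a square. *)
Record kummer B X : Prop := Kummer {
  kummer_rel : brel B;
  kummer_disc : bdisc B != 0;
  kummer_0 : X 0 = None;
  kummer_None : forall P, X P = None -> P = 0;
  kummer_opp : forall P, X (- P) = X P;
  kummer_inj : forall P Q, X P = X Q -> P = Q \/ P = - Q;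
  kummer_add : forall P Q x y, X P = Some x -> X Q = Some y -> x != y ->
    exists z w, [/\ X (P + Q) = Some z, X (P - Q) = Some w,
      (z + w) * (x - y) ^+ 2 = bsum B x y & z * w * (x - y) ^+ 2 = bprod B x y];
  kummer_dbl : forall P x, X P = Some x -> c6 (bshift B x) != 0 ->
    exists2 z, X (P + P) = Some z & z * c6 (bshift B x) = bnum B x;
  kummer_dbl0 : forall P x, X P = Some x -> c6 (bshift B x) = 0 -> P + P = 0;
  kummer_low : exists C, forall P x, X P = Some x ->
    2%:R^-1 * ln (Num.max 1 (abs x)) - C <= lam P;
  kummer_lam_dbl : forall P x, X P = Some x -> c6 (bshift B x) != 0 ->
    lam (P + P) = 4%:R * lam P - 2%:R^-1 * ln (abs (c6 (bshift B x)))
                  + 4%:R^-1 * ln (abs (bdisc B));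
  kummer_approx : forall P x, X P = Some x -> c6 (bshift B x) = 0 ->
    forall d e : R, 0 < d -> 0 < e -> exists Q y,
    [/\ X Q = Some y, abs (y - x) < d, c6 (bshift B y) != 0 & `|lam Q - lam P| < e] }.

(** The same [lam] serves for both equations: the factors k^-3 in [c6] and k^-6 in the discriminant
    cancel in the duplication formula, because 3/2 = 6/4. *)
Lemma kummer_affine B X r k : k != 0 -> kummer B X ->
  kummer (bscale (bshift B r) k) (fun P => omap (fun x => (x - r) / k) (X P)).
Proof.
move=> k0 [Hrel Hd H0 HN Hopp Hinj Hadd Hdbl Hdbl0 [C HC] Hlam Happ].
have k0' : 0 < abs k by rewrite abs_gt0.
have aff x : r + k * ((x - r) / k) = x by rewrite mulrCA divff // mulr1 addrC subrK.
have d6 x : c6 (bshift (bscale (bshift B r) k) ((x - r) / k)) = c6 (bshift B x) / k ^+ 3.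
  by rewrite bshift_affine // aff.
have d60 x : (c6 (bshift (bscale (bshift B r) k) ((x - r) / k)) == 0) =
   (c6 (bshift B x) == 0).
  by rewrite d6 mulf_eq0 invr_eq0 expf_eq0 (negPf k0) andbF orbF.
split => //.
- by apply: brel_scale => //; apply: brel_shift.
- by rewrite bdisc_scale // bdisc_shift // mulf_neq0 // invr_eq0 expf_neq0.
- by rewrite H0.
- by move=> P; case E: (X P) => [x|] //= _; apply: HN.
- by move=> P; rewrite Hopp.
- move=> P Q h; apply: Hinj; case: (X P) (X Q) h => [x|] [y|] //= [] h.
  by rewrite -(aff x) h aff.
- move=> P Q x' y'; case EP: (X P) => [x|] //= [<-]; case EQ: (X Q) => [y|] //= [<-] ne.
  have ne' : x != y by apply: contraNneq ne => ->.
  have [z [w [-> -> e1 e2]]] := Hadd _ _ _ _ EP EQ ne'.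
  exists ((z - r) / k), ((w - r) / k); split => //.
    by rewrite bsum_affine // !aff -e1; field.
  by rewrite bprod_affine // !aff -e1 -e2; field.
- move=> P x'; case EP: (X P) => [x|] //= [<-]; rewrite d60 => ne.
  have [z -> e1] := Hdbl _ _ EP ne.
  by exists ((z - r) / k) => //=; rewrite d6 bnum_affine // aff -e1; field.
- move=> P x'; case EP: (X P) => [x|] //= [<-] /eqP; rewrite d60 => /eqP.
  exact: Hdbl0 EP.
(* An affine change of x alters max(1, |x|) by a bounded factor, which goes into the additive
   constant. *)
- set c := 1 + Num.max 1 (abs r) / abs k.
  have r1 : 1 <= Num.max 1 (abs r) by rewrite le_max lexx.
  have c1 : 0 < c by rewrite addr_gt0 // divr_gt0 // (lt_le_trans _ r1).
  exists (C + 2%:R^-1 * ln c) => P x'; case EP: (X P) => [x|] //= [<-].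
  apply: le_trans (HC _ _ EP).
  have x1 : 1 <= Num.max 1 (abs x) by rewrite le_max lexx.
  have m0 : 0 < Num.max 1 (abs ((x - r) / k)) by rewrite lt_max ltr01.
  have h : Num.max 1 (abs ((x - r) / k)) <= c * Num.max 1 (abs x).
    have -> : c * Num.max 1 (abs x) = Num.max 1 (abs x)
        + Num.max 1 (abs r) / abs k * Num.max 1 (abs x) by rewrite /c; ring.
    rewrite ge_max; apply/andP; split.
      by rewrite ler_wpDr // mulr_ge0 ?divr_ge0 ?(le_trans _ x1) ?(le_trans _ r1) // ltW.
    apply: ler_wpDl; first exact: le_trans x1.
    rewrite (absM na) (absV na) mulrAC ler_pM2r ?invr_gt0 //.
    apply: absB_le => //.
      apply: (@le_trans _ _ (Num.max 1 (abs x))); first by rewrite le_max lexx orbT.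
      by apply: ler_peMl => //; apply: le_trans x1.
    apply: (@le_trans _ _ (Num.max 1 (abs r))); first by rewrite le_max lexx orbT.
    by apply: ler_peMr => //; apply: le_trans r1.
  have : ln (Num.max 1 (abs ((x - r) / k))) <= ln (c * Num.max 1 (abs x)).
    by rewrite ler_ln // posrE // mulr_gt0 // (lt_le_trans _ x1).
  by rewrite lnM ?posrE // ?(lt_le_trans _ x1) //; lra.
- move=> P x'; case EP: (X P) => [x|] //= [<-]; rewrite d60 => ne.
  rewrite (Hlam _ _ EP ne) d6 bdisc_scale // bdisc_shift //.
  rewrite !(absM na) !(absV na) !(absX na) !lnM ?posrE ?invr_gt0 ?exprn_gt0 ?abs_gt0 //.
  rewrite !lnV ?posrE ?exprn_gt0 // !lnXn //; lra.
- move=> P x'; case EP: (X P) => [x|] //= [<-] /eqP; rewrite d60 => /eqP e0 d e dp ep.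
  have dk : 0 < d * abs k by rewrite mulr_gt0.
  have [Q [y [EQ h1 h2 h3]]] := Happ _ _ EP e0 _ _ dk ep.
  exists Q, ((y - r) / k); split; rewrite ?EQ ?d60 //.
  have -> : (y - r) / k - (x - r) / k = (y - x) / k by field.
  by rewrite (absM na) (absV na) ltr_pdivrMr.
Qed.

(** A deficit l - lam of at most b at 2P is one of at most b/4 at P, so a uniform bound b improves
    to b/4^n for every n. [S] is a region stable under duplication on which l behaves. Near a
    2-torsion point l may not drop, so that an approximating point can replace it. *)
Lemma kummer_lower B X (S : K -> Prop) (l : K -> R) : kummer B X ->
  (exists C, forall x, S x -> l x <= 2%:R^-1 * ln (Num.max 1 (abs x)) + C) ->
  (forall x z, S x -> c6 (bshift B x) != 0 -> z * c6 (bshift B x) = bnum B x ->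
     S z /\ 4%:R * l x - 2%:R^-1 * ln (abs (c6 (bshift B x)))
                  + 4%:R^-1 * ln (abs (bdisc B)) <= l z) ->
  (forall x, S x -> c6 (bshift B x) = 0 -> exists2 d : R, 0 < d &
     forall y, abs (y - x) < d -> S y /\ l x <= l y) ->
  forall P x, X P = Some x -> S x -> l x <= lam P.
Proof.
move=> [_ _ _ _ _ _ _ Hdbl _ [C HC] Hlam Happ] [C' HC'] H2 H3.
pose b := Num.max 0 (C + C').
have b0 : 0 <= b by rewrite le_max lexx.
have main n P x : X P = Some x -> S x -> l x - b * 4%:R^-1 ^+ n <= lam P.
  elim: n P x => [|n IHn] P x EP Sx.
    have := HC _ _ EP; have := HC' _ Sx.
    have : C + C' <= b by rewrite le_max lexx orbT.
    rewrite expr0; lra.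
  have step Q y : X Q = Some y -> S y -> c6 (bshift B y) != 0 ->
      l y - b * 4%:R^-1 ^+ n.+1 <= lam Q.
    move=> EQ Sy ne; have [z Ez ez] := Hdbl _ _ EQ ne.
    have [Sz lz] := H2 _ _ Sy ne ez.
    have := IHn _ _ Ez Sz; rewrite (Hlam _ _ EQ ne) exprS.
    set q := _ ^+ n; lra.
  have [e0|ne] := eqVneq (c6 (bshift B x)) 0; last exact: step.
  rewrite leNgt; apply/negP => h.
  have [d d0 Hd] := H3 _ Sx e0.
  have e1 : 0 < l x - b * 4%:R^-1 ^+ n.+1 - lam P by rewrite subr_gt0.
  have [Q [y [EQ yx ne]]] := Happ _ _ EP e0 _ _ d0 e1.
  have [Sy ly] := Hd _ yx; have := step _ _ EQ Sy ne.
  rewrite ltr_norml => ? /andP[]; lra.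
move=> P x EP Sx; rewrite leNgt; apply/negP => h.
have e1 : 0 < (l x - lam P) / (b + 1) by rewrite divr_gt0 ?subr_gt0 // ltr_wpDl.
have q0 : 0 <= 4%:R^-1 :> R by lra.
have q1 : 4%:R^-1 < 1 :> R by lra.
have [n Hn] := exprn_small q0 q1 e1.
have := main n _ _ EP Sx; have := Hn n (leqnn n).
rewrite ltr_pdivlMr; last by rewrite ltr_wpDl.
have := exprn_ge0 n q0; set q := _ ^+ n; nra.
Qed.

End Kummer.

(** * Duplication and division polynomials *)

Section BDouble.
Variable K : fieldType.
Implicit Types (B : bcoef K) (x y z : K).

Lemma bshiftD B x t : bshift (bshift B x) t = bshift B (x + t).
Proof. by rewrite /bshift /c2 /c4 /c6 /c8; congr BCoef; ring. Qed.

Lemma bnumE B x : bnum B x = x * c6 (bshift B x) - c8 (bshift B x).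
Proof. by rewrite /bnum /bshift /c2 /c4 /c6 /c8; ring. Qed.

(** With x moved to the origin, x(2P) is -b_8/b_6 and b_4 b_8 - b_6^2 is psi_4/psi_2 at P; the
    identity is psi_4(P) = psi_2(2P) psi_2(P)^4, squared. *)
Lemma dbl_c6 B x z : brel B -> c6 (bshift B x) != 0 -> z * c6 (bshift B x) = bnum B x ->
  c6 (bshift B z) * c6 (bshift B x) ^+ 3 =
  (c4 (bshift B x) * c8 (bshift B x) - c6 (bshift B x) ^+ 2) ^+ 2.
Proof.
move=> hr ne; rewrite bnumE => e.
have -> : z = x + - (c8 (bshift B x) / c6 (bshift B x)).
  by apply: (mulIf ne); rewrite e; field.
rewrite -bshiftD; have := brel_shift x hr; move: ne {e}.
case: (bshift B x) => b2 b4 b6 b8; rewrite /brel /bshift /c2 /c4 /c6 /c8 => ne h.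
transitivity (b6 ^+ 4 - 2%:R * b4 * b8 * b6 ^+ 2 + b8 ^+ 2 * (b2 * b6 - 4%:R * b8)).
  by field.
by rewrite h; ring.
Qed.

(** Both sides are psi_6/psi_2 at P: the left one by psi_6(P) = psi_3(2P) psi_2(P)^9, the right one
    by the recursion psi_6/psi_2 = psi_3 (psi_5 - (psi_4/psi_2)^2) with psi_5 = psi_4 psi_2^3 -
    psi_3^3. *)
Lemma dbl_c8 B x z : brel B -> c6 (bshift B x) != 0 -> z * c6 (bshift B x) = bnum B x ->
  c8 (bshift B z) * c6 (bshift B x) ^+ 4 = c8 (bshift B x) *
  (- (c4 (bshift B x) * c8 (bshift B x) - c6 (bshift B x) ^+ 2) ^+ 2
   - c8 (bshift B x) ^+ 3
   + c6 (bshift B x) ^+ 2 * (c4 (bshift B x) * c8 (bshift B x) - c6 (bshift B x) ^+ 2)).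
Proof.
move=> hr ne; rewrite bnumE => e.
have -> : z = x + - (c8 (bshift B x) / c6 (bshift B x)).
  by apply: (mulIf ne); rewrite e; field.
rewrite -bshiftD; have := brel_shift x hr; move: ne {e}.
case: (bshift B x) => b2 b4 b6 b8; rewrite /brel /bshift /c2 /c4 /c6 /c8 => ne h.
transitivity (b8 * (- b8 ^+ 2 * (b2 * b6 - 4%:R * b8) - b8 ^+ 3 + 3%:R * b4 * b8 * b6 ^+ 2
   - 2%:R * b6 ^+ 4)).
  by field.
by rewrite h; ring.
Qed.

End BDouble.

Section Mu.
Variables (R : realType) (K : fieldType) (abs : K -> R).
Hypothesis na : is_nonarch_abs abs.
Let ag0 x : 0 <= abs x := abs_ge0 na x.
Implicit Types (B : bcoef K) (x y z : K).

Lemma real_root (a : R) n : (0 < n)%N -> 0 <= a -> exists2 r, 0 <= r & r ^+ n = a.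
Proof.
move=> n0; rewrite le_eqVlt => /orP[/eqP<-|a0].
  by exists 0; rewrite ?expr0n // eqn0Ngt n0.
exists (sequences.expR (ln a / n%:R)); first exact: expR_ge0.
by rewrite -expRM_natl mulrCA divff ?mulr1 ?lnK ?posrE // pnatr_eq0 -lt0n.
Qed.

(** The exponents bring b_6 and b_8, of weights 6 and 8, to the common weight 24. For integral B a
    value below 1 means singular reduction. *)
Definition bmu B x : R :=
  Num.max (abs (c6 (bshift B x)) ^+ 4) (abs (c8 (bshift B x)) ^+ 3).

Lemma bmu_ge0 B x : 0 <= bmu B x.
Proof. by rewrite le_max exprn_ge0 ?ag0. Qed.

(** Write [bmu B x] = M^24. If |b_8| < M^8, then |b_6| = M^6 and b_4 b_8 - b_6^2 has the full size
    M^12, so b_6 at 2P is large. If |b_8| = M^8 and b_4 b_8 - b_6^2 is smaller than M^12, then b_8^3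
    dominates the second factor in [dbl_c8] and b_8 at 2P is large. *)
Lemma bmu_dbl B x z : brel B -> c6 (bshift B x) != 0 ->
  z * c6 (bshift B x) = bnum B x -> 0 < bmu B x -> abs (c4 (bshift B x)) ^+ 6 <= bmu B x ->
  bmu B x ^+ 4 <= bmu B z * abs (c6 (bshift B x)) ^+ 12.
Proof.
move=> hr ne ez mu0 h4.
have e6 := dbl_c6 hr ne ez; have e8 := dbl_c8 hr ne ez.
(* With this root every b_i is bounded by M^i, and all estimates become homogeneous. *)
have [M M0 EM] := real_root (n := 24) isT (ltW mu0).
have Mgt : 0 < M.
  by rewrite lt_neqAle M0 andbT; apply: contraTneq mu0 => e0; rewrite -EM -e0 expr0n ltxx.
rewrite /(bmu B z) maxr_pMl; last by rewrite exprn_ge0 ?ag0.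
have -> : abs (c6 (bshift B z)) ^+ 4 * abs (c6 (bshift B x)) ^+ 12 =
  abs (c6 (bshift B z) * c6 (bshift B x) ^+ 3) ^+ 4.
  by rewrite (absM na) (absX na) exprMn -exprM.
have -> : abs (c8 (bshift B z)) ^+ 3 * abs (c6 (bshift B x)) ^+ 12 =
  abs (c8 (bshift B z) * c6 (bshift B x) ^+ 4) ^+ 3.
  by rewrite (absM na) (absX na) exprMn -exprM.
rewrite e6 e8 -EM -exprM.
have l4 : abs (c4 (bshift B x)) <= M ^+ 4.
  by rewrite -(@ler_pXn2r _ 6) ?nnegrE ?ag0 ?exprn_ge0 // -exprM EM.
have l6 : abs (c6 (bshift B x)) <= M ^+ 6.
  rewrite -(@ler_pXn2r _ 4) ?nnegrE ?ag0 ?exprn_ge0 // -exprM EM.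
  by rewrite le_max lexx.
have l8 : abs (c8 (bshift B x)) <= M ^+ 8.
  rewrite -(@ler_pXn2r _ 3) ?nnegrE ?ag0 ?exprn_ge0 // -exprM EM.
  by rewrite le_max lexx orbT.
have a6 : M ^+ 24 = abs (c6 (bshift B x)) ^+ 4 \/ M ^+ 24 = abs (c8 (bshift B x)) ^+ 3.
  by rewrite EM /bmu maxEle; case: ifP; [right | left].
move: (c4 _) (c6 _) (c8 _) l4 l6 l8 a6 => b4 b6 b8 l4 l6 l8 a6.
rewrite le_max; have [h8|h8] := ltP (abs b8) (M ^+ 8).
  have e : abs b6 = M ^+ 6.
    case: a6 => [a6|a6].
      by apply/eqP; rewrite -(@eqrXn2 _ 4) ?ag0 // ?exprn_ge0 // -a6 -exprM.
    have : abs b8 ^+ 3 < (M ^+ 8) ^+ 3 by rewrite ltr_pXn2r ?nnegrE ?ag0 ?exprn_ge0.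
    by rewrite -a6 -exprM ltxx.
  have h : abs (b4 * b8 - b6 ^+ 2) = M ^+ 12.
    rewrite (absBr na) (absX na) e -?exprM // (absM na).
    have -> : M ^+ (6 * 2) = M ^+ 4 * M ^+ 8 by rewrite -exprD.
    by apply: ler_ltM => //; rewrite ?ag0 ?exprn_gt0.
  by rewrite !(absX na) h -!exprM lexx.
have e8' : abs b8 = M ^+ 8 by apply/le_anti; rewrite l8.
apply/orP; case: (leP (M ^+ 96) (abs ((b4 * b8 - b6 ^+ 2) ^+ 2) ^+ 4)) => [|hF]; [by left|right].
have h12 : abs (b4 * b8 - b6 ^+ 2) < M ^+ 12.
  by rewrite -(@ltr_pXn2r _ 8) ?nnegrE ?ag0 ?exprn_ge0 // -exprM; rewrite (absX na) -exprM in hF.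
have h24 : abs (- (b4 * b8 - b6 ^+ 2) ^+ 2 - b8 ^+ 3 + b6 ^+ 2 * (b4 * b8 - b6 ^+ 2)) = M ^+ 24.
  have e24 : abs (b8 ^+ 3) = M ^+ 24 by rewrite (absX na) e8' -exprM.
  have -> : forall u v w : K, - u - v + w = - (v + (u - w)) by move=> *; ring.
  rewrite (absN na) (absDl na) // e24; apply: (absB_lt na).
    rewrite (absX na) -[24%N]/(12 * 2)%N exprM.
    by rewrite ltr_pXn2r ?nnegrE ?ag0 ?exprn_ge0.
  rewrite (absM na) -[24%N]/(12 + 12)%N exprD.
  apply: ler_ltM => //; rewrite ?ag0 ?exprn_gt0 //.
  by rewrite (absX na) -[12%N]/(6 * 2)%N exprM ler_pXn2r ?nnegrE ?ag0 ?exprn_ge0.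
by rewrite (absM na) h24 e8' -exprD -exprM.
Qed.

Definition bintegral B := [/\ abs (c2 B) <= 1, abs (c4 B) <= 1, abs (c6 B) <= 1 & abs (c8 B) <= 1].

Lemma term_le (c x : K) (m : R) i j : abs c <= 1 -> 1 <= m -> abs x <= m -> (i <= j)%N ->
  abs (c * x ^+ i) <= m ^+ j.
Proof.
move=> c1 m1 xm ij; rewrite (absM na) (absX na) -[m ^+ j]mul1r.
have m0 : 0 <= m by apply: le_trans m1.
apply: ler_pM; rewrite ?exprn_ge0 ?ag0 //.
apply: le_trans (_ : m ^+ i <= _); last by rewrite ler_weXn2l.
by rewrite lerXn2r ?nnegrE ?ag0.
Qed.

Lemma bshift_le B x (m : R) : bintegral B -> 1 <= m -> abs x <= m ->
  [/\ abs (c2 (bshift B x)) <= m, abs (c4 (bshift B x)) <= m ^+ 2,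
      abs (c6 (bshift B x)) <= m ^+ 3 & abs (c8 (bshift B x)) <= m ^+ 4].
Proof.
case=> h2 h4 h6 h8 m1 xm.
have m0 : 0 <= m by apply: le_trans m1.
have nt n (c : K) : abs c <= 1 -> abs (n%:R * c) <= 1 by apply: abs_natM_le.
have n1 n := abs_nat na n.
have tm c i j : abs c <= 1 -> (i <= j)%N -> abs (c * x ^+ i) <= m ^+ j.
  by move=> ? ?; apply: term_le.
have t0 c j : abs c <= 1 -> abs c <= m ^+ j.
  by move=> c1; have := tm c 0%N j c1 isT; rewrite expr0 mulr1.
have t1 c j : abs c <= 1 -> abs (c * x) <= m ^+ j.+1.
  by move=> c1; have := tm c 1%N j.+1 c1 isT; rewrite expr1.
rewrite c2_shift c4_shift c6_shift c8_shift; split.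
- by rewrite -[m]expr1; exact: (absD_le na (t0 _ 1%N h2) (t1 _ 0%N (n1 _))).
- exact: (absD_le na (absD_le na (t0 _ 2%N h4) (t1 _ 1%N h2)) (tm _ 2%N 2%N (n1 _) isT)).
- exact: (absD_le na (absD_le na (absD_le na (t0 _ 3%N h6) (t1 _ 2%N (nt _ _ h4)))
    (tm _ 2%N 3%N h2 isT)) (tm _ 3%N 3%N (n1 _) isT)).
- exact: (absD_le na (absD_le na (absD_le na (absD_le na (t0 _ 4%N h8)
    (t1 _ 3%N (nt _ _ h6))) (tm _ 2%N 4%N (nt _ _ h4) isT))
    (tm _ 3%N 4%N h2 isT)) (tm _ 4%N 4%N (n1 _) isT)).
Qed.

Lemma bmu_le B x (m : R) : bintegral B -> 1 <= m -> abs x <= m -> bmu B x <= m ^+ 12.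
Proof.
move=> hB m1 xm; have [_ _ h6 h8] := bshift_le hB m1 xm.
have m0 : 0 <= m by apply: le_trans m1.
rewrite /bmu ge_max -[12%N in X in _ <= X]/(3 * 4)%N [m ^+ (3 * 4)]exprM.
rewrite lerXn2r ?nnegrE ?ag0 ?exprn_ge0 //= -exprM -[(3 * 4)%N]/(4 * 3)%N exprM.
by rewrite lerXn2r ?nnegrE ?ag0 ?exprn_ge0.
Qed.

(** The leading terms of b_6 and b_8 at x are 4 x^3 and 3 x^4, and 4 - 3 = 1 prevents 3 and 4 from
    both being small. *)
Lemma bmu_big B x : bintegral B -> 1 < abs x -> abs x ^+ 12 <= bmu B x.
Proof.
case=> h2 h4 h6 h8 x1; have x0 : 0 < abs x by apply: lt_trans x1.
have lo c i j : abs c <= 1 -> (i < j)%N -> abs (c * x ^+ i) < abs x ^+ j.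
  move=> c1 ij; apply: le_lt_trans (term_le c1 (ltW x1) (lexx _) (leqnn i)) _.
  by rewrite ltr_eXn2l.
have nt n (c : K) : abs c <= 1 -> abs (n%:R * c) <= 1 by apply: abs_natM_le.
have l0 c j : abs c <= 1 -> abs c < abs x ^+ j.+1.
  by move=> c1; have := lo c 0%N j.+1 c1 isT; rewrite expr0 mulr1.
have l1 c j : abs c <= 1 -> abs (c * x) < abs x ^+ j.+2.
  by move=> c1; have := lo c 1%N j.+2 c1 isT; rewrite expr1.
rewrite le_max; apply/orP.
have : 1 <= abs (4%:R : K) \/ 1 <= abs (3%:R : K).
  have [h|h] := leP 1 (abs (4%:R : K)); [by left|right].
  have <- : abs (4%:R - 3%:R : K) = 1 by rewrite -(abs1 na); congr abs; ring.
  rewrite leNgt; apply/negP => h3.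
  have : abs (4%:R - 3%:R : K) < abs (4%:R - 3%:R : K).
    by apply: absB_lt => //; apply: lt_le_trans h _;
       rewrite -(abs1 na) le_eqVlt; apply/orP; left; apply/eqP; congr abs; ring.
  by rewrite ltxx.
have an n : 1 <= abs (n%:R : K) -> abs (n%:R : K) = 1.
  by move=> h; apply/le_anti; rewrite h abs_nat.
case=> /an hn; [left|right].
  have -> : abs (c6 (bshift B x)) = abs x ^+ 3; last by rewrite -exprM.
  have e : abs (4%:R * x ^+ 3) = abs x ^+ 3 by rewrite (absM na) hn mul1r (absX na).
  rewrite c6_shift -e; apply: (absDr na); rewrite e.
  exact: (absD_lt na (absD_lt na (l0 _ 2%N h6) (l1 _ 1%N (nt _ _ h4)))
    (lo _ 2%N 3%N h2 isT)).
have -> : abs (c8 (bshift B x)) = abs x ^+ 4; last by rewrite -exprM.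
have e : abs (3%:R * x ^+ 4) = abs x ^+ 4 by rewrite (absM na) hn mul1r (absX na).
rewrite c8_shift -e; apply: (absDr na); rewrite e.
exact: (absD_lt na (absD_lt na (absD_lt na (l0 _ 3%N h8) (l1 _ 2%N (nt _ _ h6)))
  (lo _ 2%N 4%N (nt _ _ h4) isT)) (lo _ 3%N 4%N h2 isT)).
Qed.

End Mu.

(** * Lower bounds on E_0 and for integral j *)

Section MuLower.
Variables (R : realType) (K : fieldType) (abs : K -> R).
Hypothesis na : is_nonarch_abs abs.
Let ag0 x : 0 <= abs x := abs_ge0 na x.
Variables (G : zmodType) (lam : G -> R).
Implicit Types (B : bcoef K) (X : G -> option K) (P Q : G) (x y z w : K).

(** At a 2-torsion point the linear term 3 b_6 t of the expansion of b_8 vanishes, and the rest is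
    t^2 times a quantity of size at most m^2; hence |b_8| is locally constant. *)
Lemma bmu_loc B x : bintegral abs B -> c6 (bshift B x) = 0 -> c8 (bshift B x) != 0 ->
  exists2 d : R, 0 < d & forall y, abs (y - x) < d -> bmu abs B x <= bmu abs B y.
Proof.
move=> hB e6 n8; set m := Num.max 1 (abs x).
have m1 : 1 <= m by rewrite le_max lexx.
have xm : abs x <= m by rewrite le_max lexx orbT.
have m0 : 0 < m by apply: lt_le_trans m1.
have [h2 h4 _ _] := bshift_le na hB m1 xm.
have g8 : 0 < abs (c8 (bshift B x)) by rewrite abs_gt0.
exists (Num.min 1 (abs (c8 (bshift B x)) / m ^+ 2)).
  by rewrite lt_min ltr01 divr_gt0 ?exprn_gt0.
move=> y; rewrite lt_min ltr_pdivlMr ?exprn_gt0 // => /andP[t1 t2].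
have -> : bmu abs B x = abs (c8 (bshift B x)) ^+ 3.
  by rewrite /bmu e6 (abs0 na) expr0n max_r // exprn_ge0.
rewrite /bmu le_max; apply/orP; right.
have -> : y = x + (y - x) by rewrite addrC subrK.
rewrite -bshiftD [c8 (bshift (bshift _ _) _)]c8_shift e6; move: (y - x) t1 t2 => t t1 t2.
set u := c8 (bshift B x) in g8 t2 *.
have -> : u + 3%:R * 0 * t + 3%:R * c4 (bshift B x) * t ^+ 2 + c2 (bshift B x) * t ^+ 3
    + 3%:R * t ^+ 4 = u + t ^+ 2 * (3%:R * c4 (bshift B x) + c2 (bshift B x) * t + 3%:R * t ^+ 2).
  by ring.
rewrite (absDl na) ?lexx //.
have m2 : m <= m ^+ 2 by rewrite ler_eXnr.
have m21 : 1 <= m ^+ 2 by apply: le_trans m2.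
have hl : abs (3%:R * c4 (bshift B x) + c2 (bshift B x) * t + 3%:R * t ^+ 2) <= m ^+ 2.
  apply: (absD_le na (absD_le na (abs_natM_le na _ h4) _) (abs_natM_le na _ _)).
    apply: le_trans m2; rewrite (absM na) -[m]mulr1.
    by apply: ler_pM => //; apply: ltW.
  by apply: le_trans m21; rewrite (absX na) exprn_ile1 // ltW.
apply: le_lt_trans t2; rewrite (absM na); apply: ler_pM => //.
by rewrite (absX na) expr2; have := ag0 t; nra.
Qed.

(** In logarithms [bmu_dbl] is the duplication inequality for log(bmu)/24 - log|disc|/12. The region
    bmu >= th is stable because |b_6|^12 <= bmu^3 turns [bmu_dbl] into bmu(P) <= bmu(2P). *)
Lemma kummer_mu_lower B X (th : R) : kummer abs lam B X -> bintegral abs B -> 0 < th ->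
  (forall x, th <= bmu abs B x -> abs (c4 (bshift B x)) ^+ 6 <= bmu abs B x) ->
  forall P x, X P = Some x -> th <= bmu abs B x ->
  24%:R^-1 * ln th - 12%:R^-1 * ln (abs (bdisc B)) <= lam P.
Proof.
move=> kum hB th0 h4 P x EP hx.
pose l x := 24%:R^-1 * ln (bmu abs B x) - 12%:R^-1 * ln (abs (bdisc B)).
apply: (@le_trans _ _ (l x)).
  have : ln th <= ln (bmu abs B x) by rewrite ler_ln ?posrE // (lt_le_trans th0).
  rewrite /l; lra.
have d0 : bdisc B != 0 by case: kum.
have hr : brel B by case: kum.
apply: (kummer_lower (S := fun x => th <= bmu abs B x) kum _ _ _ EP hx).
- exists (- 12%:R^-1 * ln (abs (bdisc B))) => {EP P hx}x hx; rewrite /l.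
  set m := Num.max 1 (abs x).
  have m1 : 1 <= m by rewrite le_max lexx.
  have m0 : 0 < m by apply: lt_le_trans m1.
  have := bmu_le na hB m1 (_ : abs x <= m); rewrite le_max lexx orbT => /(_ isT).
  rewrite -ler_ln ?posrE ?exprn_gt0 // ?(lt_le_trans th0) // lnXn // => h; lra.
- move=> {EP P hx}x z hx ne ez.
  have mu0 := lt_le_trans th0 hx.
  have h := bmu_dbl na hr ne ez mu0 (h4 _ hx).
  have g6 : 0 < abs (c6 (bshift B x)) by rewrite abs_gt0.
  have h6 : abs (c6 (bshift B x)) ^+ 12 <= bmu abs B x ^+ 3.
    rewrite -[12%N]/(4 * 3)%N exprM lerXn2r ?nnegrE ?exprn_ge0 ?(bmu_ge0 na) //.
    by rewrite /bmu le_max lexx.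
  have g12 : 0 < abs (c6 (bshift B x)) ^+ 12 by rewrite exprn_gt0.
  have hz : bmu abs B x <= bmu abs B z.
    rewrite -(ler_pM2r g12); apply: le_trans h.
    by rewrite exprS ler_pM2l.
  have muz : 0 < bmu abs B z by apply: lt_le_trans hz.
  split; first exact: le_trans hz.
  have : ln (bmu abs B x ^+ 4) <= ln (bmu abs B z * abs (c6 (bshift B x)) ^+ 12).
    by rewrite ler_ln ?posrE ?exprn_gt0 // mulr_gt0.
  rewrite lnM ?posrE // !lnXn // /l.
  set u := ln _; set v := ln _; set w := ln _; lra.
- move=> {EP P hx}x hx e6.
  have n8 : c8 (bshift B x) != 0.
    apply: contraTneq (lt_le_trans th0 hx) => e8.
    by rewrite /bmu e6 e8 (abs0 na) !expr0n maxxx ltxx.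
  have [d d0' Hd] := bmu_loc hB e6 n8; exists d => // y /Hd hy.
  split; first exact: le_trans hy.
  have := lt_le_trans th0 hx => mu0.
  have : ln (bmu abs B x) <= ln (bmu abs B y).
    by rewrite ler_ln ?posrE // (lt_le_trans mu0).
  rewrite /l; lra.
Qed.

Lemma kummer_E0_lower B X : kummer abs lam B X -> bintegral abs B ->
  forall P x, X P = Some x -> 1 <= bmu abs B x ->
  - 12%:R^-1 * ln (abs (bdisc B)) <= lam P.
Proof.
move=> kum hB P x EP hx.
have := kummer_mu_lower kum hB ltr01 _ EP hx; rewrite ln1 mulr0 add0r mulNr; apply.
move=> {EP P hx}x hx; have [x1|x1] := leP (abs x) 1.
  have [_ h4 _ _] := bshift_le na hB (lexx 1) x1.
  by apply: le_trans hx; rewrite exprn_ile1 // -(expr1n _ 2).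
have [_ h4 _ _] := bshift_le na hB (ltW x1) (lexx _).
apply: le_trans (bmu_big na hB x1); rewrite -[12%N]/(2 * 6)%N exprM.
by rewrite lerXn2r ?nnegrE ?exprn_ge0.
Qed.

(** The hypothesis is |c_4|^3 <= |disc|, that is |j| <= 1. Let |disc| = d^12. If bmu were below
    d^24, then b_2 and b_4 would be at most d^2 and d^4 and each term of the discriminant would be
    smaller than d^12. The threshold |disc|^2 is the one at which [kummer_mu_lower] yields 0. *)
Lemma bmu_potgood B x : brel B -> bdisc B != 0 ->
  abs (c2 B ^+ 2 - 24%:R * c4 B) ^+ 3 <= abs (bdisc B) ->
  abs (bdisc B) ^+ 2 <= bmu abs B x /\ abs (c4 (bshift B x)) ^+ 6 <= bmu abs B x.
Proof.
move=> hr; have := brel_shift x hr; rewrite -(bdisc_shift x hr).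
have -> : c2 B ^+ 2 - 24%:R * c4 B = c2 (bshift B x) ^+ 2 - 24%:R * c4 (bshift B x).
  by rewrite c2_shift c4_shift; ring.
rewrite /bmu /brel /bdisc; case: (bshift B x) => b2 b4 b6 b8.
rewrite /c2 /c4 /c6 /c8; set dl := (X in X != 0) => {}hr dl0 hc.
have dlp : 0 < abs dl by rewrite abs_gt0.
set mu := Num.max _ _.
have mu0 : 0 <= mu by rewrite le_max exprn_ge0.
have [d d0 Ed] := real_root (n := 12) isT (ltW dlp).
have dp : 0 < d.
  by rewrite lt_neqAle d0 andbT; apply: contraTneq dlp => e0; rewrite -Ed -e0 expr0n ltxx.
have [M M0 EM] := real_root (n := 24) isT mu0.
have root_le k j (u v : R) : (0 < k)%N -> 0 <= u -> 0 <= v -> u ^+ k <= (v ^+ j) ^+ k ->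
    u <= v ^+ j.
  by move=> k0 u0 v0; rewrite ler_pXn2r // nnegrE exprn_ge0.
have l6 : abs b6 <= M ^+ 6.
  by apply: (root_le 4%N) => //; rewrite -exprM EM le_max lexx.
have l8 : abs b8 <= M ^+ 8.
  by apply: (root_le 3%N) => //; rewrite -exprM EM le_max lexx orbT.
have lc : abs (b2 ^+ 2 - 24%:R * b4) <= d ^+ 4.
  by apply: (root_le 3%N) => //; rewrite -exprM Ed.
have b44 : b4 ^+ 2 = b2 * b6 - 4%:R * b8 by rewrite hr; ring.
pose N := Num.max M d.
have NM : M <= N by rewrite le_max lexx.
have Nd : d <= N by rewrite le_max lexx orbT.
have N0 : 0 < N by apply: lt_le_trans Nd.
have XN j (u : R) : 0 <= u -> u <= N -> u ^+ j <= N ^+ j.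
  by move=> u0 uN; rewrite lerXn2r // nnegrE // ltW.
(* As c_4 is small, a large b_2^2 must be balanced by 24 b_4; then b_4^2 = b_2 b_6 - 4 b_8 gives
   |b_2|^4 <= |b_2| N^6, a contradiction. *)
have l2 : abs b2 <= N ^+ 2.
  rewrite leNgt; apply/negP => h2.
  have b2p : 0 < abs b2 by apply: lt_trans h2; rewrite exprn_gt0.
  have h3 : abs b2 ^+ 2 <= abs b4.
    rewrite leNgt; apply/negP => h4.
    have : abs b2 ^+ 2 < abs b2 ^+ 2; last by rewrite ltxx.
    rewrite -{1}(absX na) -[b2 ^+ 2](subrK (24%:R * b4)).
    apply: absD_lt => //; last exact: (abs_natM_lt na).
    apply: le_lt_trans lc _; apply: le_lt_trans (XN _ _ d0 Nd) _.
    by rewrite -[4%N]/(2 * 2)%N exprM ltr_pXn2r ?nnegrE ?exprn_ge0 // ltW.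
  have h4 : abs b4 ^+ 2 <= abs b2 * N ^+ 6.
    rewrite -(absX na) b44; apply: (absB_le na).
      by rewrite (absM na) ler_pM2l // (le_trans l6) ?XN.
    apply: (abs_natM_le na); apply: le_trans l8 _; apply: le_trans (XN _ _ M0 NM) _.
    by rewrite -[8%N]/(2 + 6)%N exprD ler_pM2r ?exprn_gt0 // ltW.
  have h5 : abs b2 ^+ 4 <= abs b4 ^+ 2.
    by rewrite -[4%N]/(2 * 2)%N exprM lerXn2r ?nnegrE ?exprn_ge0.
  have := le_trans h5 h4; rewrite exprS ler_pM2l // leNgt => /negP; apply.
  by rewrite -[6%N]/(2 * 3)%N exprM ltr_pXn2r ?nnegrE ?exprn_ge0 // ltW.
have [dM|dM] := leP d M; last first.
  have eN : N = d by rewrite /N max_r // ltW.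
  have XM j : (0 < j)%N -> M ^+ j < d ^+ j.
    by move=> j0; rewrite ltr_pXn2r // nnegrE.
  have s6 := le_lt_trans l6 (XM 6%N isT); have s8 := le_lt_trans l8 (XM 8%N isT).
  rewrite eN in l2.
  have s4 : abs b4 < d ^+ 4.
    rewrite -(@ltr_pXn2r _ 2) ?nnegrE ?exprn_ge0 // -(absX na) b44 -exprM.
    apply: (absB_lt na); last exact: (abs_natM_lt na).
    by rewrite (absM na) -[(4 * 2)%N]/(2 + 6)%N exprD; apply: ler_ltM; rewrite ?exprn_gt0.
  have : abs dl < d ^+ 12; last by rewrite Ed ltxx.
  rewrite /dl; apply: (absD_lt na (absB_lt na (absB_lt na _ (abs_natM_lt na _ _)) (abs_natM_lt na _ _)) _).
  - rewrite mulNr (absN na) (absM na) -[12%N]/(4 + 8)%N exprD.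
    apply: ler_ltM => //; rewrite ?exprn_gt0 // -[4%N]/(2 * 2)%N exprM (absX na).
    by rewrite lerXn2r ?nnegrE ?exprn_ge0.
  - by rewrite (absX na) -[12%N]/(4 * 3)%N exprM ltr_pXn2r ?nnegrE ?exprn_ge0.
  - by rewrite (absX na) -[12%N]/(6 * 2)%N exprM ltr_pXn2r ?nnegrE ?exprn_ge0.
  - rewrite (absM na) -[12%N]/(6 + 6)%N exprD; apply: ler_ltM => //; rewrite ?exprn_gt0 //.
    rewrite -mulrA; apply: (abs_natM_le na); rewrite (absM na) -[6%N]/(2 + 4)%N exprD.
    by apply: ler_pM => //; apply: ltW.
have eN : N = M by rewrite /N max_l.
rewrite eN in l2; rewrite -EM; split.
  by rewrite -Ed -exprM lerXn2r ?nnegrE.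
rewrite -[24%N]/(4 * 6)%N exprM lerXn2r ?nnegrE ?exprn_ge0 //.
rewrite -(@ler_pXn2r _ 2) ?nnegrE ?exprn_ge0 // -(absX na) b44 -exprM.
apply: (absB_le na); last exact: (abs_natM_le na).
by rewrite (absM na) -[(4 * 2)%N]/(2 + 6)%N exprD; apply: ler_pM.
Qed.

Lemma kummer_potgood_lower B X : kummer abs lam B X -> bintegral abs B ->
  abs (c2 B ^+ 2 - 24%:R * c4 B) ^+ 3 <= abs (bdisc B) ->
  forall P, P != 0 -> 0 <= lam P.
Proof.
move=> kum hB hc P P0; have [hr d0 _ hN _ _ _ _ _ _ _ _] := kum.
case EP: (X P) => [x|]; last by rewrite (hN _ EP) eqxx in P0.
have hmu y := bmu_potgood y hr d0 hc.
have dp : 0 < abs (bdisc B) by rewrite abs_gt0.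
have := kummer_mu_lower kum hB (exprn_gt0 2 dp) (fun y _ => (hmu y).2) EP (hmu x).1.
rewrite lnXn //; lra.
Qed.

Definition kE0 B X P := if X P is Some x then 1 <= bmu abs B x else true.

(** Suppose P - Q reduces to the singular point, and move its x-coordinate s to 0. Then b_4, b_6,
    b_8 are small, while x(P) and x(Q) have size at least 1. Now x(P - Q) = 0 makes [bprod] vanish,
    although its term x^2 y^2 dominates. If Q = -P, the same happens to [bnum] and its term x^4. *)
Lemma kE0_sub B X : kummer abs lam B X -> bintegral abs B ->
  forall P Q, kE0 B X P -> kE0 B X Q -> kE0 B X (P - Q).
Proof.
move=> kum hB P Q; have [hr d0 h0 hN hopp hinj hadd hdbl hdbl0 _ _ _] := kum.
rewrite /kE0; case EP: (X P) => [x|]; last by rewrite (hN _ EP) sub0r hopp.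
case EQ: (X Q) => [y|]; last by rewrite (hN _ EQ) subr0 EP.
move=> hx hy; case ES: (X (P - Q)) => [s|] //; rewrite leNgt; apply/negP => hs.
have s1 : abs s <= 1.
  rewrite leNgt; apply/negP => s1; have := bmu_big na hB s1.
  rewrite leNgt (lt_le_trans hs) //; exact: exprn_ege1 (ltW s1).
have [l2 _ _ _] := bshift_le na hB (lexx 1) s1.
have /andP[l6 l8] : (abs (c6 (bshift B s)) < 1) && (abs (c8 (bshift B s)) < 1).
  move: hs; rewrite /bmu gt_max => /andP[].
  by rewrite !expr_lt1 // => -> ->.
have l4 : abs (c4 (bshift B s)) < 1.
  have := brel_shift s hr; rewrite /brel => e.
  rewrite -(@ltr_pXn2r _ 2) ?nnegrE // expr1n -(absX na).
  have -> : c4 (bshift B s) ^+ 2 = c2 (bshift B s) * c6 (bshift B s) - 4%:R * c8 (bshift B s).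
    by rewrite e; ring.
  apply: (absB_lt na); last exact: (abs_natM_lt na).
  by rewrite (absM na) -[X in _ < X]mulr1; apply: ler_ltM.
have kumS := kummer_affine na s (oner_neq0 K) kum.
set B' := bscale _ _ in kumS.
have [l2' l4' l6' l8'] : [/\ abs (c2 B') <= 1, abs (c4 B') < 1, abs (c6 B') < 1
   & abs (c8 B') < 1].
  by rewrite /B' /bscale /c2 /c4 /c6 /c8 !expr1n !divr1.
(* Singular reduction depends only on the residue class of the x-coordinate. *)
have small u : abs (u - s) < 1 -> bmu abs B u < 1.
  move=> us.
  have us' n : abs ((u - s) ^+ n.+1) < 1 by rewrite (absX na) exprn_ilt1.
  have mul1 v w : abs v <= 1 -> abs w < 1 -> abs (v * w) < 1.
    by move=> v1 w1; rewrite (absM na) -[X in _ < X]mulr1; apply: ler_ltM.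
  have mul1' n v w : abs v <= 1 -> abs w < 1 -> abs (n%:R * v * w) < 1.
    by move=> v1 w1; apply: mul1 => //; apply: (abs_natM_le na).
  rewrite /bmu; have -> : u = s + (u - s) by rewrite addrC subrK.
  rewrite -bshiftD gt_max !exprn_ilt1 //.
    rewrite c8_shift; apply: (absD_lt na (absD_lt na (absD_lt na (absD_lt na l8 _) _) _) _).
    - exact: mul1' (ltW l6) us.
    - exact: mul1' (ltW l4) (us' 1%N).
    - exact: mul1 l2 (us' 2%N).
    - exact: abs_natM_lt (us' 3%N).
  rewrite c6_shift; apply: (absD_lt na (absD_lt na (absD_lt na l6 _) _) _).
  - exact: mul1' (ltW l4) us.
  - exact: mul1 l2 (us' 1%N).
  - exact: abs_natM_lt (us' 2%N).
have {hx}hx : 1 <= abs (x - s) by rewrite leNgt; apply/negP => /small; rewrite ltNge hx.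
have {hy}hy : 1 <= abs (y - s) by rewrite leNgt; apply/negP => /small; rewrite ltNge hy.
have EP' : omap (fun x => (x - s) / 1) (X P) = Some (x - s) by rewrite EP /= divr1.
have EQ' : omap (fun x => (x - s) / 1) (X Q) = Some (y - s) by rewrite EQ /= divr1.
have ES' : omap (fun x => (x - s) / 1) (X (P - Q)) = Some 0 by rewrite ES /= subrr mul0r.
have [exy|nxy] := eqVneq x y.
  have e : X P = X Q by rewrite EP EQ exy.
  have [ePQ|ePQ] := hinj _ _ e; first by move: ES; rewrite ePQ subrr h0.
  have eD : P - Q = P + P by rewrite -ePQ.
  have [e0|ne] := eqVneq (c6 (bshift B' (x - s))) 0.
    by move: ES; rewrite eD (kummer_dbl0 kumS EP' e0) h0.
  have [z] := kummer_dbl kumS EP' ne; rewrite -eD ES' => -[<-]; rewrite mul0r => /esym/eqP.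
  apply/negP; rewrite -(abs_eq0 na) gt_eqF // /bnum.
  set v := x - s in hx *.
  have v0 : 0 < abs v by apply: lt_le_trans hx.
  have v4 : abs (v ^+ 4) = abs v ^+ 4 by rewrite (absX na).
  have vle i : (i <= 4)%N -> abs v ^+ i <= abs v ^+ 4 by move=> i4; rewrite ler_weXn2l.
  have lo c i : abs c < 1 -> (i <= 4)%N -> abs (c * v ^+ i) < abs (v ^+ 4).
    move=> c1 i4; rewrite v4 (absM na) (absX na) -[X in _ < X]mul1r mulrC [X in _ < X]mulrC.
    by apply: ler_ltM; rewrite ?exprn_gt0 ?vle.
  have -> : v ^+ 4 - c4 B' * v ^+ 2 - 2%:R * c6 B' * v - c8 B' =
    v ^+ 4 - (c4 B' * v ^+ 2 + 2%:R * c6 B' * v ^+ 1 + c8 B' * v ^+ 0) by ring.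
  rewrite (absBl na) ?v4 ?exprn_gt0 // -v4.
  apply: (absD_lt na (absD_lt na (lo _ 2%N l4' isT) (lo _ 1%N _ isT)) (lo _ 0%N l8' isT)).
  exact: (abs_natM_lt na).
have nxy' : x - s != y - s by apply: contra nxy => /eqP/addIr->.
have [z [w [_]]] := kummer_add kumS EP' EQ' nxy'.
rewrite ES' => -[<-] _; rewrite mulr0 mul0r => /esym/eqP.
apply/negP; rewrite -(abs_eq0 na) gt_eqF // /bprod.
set v := x - s in hx *; set w' := y - s in hy *.
have v0 : 0 < abs v by apply: lt_le_trans hx.
have w0 : 0 < abs w' by apply: lt_le_trans hy.
have vw1 : 1 <= abs v * abs w' by apply: mulr_ege1.
have vw0 : 0 < abs v * abs w' by apply: mulr_gt0.
have vw2 : abs v * abs w' <= (abs v * abs w') ^+ 2 by rewrite ler_eXnr.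
have h : abs (v ^+ 2 * w' ^+ 2) = (abs v * abs w') ^+ 2 by rewrite (absM na) !(absX na) exprMn.
have lo c u : abs c < 1 -> abs u <= abs v * abs w' -> abs (c * u) < abs (v ^+ 2 * w' ^+ 2).
  move=> c1 hu; rewrite h; apply: lt_le_trans vw2.
  rewrite (absM na) mulrC -[X in _ < X]mulr1; exact: ler_ltM.
have -> : v ^+ 2 * w' ^+ 2 - c4 B' * v * w' - c6 B' * (v + w') - c8 B' =
   v ^+ 2 * w' ^+ 2 - (c4 B' * (v * w') + c6 B' * (v + w') + c8 B' * 1) by ring.
rewrite (absBl na) ?h ?exprn_gt0 // -h.
apply: (absD_lt na (absD_lt na (lo _ _ l4' _) (lo _ _ l6' _)) (lo _ _ l8' _)).
- by rewrite (absM na).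
- by apply: (absD_le na); [rewrite ler_peMr | rewrite ler_peMl].
- by rewrite (abs1 na).
Qed.

End MuLower.

(** * The Tate curve *)

(* The x-line of the Tate curve [y^2 + xy = x^3 + b]. *)
Definition tateb (K : fieldType) (b : K) := BCoef 1 0 (4%:R * b) b.

Section TateModel.
Variables (R : realType) (K : fieldType) (abs : K -> R).
Hypothesis na : is_nonarch_abs abs.
Hypothesis cpl : abs_complete abs.
Hypothesis two0 : (2%:R : K) != 0.
Hypothesis three0 : (3%:R : K) != 0.
Let ag0 x : 0 <= abs x := abs_ge0 na x.

(** Here [C] and [C6] are the classical c_4 and c_6, with c_6^2 = c_4^3 - 1728 disc. Since |disc| <
    |c_4|^3, the quotient c_6^2/c_4^3 is the square of some 1 + 2w, so c_4 is a square v^2.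
    Translating to b_4 = 0 and scaling by k = -v leaves b_2 = 1. *)
Lemma tate_model (B : bcoef K) : brel B -> bdisc B != 0 -> bintegral abs B ->
  abs (bdisc B) < abs (c2 B ^+ 2 - 24%:R * c4 B) ^+ 3 ->
  exists x0 k b, [/\ k != 0, b != 0, abs b < 1, abs k <= 1 &
    bscale (bshift B x0) k = tateb b /\ abs (bdisc B) = abs b * abs k ^+ 6].
Proof.
move=> hr d0 [i2 i4 i6 i8]; set C := c2 B ^+ 2 - 24%:R * c4 B => hC.
pose C6 := - c2 B ^+ 3 + 36%:R * c2 B * c4 B - 216%:R * c6 B.
have n4 : (4%:R : K) != 0.
  by rewrite (_ : 4%:R = 2%:R * 2%:R :> K) ?mulf_neq0 //; ring.
have n12 : (12%:R : K) != 0.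
  by rewrite (_ : 12%:R = 4%:R * 3%:R :> K) ?mulf_neq0 //; ring.
have n432 : (432%:R : K) != 0.
  by rewrite (_ : 432%:R = 12%:R * 12%:R * 3%:R :> K) ?mulf_neq0 //; ring.
have C0 : C != 0.
  by apply: contraTneq hC => ->; rewrite (abs0 na) expr0n /= -leNgt.
have Cp : 0 < abs C by rewrite abs_gt0.
have E1728 : C6 ^+ 2 = C ^+ 3 - 1728%:R * bdisc B.
  rewrite /bdisc; move: hr; rewrite /brel => hr.
  transitivity (C ^+ 3 + 432%:R * c2 B ^+ 2 * (4%:R * c8 B) + 1728%:R * (8%:R * c4 B ^+ 3
     + 27%:R * c6 B ^+ 2 - 9%:R * c2 B * c4 B * c6 B)); last ring.
  by rewrite hr /C6 /C; ring.
(* Chosen so that C6^2/C^3 = 1 + 4f, which is (1 + 2w)^2 when w^2 + w = f. *)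
pose f := - 432%:R * bdisc B / C ^+ 3.
have hD : abs (bdisc B / C ^+ 3) < 1.
  by rewrite (absM na) (absV na) (absX na) ltr_pdivrMr ?mul1r // exprn_gt0.
have f1 : abs f < 1.
  by rewrite /f mulNr mulNr (absN na) -mulrA; apply: (abs_natM_lt na).
have [w [ew hw]] := artin_schreier_root na cpl f1.
have w1 : 1 + 2%:R * w != 0.
  rewrite -(abs_eq0 na) (absDl na) ?(abs1 na) ?oner_eq0 //.
  by apply: (abs_natM_lt na); apply: le_lt_trans f1.
have Ew : C6 ^+ 2 = C ^+ 3 * (1 + 2%:R * w) ^+ 2.
  transitivity (C ^+ 3 * (1 + 4%:R * (w ^+ 2 + w))); last ring.
  by rewrite ew E1728 /f; field.
pose v := C6 / (C * (1 + 2%:R * w)).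
have v2 : v ^+ 2 = C.
  by rewrite /v expr_div_n Ew; field; rewrite ?C0 ?w1.
have ev : C6 = v ^+ 3 * (1 + 2%:R * w).
  by rewrite exprSr v2 /v; field; rewrite ?C0 ?w1.
have v0 : v != 0 by apply: contraNneq C0 => e; rewrite -v2 e expr0n.
(* The translation that makes b_2 equal to -v; then b_4 = 0, because b_2^2 - 24 b_4 = v^2 is
   invariant. *)
pose x0 := (- c2 B - v) / 12%:R.
have e2 : c2 (bshift B x0) = - v by rewrite c2_shift /x0; field.
have n24 : (24%:R : K) != 0.
  by rewrite (_ : 24%:R = 12%:R * 2%:R :> K) ?mulf_neq0 //; ring.
have e4 : c4 (bshift B x0) = 0.
  apply: (mulfI n24); rewrite mulr0.
  transitivity (c2 (bshift B x0) ^+ 2 - C); last by rewrite e2 sqrrN v2 subrr.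
  by rewrite c2_shift c4_shift /C; ring.
have n216 : (216%:R : K) != 0.
  by rewrite (_ : 216%:R = 12%:R * 2%:R * 3%:R * 3%:R :> K) ?mulf_neq0 //; ring.
(* The division is harmless: |w| <= |f| carries the factor |432|, so |b| <= |disc/c_4^3| < 1. *)
pose b := w / 432%:R.
have e6 : c6 (bshift B x0) = 4%:R * b * (- v) ^+ 3.
  apply: (mulfI n216).
  transitivity (- C6 - c2 (bshift B x0) ^+ 3 + 36%:R * c2 (bshift B x0) * c4 (bshift B x0)).
    by rewrite c2_shift c4_shift c6_shift /C6; ring.
  by rewrite e2 e4 ev /b; field.
have e8 : c8 (bshift B x0) = b * (- v) ^+ 4.
  have := brel_shift x0 hr; rewrite /brel e2 e4 e6 => h; apply: (mulfI n4).
  by rewrite h; ring.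
have ED : bdisc B = - (b * v ^+ 6 * (1 + 432%:R * b)).
  by rewrite -(bdisc_shift x0 hr) /bdisc e2 e4 e6 e8; ring.
have b1 : abs b < 1.
  apply: le_lt_trans hD; rewrite /b (absM na) (absV na).
  rewrite ler_pdivrMr ?abs_gt0 // mulrC -(absM na); apply: le_trans hw _.
  by rewrite /f !mulNr (absN na) mulrA.
have vk : abs v <= 1.
  rewrite -(@ler_pXn2r _ 2) ?nnegrE // expr1n -(absX na) v2; apply: (absB_le na).
    by rewrite (absX na) exprn_ile1.
  exact: (abs_natM_le na).
exists x0, (- v), b; split => //; rewrite ?oppr_eq0 ?(absN na) //.
  by apply: contraNneq d0 => e; rewrite ED e !mul0r oppr0.
split.
  rewrite /bscale /tateb; congr BCoef; rewrite ?e2 ?e4 ?e6 ?e8.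
  - by rewrite divff // oppr_eq0.
  - by rewrite mul0r.
  - by rewrite mulfK // expf_neq0 // oppr_eq0.
  - by rewrite mulfK // expf_neq0 // oppr_eq0.
rewrite ED (absN na) 2!(absM na) (absX na) (absDl na) ?(abs1 na) ?mulr1 //.
exact: (abs_natM_lt na).
Qed.

(** * Addition on the Tate curve in terms of |x| *)

Section TateRadius.
Variables (b : K) (q : R).
Hypotheses (q0 : 0 < q) (q1 : q < 1) (qb : q ^+ 2 = abs b).
Let qge0 : 0 <= q := ltW q0.

(** The value exp(-m). Radius 1 covers every |x| >= 1, and radius q, the square root of |b|, covers
    every |x| <= q, at distance m = V/2. *)
Definition tclamp (a : R) := Num.max q (Num.min 1 a).

Lemma tclamp_big a : 1 <= a -> tclamp a = 1.
Proof. by move=> h; rewrite /tclamp min_l // max_r // ltW. Qed.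
Lemma tclamp_small a : a <= q -> tclamp a = q.
Proof. by move=> h; rewrite /tclamp max_l // ge_min h orbT. Qed.
Lemma tclamp_mid a : q <= a -> a <= 1 -> tclamp a = a.
Proof. by move=> h h'; rewrite /tclamp min_r // max_r. Qed.

(** The relation between m(P), m(Q) and m(P + Q), m(P - Q) in multiplicative form. The disjunction
    reflects that the x-line does not distinguish P + Q from P - Q. *)
Definition trel (r1 r2 s1 s2 : R) :=
  (s1 = Num.min (r1 / r2) (r2 / r1) /\ s2 = Num.max (r1 * r2) (q ^+ 2 / (r1 * r2))) \/
  (s2 = Num.min (r1 / r2) (r2 / r1) /\ s1 = Num.max (r1 * r2) (q ^+ 2 / (r1 * r2))).

Lemma trel_sym r1 r2 s1 s2 : trel r1 r2 s1 s2 -> trel r2 r1 s1 s2.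
Proof. by rewrite /trel [r2 * r1]mulrC [Num.min (r2 / r1) _]minC. Qed.

Lemma trel1 r : q <= r -> r <= 1 -> trel 1 r r r.
Proof.
move=> qr r1; have r0 : 0 < r by apply: lt_le_trans qr.
have rge0 := ltW r0.
have h1 : r <= r^-1 by rewrite -(ler_pM2r r0) mulVf ?gt_eqF //; nra.
have h2 : q ^+ 2 / r <= r by rewrite ler_pdivrMr // -expr2 lerXn2r ?nnegrE //.
by left; rewrite !mul1r divr1 min_r ?max_l.
Qed.

Lemma trelq r : q <= r -> r <= 1 -> trel r q (q / r) (q / r).
Proof.
move=> qr r1; have r0 : 0 < r by apply: lt_le_trans qr.
have rge0 := ltW r0.
have e : q ^+ 2 / (r * q) = q / r by field; rewrite !gt_eqF.
have h1 : r * q <= q / r by rewrite ler_pdivlMr // mulrAC ger_pMl //; nra.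
have h2 : q / r <= r / q.
  by rewrite ler_pdivrMr // mulrAC ler_pdivlMr // -!expr2 lerXn2r ?nnegrE //.
by left; rewrite e min_r ?max_r.
Qed.

Lemma q2lt1 : q ^+ 2 < 1. Proof. by rewrite expr_lt1 // ltW. Qed.

(** This and the next three lemmas are cases of the Newton polygon of T^2 - (z + w) T + z w, to be
    applied with z = x(P + Q) and w = x(P - Q). *)
Lemma roots_eq z w (rho : R) : 0 < rho -> abs (z * w) = rho ^+ 2 -> abs (z + w) <= rho ->
  abs z = rho /\ abs w = rho.
Proof.
have key z1 w1 : 0 < rho -> abs (z1 * w1) = rho ^+ 2 -> abs (z1 + w1) <= rho -> abs z1 <= rho.
  move=> r0; rewrite (absM na) expr2 => e h; rewrite leNgt; apply/negP => hz.
  have hw : abs w1 < rho.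
    rewrite ltNge; apply/negP => hw.
    have : rho * rho < abs w1 * abs z1 by apply: ler_ltM => //; [exact: lt_le_trans hw | exact: ltW].
    by rewrite [abs w1 * _]mulrC e ltxx.
  by move: h; rewrite (absDl na) ?(lt_trans hw) // leNgt hz.
move=> r0 e h; have h1 := key _ _ r0 e h.
have h2 : abs w <= rho by apply: (key w z r0); rewrite 1?mulrC 1?addrC.
have hz0 := ag0 z; have hw0 := ag0 w.
move: e; rewrite (absM na) expr2 => e.
by split; apply/le_anti/andP; split => //; nra.
Qed.

Lemma roots_le z w (rho : R) : 0 < rho -> abs (z * w) <= rho ^+ 2 -> abs (z + w) <= rho ->
  abs z <= rho /\ abs w <= rho.
Proof.
have key z1 w1 : 0 < rho -> abs (z1 * w1) <= rho ^+ 2 -> abs (z1 + w1) <= rho -> abs z1 <= rho.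
  move=> r0; rewrite (absM na) expr2 => e h; rewrite leNgt; apply/negP => hz.
  have hw : abs w1 < rho.
    rewrite ltNge; apply/negP => hw.
    have : rho * rho < abs w1 * abs z1 by apply: ler_ltM => //; [exact: lt_le_trans hw | exact: ltW].
    by rewrite [abs w1 * _]mulrC ltNge e.
  by move: h; rewrite (absDl na) ?(lt_trans hw) // leNgt hz.
by move=> r0 e h; split; [apply: (key z w) | apply: (key w z); rewrite // 1?mulrC 1?addrC].
Qed.

Lemma roots_ge1 z w (tau : R) : 1 <= tau -> tau <= abs (z * w) -> abs (z + w) <= tau ->
  1 <= abs z /\ 1 <= abs w.
Proof.
have key z1 w1 : 1 <= tau -> tau <= abs (z1 * w1) -> abs (z1 + w1) <= tau -> 1 <= abs z1.
  move=> t1; rewrite (absM na) => e h; rewrite leNgt; apply/negP => hz.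
  have hw : tau < abs w1.
    have w0 : 0 < abs w1.
      rewrite lt_neqAle ag0 andbT; apply: contraTneq e => <-.
      by rewrite mulr0 -ltNge; lra.
    by apply: le_lt_trans e _; rewrite -[X in _ < X]mul1r ltr_pM2r.
  by move: h; rewrite (absDr na) ?leNgt ?hw //; lra.
by move=> r0 e h; split; [apply: (key z w) | apply: (key w z); rewrite // 1?mulrC 1?addrC].
Qed.

Lemma roots_split z w : abs (z * w) < abs (z + w) ^+ 2 ->
  (abs z = abs (z + w) /\ abs w = abs (z * w) / abs (z + w)) \/
  (abs w = abs (z + w) /\ abs z = abs (z * w) / abs (z + w)).
Proof.
have key z1 w1 : abs w1 < abs z1 ->
  abs z1 = abs (z1 + w1) /\ abs w1 = abs (z1 * w1) / abs (z1 + w1).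
  move=> h; rewrite (absDl na) // (absM na); split => //.
  by rewrite [abs z1 * _]mulrC mulfK // gt_eqF // (le_lt_trans _ h).
move=> h; have [hzw|hzw|e] := ltgtP (abs w) (abs z).
- by left; apply: key.
- by right; rewrite [z + w]addrC [z * w]mulrC; apply: key.
- have : abs (z + w) <= abs z by apply: (absD_le na); rewrite ?e.
  rewrite leNgt => /negP[]; rewrite -(@ltr_pXn2r _ 2) ?nnegrE //.
  by move: h; rewrite (absM na) e expr2.
Qed.

Lemma bsum_tate x y : bsum (tateb b) x y = x * y + (2%:R * (x * y * (x + y)) + 4%:R * b).
Proof. by rewrite /bsum /tateb /c2 /c4 /c6; ring. Qed.

Lemma bprod_tate x y : bprod (tateb b) x y = (x * y) ^+ 2 - b * (1 + 4%:R * (x + y)).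
Proof. by rewrite /bprod /tateb /c4 /c6 /c8; ring. Qed.

(** The cases are the positions of |x| >= |y| relative to 1 and q. In each of them the sizes of
    [bsum] and [bprod] determine enough of the Newton polygon to give the clamped radii of both
    roots. *)
Lemma tclamp_add x y z w : x != y ->
  (z + w) * (x - y) ^+ 2 = bsum (tateb b) x y ->
  z * w * (x - y) ^+ 2 = bprod (tateb b) x y ->
  trel (tclamp (abs x)) (tclamp (abs y)) (tclamp (abs z)) (tclamp (abs w)).
Proof.
wlog xy : x y / abs y <= abs x.
  move=> H ne es ep; case/orP: (le_total (abs y) (abs x)) => h; first exact: H.
  apply: trel_sym; apply: H => //; rewrite 1?eq_sym // -[x - y]opprB sqrrN in es ep *.
    by rewrite es /bsum; ring.
  by rewrite ep /bprod; ring.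
move=> ne es ep.
have sp : 0 < abs (x - y) by rewrite abs_gt0 // subr_eq0.
have sle : abs (x - y) <= abs x by apply: (absB_le na).
have Es : abs (z + w) = abs (bsum (tateb b) x y) / abs (x - y) ^+ 2.
  by rewrite -es (absM na) (absX na) mulfK // expf_neq0 // gt_eqF.
have Ep : abs (z * w) = abs (bprod (tateb b) x y) / abs (x - y) ^+ 2.
  by rewrite -ep [abs (z * w * _)](absM na) (absX na) mulfK // expf_neq0 // gt_eqF.
have s2p : 0 < abs (x - y) ^+ 2 by rewrite exprn_gt0.
have dp : abs (x + y) <= abs x by apply: (absD_le na).
have q21 := q2lt1.
have q20 : 0 < q ^+ 2 by rewrite exprn_gt0.
have bsum_le (c : R) : abs x * abs y <= c -> abs x * abs y * abs x <= c -> q ^+ 2 <= c ->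
    abs (bsum (tateb b) x y) <= c.
  move=> h1 h2 h3; rewrite bsum_tate.
  apply: (absD_le na _ (absD_le na (abs_natM_le na _ _) (abs_natM_le na _ _))).
  - by rewrite (absM na).
  - by rewrite 2!(absM na); apply: le_trans h2; rewrite ler_wpM2l // mulr_ge0.
  - by rewrite -qb.
have yp := ag0 y.
have [y1|y1] := leP 1 (abs y).
  have x1 := le_trans y1 xy.
  have hp : abs (bprod (tateb b) x y) = (abs x * abs y) ^+ 2.
    rewrite bprod_tate (absBl na) ?(absX na) ?(absM na) // -qb.
    have : abs (1 + 4%:R * (x + y)) <= abs x.
      by apply: (absD_le na); rewrite ?(abs1 na) //; apply: (abs_natM_le na).
    move=> h; apply: (@le_lt_trans _ _ (q ^+ 2 * abs x)); first by rewrite ler_pM2l.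
    apply: (@lt_le_trans _ _ (1 * abs x)); first by rewrite ltr_pM2r //; lra.
    have xyx : abs x <= abs x * abs y by rewrite ler_peMr.
    rewrite mul1r; apply: le_trans xyx _.
    by rewrite expr2 ler_peMr ?mulr_ge0 // mulr_ege1.
  have hs : abs (bsum (tateb b) x y) <= abs x ^+ 2 * abs y.
    by apply: bsum_le; rewrite ?expr2; nra.
  have [hz hw] : 1 <= abs z /\ 1 <= abs w.
    apply: (@roots_ge1 _ _ (abs x ^+ 2 * abs y / abs (x - y) ^+ 2)).
    - rewrite ler_pdivlMr // mul1r; apply: (@le_trans _ _ (abs x ^+ 2)).
        by rewrite lerXn2r ?nnegrE //.
      by rewrite ler_peMr // exprn_ge0.
    - rewrite Ep hp ler_pM2r ?invr_gt0 // exprMn ler_wpM2l ?exprn_ge0 // expr2; nra.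
    - by rewrite Es ler_pM2r ?invr_gt0.
  rewrite !tclamp_big //; left; rewrite !mulr1 !divr1 minxx; split => //.
  by rewrite max_l // ltW.
have [x1|x1] := leP 1 (abs x).
  have sE : abs (x - y) = abs x by rewrite (absBl na) // (lt_le_trans y1).
  have xp : 0 < abs x by lra.
  have hb : abs (b * (1 + 4%:R * (x + y))) <= q ^+ 2 * abs x.
    rewrite (absM na) -qb ler_pM2l //.
    by apply: (absD_le na); rewrite ?(abs1 na) //; apply: (abs_natM_le na).
  have xx2 : abs x <= abs x ^+ 2 by rewrite ler_eXnr.
  rewrite (tclamp_big x1); have [yq|yq] := ltP q (abs y).
    have q2y : q ^+ 2 < abs y ^+ 2 by rewrite ltr_pXn2r ?nnegrE.
    have [-> ->] : abs z = abs y /\ abs w = abs y.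
      apply: roots_eq; first exact: lt_trans yq.
        have e : abs ((x * y) ^+ 2) = (abs x * abs y) ^+ 2 by rewrite (absX na) (absM na).
        rewrite Ep bprod_tate (absBl na) e ?sE.
          by rewrite exprMn mulrAC divff ?mul1r // gt_eqF ?exprn_gt0.
        apply: le_lt_trans hb _; rewrite exprMn mulrC.
        by apply: ler_ltM => //; [rewrite exprn_gt0 | apply: ltW].
      rewrite Es sE ler_pdivrMr ?exprn_gt0 //.
      by apply: bsum_le; rewrite ?expr2 in q2y *; nra.
    by rewrite tclamp_mid ?ltW //; apply: trel1; apply: ltW.
  have [hz hw] : abs z <= q /\ abs w <= q.
    have yq2 : abs y ^+ 2 <= q ^+ 2 by rewrite lerXn2r ?nnegrE //.
    apply: roots_le => //.
      rewrite Ep sE ler_pdivrMr ?exprn_gt0 // bprod_tate; apply: (absB_le na).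
        by rewrite (absX na) (absM na) exprMn mulrC ler_wpM2r ?exprn_ge0.
      by apply: le_trans hb _; rewrite ler_pM2l.
    rewrite Es sE ler_pdivrMr ?exprn_gt0 //.
    by apply: bsum_le; rewrite ?expr2 in q21 *; nra.
  by rewrite !tclamp_small //; apply: trel1; rewrite // ltW.
have hb : abs (b * (1 + 4%:R * (x + y))) = q ^+ 2.
  rewrite (absM na) -qb (absDl na) ?(abs1 na) ?mulr1 //.
  by apply: (abs_natM_lt na); apply: le_lt_trans x1.
have [xq|xq] := leP (abs x) q.
  have yq := le_trans xy xq.
  have xyq : abs x * abs y <= q ^+ 2 by rewrite expr2 ler_pM.
  have hp : abs (bprod (tateb b) x y) = q ^+ 2.
    rewrite bprod_tate (absBr na) hb // (absX na) (absM na).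
    apply: (@le_lt_trans _ _ (q ^+ 2 * q ^+ 2)); first by rewrite expr2 ler_pM ?mulr_ge0.
    by rewrite -[X in _ < X]mulr1 ltr_pM2l.
  have hs : abs (bsum (tateb b) x y) <= q ^+ 2.
    apply: bsum_le => //; apply: le_trans xyq.
    by apply: ler_piMr; [rewrite mulr_ge0 | apply: ltW].
  have [hz hw] : 1 <= abs z /\ 1 <= abs w.
    apply: (@roots_ge1 _ _ (q ^+ 2 / abs (x - y) ^+ 2)).
    - rewrite ler_pdivlMr // mul1r lerXn2r ?nnegrE ?(le_trans sle) // ltW //.
    - by rewrite Ep hp.
    - by rewrite Es ler_pM2r ?invr_gt0.
  rewrite !(tclamp_small xq) (tclamp_small yq) !tclamp_big //.
  have q2 : q / q = 1 by rewrite divff // gt_eqF.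
  left; rewrite q2 minxx -expr2 divff ?gt_eqF // max_r //; exact: ltW.
have xp : 0 < abs x by apply: lt_trans xq.
have qx : q * q < abs x * q by rewrite ltr_pM2r.
have [yq|yq] := leP (abs y) q.
  have sE : abs (x - y) = abs x by rewrite (absBl na) // (le_lt_trans yq).
  have hp : abs (bprod (tateb b) x y) = q ^+ 2.
    rewrite bprod_tate (absBr na) hb // (absX na) (absM na) ltr_pXn2r ?nnegrE ?mulr_ge0 //.
    by apply: (@le_lt_trans _ _ (abs x * q)); [rewrite ler_wpM2l | rewrite gtr_pMl].
  have [-> ->] : abs z = q / abs x /\ abs w = q / abs x.
    apply: roots_eq; first by rewrite divr_gt0.
      by rewrite Ep sE hp expr_div_n.
    have -> : q / abs x = q * abs x / abs x ^+ 2 by field; rewrite gt_eqF.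
    rewrite Es sE ler_pM2r ?invr_gt0 ?exprn_gt0 //.
    have xyq : abs x * abs y <= q * abs x by rewrite mulrC ler_wpM2r.
    apply: bsum_le => //; last by rewrite expr2 [q * abs x]mulrC ltW.
    by apply: le_trans xyq; apply: ler_piMr; [rewrite mulr_ge0 | apply: ltW].
  rewrite (tclamp_mid (ltW xq) (ltW x1)) (tclamp_small yq).
  rewrite tclamp_mid; first by apply: trelq; apply: ltW.
    by rewrite ler_pdivlMr // ger_pMr // ltW.
  by rewrite ler_pdivrMr // mul1r ltW.
rewrite (tclamp_mid (ltW xq) (ltW x1)) (tclamp_mid (ltW yq) (ltW y1)).
have yp' : 0 < abs y by apply: lt_trans yq.
set p := abs x * abs y.
have p0 : 0 < p by apply: mulr_gt0.
have qp : q ^+ 2 < p by rewrite expr2 ltr_pM // ltW.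
have p1 : p < 1 by rewrite -[X in _ < X]mulr1 /p ltr_pM.
have hs : abs (bsum (tateb b) x y) = p.
  rewrite bsum_tate /p -(absM na) (absDl na) // (absM na).
  apply: (absD_lt na (abs_natM_lt na _ _) (abs_natM_lt na _ _)); last by rewrite -qb.
  rewrite 2!(absM na) -[X in _ < X]mulr1 ltr_pM2l //; exact: le_lt_trans x1.
have hp : abs (bprod (tateb b) x y) <= Num.max (p ^+ 2) (q ^+ 2).
  rewrite bprod_tate; apply: (absB_le na); rewrite ?hb ?le_max ?lexx ?orbT //.
  by rewrite (absX na) (absM na) lexx.
have s1 : abs (x - y) < 1 by apply: le_lt_trans x1.
have s2x : abs (x - y) ^+ 2 <= abs x ^+ 2 by rewrite lerXn2r ?nnegrE //.
have hlt : abs (z * w) < abs (z + w) ^+ 2.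
  rewrite Es Ep hs expr_div_n.
  have -> : p ^+ 2 / (abs (x - y) ^+ 2) ^+ 2 =
    p ^+ 2 / abs (x - y) ^+ 2 / abs (x - y) ^+ 2 by field; rewrite gt_eqF.
  rewrite ltr_pM2r ?invr_gt0 // ltr_pdivlMr //.
  apply: (@le_lt_trans _ _ (Num.max (p ^+ 2) (q ^+ 2) * abs (x - y) ^+ 2)).
    by rewrite ler_pM2r.
  rewrite maxr_pMl ?ltW // gt_max; apply/andP; split.
    by rewrite gtr_pMr ?exprn_gt0 // expr_lt1 // ltW.
  rewrite /p exprMn mulrC; apply: ler_ltM => //; rewrite ?exprn_gt0 ?ltW //.
  by rewrite ltr_pXn2r ?nnegrE // ltW.
have small u : abs u = abs (z * w) / abs (z + w) ->
    tclamp (abs u) = Num.max p (q ^+ 2 / p).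
  have -> : abs (z * w) / abs (z + w) = abs (bprod (tateb b) x y) / p.
    by rewrite Es Ep hs; field; rewrite !gt_eqF.
  move=> ->; have epp : (abs x * abs y) ^+ 2 = abs ((x * y) ^+ 2) by rewrite (absX na) (absM na).
  have qlep : (q ^+ 2 / p <= q) = (q <= p).
    by rewrite ler_pdivrMr // expr2 ler_pM2l.
  have [hpq|hpq|epq] := ltgtP p q.
  - have -> : abs (bprod (tateb b) x y) = q ^+ 2.
      by rewrite bprod_tate (absBr na) hb // -epp ltr_pXn2r ?nnegrE // ltW.
    have h : q < q ^+ 2 / p by rewrite ltNge qlep -ltNge.
    rewrite max_r; last exact: ltW (lt_trans hpq h).
    by rewrite tclamp_mid ?ltW // ltr_pdivrMr // mul1r.
  - have -> : abs (bprod (tateb b) x y) = p ^+ 2.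
      by rewrite bprod_tate (absBl na) -?epp // hb ltr_pXn2r ?nnegrE // ltW.
    have -> : p ^+ 2 / p = p by field; rewrite gt_eqF.
    rewrite tclamp_mid ?ltW // max_l //; apply: le_trans (ltW hpq).
    by rewrite qlep ltW.
  (* For p = q the leading terms of [bprod] may cancel; the root is then at most q, and clamping
     restores the value q. *)
  - rewrite tclamp_small; last first.
      rewrite ler_pdivrMr // epq -expr2; apply: le_trans hp _.
      by rewrite epq maxxx.
    by rewrite epq expr2 mulfK ?maxxx // gt_eqF.
have big u : abs u = abs (z + w) ->
    tclamp (abs u) = Num.min (abs x / abs y) (abs y / abs x).
  move=> ->; rewrite Es hs min_r; last first.
    by rewrite ler_pdivrMr // mulrAC ler_pdivlMr // -!expr2 lerXn2r ?nnegrE //.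
  move: xy; rewrite le_eqVlt => /orP[/eqP exy|lxy].
    (* Here |x - y| may be smaller than |x|, which only pushes the root further above 1. *)
    rewrite exy divff ?gt_eqF // tclamp_big // ler_pdivlMr // mul1r /p exy -expr2.
    by rewrite lerXn2r ?nnegrE //.
  have -> : abs (x - y) = abs x by rewrite (absBl na).
  have -> : p / abs x ^+ 2 = abs y / abs x by rewrite /p; field; rewrite gt_eqF.
  rewrite tclamp_mid //.
    rewrite ler_pdivlMr //; apply: le_trans (ltW yq); rewrite ger_pMr // ltW //.
  by rewrite ler_pdivrMr // mul1r ltW.
case: (roots_split hlt) => -[h1 h2]; [left | right];
  by split; [apply: big | apply: small].
Qed.

End TateRadius.
End TateModel.

(* [V / 2 * B_2 (m / V)], with [B_2] the second Bernoulli polynomial. *)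
Definition bern2 (R : realType) (V m : R) := V / 12%:R - m / 2%:R + m ^+ 2 / (2%:R * V).

(** * The local height on the Tate curve *)

Section TateHeight.
Variables (R : realType) (K : fieldType) (abs : K -> R).
Hypothesis na : is_nonarch_abs abs.
Let ag0 x : 0 <= abs x := abs_ge0 na x.
Variables (b : K) (q : R).
Hypotheses (q0 : 0 < q) (q1 : q < 1) (qb : q ^+ 2 = abs b).
Let qge0 : 0 <= q := ltW q0.
Local Notation V := (- (ln q *+ 2)).

Lemma tateV_gt0 : 0 < V.
Proof.
have : ln q < 0 by apply: ln_lt0; rewrite q0.
rewrite mulr2n; lra.
Qed.

Lemma tclamp_ge a : q <= tclamp q a. Proof. by rewrite le_max lexx. Qed.
Lemma tclamp_le1 a : tclamp q a <= 1.
Proof. by rewrite ge_max ge_min lexx ltW. Qed.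
Lemma tclamp_gt0 a : 0 < tclamp q a. Proof. exact: lt_le_trans (tclamp_ge a). Qed.

Lemma tate_den_big x : 1 <= abs x -> abs (c6 (bshift (tateb b) x)) <= abs x ^+ 3.
Proof.
move=> x1; rewrite c6_shift /tateb /c6 /c4 /c2 mulr0 mul0r addr0 mul1r.
have x0 : 0 <= abs x by [].
have x13 : 1 <= abs x ^+ 3 by rewrite exprn_ege1.
apply: (absD_le na (absD_le na (abs_natM_le na _ _) _) (abs_natM_le na _ _)).
- by rewrite -qb; apply: le_trans x13; rewrite exprn_ile1 // ltW.
- by rewrite (absX na) ler_weXn2l.
- by rewrite (absX na).
Qed.

Lemma tate_den_mid x : q < abs x -> abs x < 1 ->
  abs (c6 (bshift (tateb b) x)) = abs x ^+ 2.
Proof.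
move=> xq x1; have x0 : 0 < abs x by apply: lt_trans xq.
have -> : c6 (bshift (tateb b) x) = x ^+ 2 + (4%:R * b + 4%:R * x ^+ 3).
  by rewrite c6_shift /tateb /c6 /c4 /c2; ring.
rewrite (absDl na) (absX na) //; apply: (absD_lt na); apply: (abs_natM_lt na).
  by rewrite -qb ltr_pXn2r ?nnegrE.
by rewrite (absX na) ltr_iXn2l.
Qed.

Lemma tate_den_small x : abs x <= q -> abs (c6 (bshift (tateb b) x)) <= q ^+ 2.
Proof.
move=> xq; rewrite c6_shift /tateb /c6 /c4 /c2 mulr0 mul0r addr0 mul1r.
have x1 : abs x <= 1 by apply: le_trans xq (ltW q1).
have x2 : abs (x ^+ 2) <= q ^+ 2 by rewrite (absX na) lerXn2r ?nnegrE.
apply: (absD_le na (absD_le na (abs_natM_le na _ _) _) (abs_natM_le na _ _)) => //.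
  by rewrite -qb.
by apply: le_trans x2; rewrite !(absX na) ler_wiXn2l.
Qed.

Lemma tate_num_big x : 1 <= abs x -> abs (bnum (tateb b) x) = abs x ^+ 4.
Proof.
move=> x1; have x0 : 0 < abs x by apply: lt_le_trans x1.
have -> : bnum (tateb b) x = x ^+ 4 - b * (8%:R * x + 1).
  by rewrite /bnum /tateb /c6 /c4 /c8; ring.
rewrite (absBl na) (absX na) // (absM na) -qb mulrC.
apply: (@lt_le_trans _ _ (abs x * 1)); last first.
  by rewrite mulr1 ler_eXnr.
apply: ler_ltM => //; rewrite ?exprn_ge0 //.
  by apply: (absD_le na); rewrite ?(abs1 na) //; apply: (abs_natM_le na).
by rewrite expr_lt1.
Qed.

Lemma tate_num_small x : abs x < 1 ->
  [/\ abs (bnum (tateb b) x) <= Num.max (abs x ^+ 4) (q ^+ 2),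
      abs x ^+ 2 < q -> abs (bnum (tateb b) x) = q ^+ 2 &
      q < abs x ^+ 2 -> abs (bnum (tateb b) x) = abs x ^+ 4].
Proof.
move=> x1; have x0 : 0 <= abs x by [].
have -> : bnum (tateb b) x = x ^+ 4 - b * (1 + 8%:R * x).
  by rewrite /bnum /tateb /c6 /c4 /c8; ring.
have hb : abs (b * (1 + 8%:R * x)) = q ^+ 2.
  by rewrite (absM na) -qb (absDl na) ?(abs1 na) ?mulr1 //; apply: (abs_natM_lt na).
have e4 : abs (x ^+ 4) = (abs x ^+ 2) ^+ 2 by rewrite (absX na) -exprM.
split.
- by apply: (absB_le na); rewrite ?hb le_max ?(absX na) ?lexx ?orbT.
- by move=> h; rewrite (absBr na) hb // e4 ltr_pXn2r ?nnegrE ?exprn_ge0.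
- by move=> h; rewrite (absBl na) ?(absX na) // hb -(absX na) e4 ltr_pXn2r ?nnegrE ?exprn_ge0.
Qed.

Lemma sqr_lt_q x : abs x <= q -> abs x ^+ 2 < q.
Proof.
move=> xq; apply: (@le_lt_trans _ _ (q ^+ 2)); first by rewrite lerXn2r ?nnegrE.
by rewrite expr2 gtr_pMr.
Qed.

(** The case P = Q, where the formulas for the sum and product of x(P + Q) and x(P - Q)
    degenerate. *)
Lemma tclamp_dbl x z : c6 (bshift (tateb b) x) != 0 ->
  z * c6 (bshift (tateb b) x) = bnum (tateb b) x ->
  tclamp q (abs z) = Num.max (tclamp q (abs x) * tclamp q (abs x))
                             (q ^+ 2 / (tclamp q (abs x) * tclamp q (abs x))).
Proof.
move=> ne ez; have q20 : 0 < q ^+ 2 by rewrite exprn_gt0.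
have dp : 0 < abs (c6 (bshift (tateb b) x)) by rewrite abs_gt0.
have Ez : abs z = abs (bnum (tateb b) x) / abs (c6 (bshift (tateb b) x)).
  by rewrite -ez (absM na) mulfK // gt_eqF.
have [x1|x1] := leP 1 (abs x).
  rewrite (tclamp_big q1 x1) mulr1 divr1 max_l; last by rewrite ltW // expr_lt1.
  apply: tclamp_big => //; rewrite Ez tate_num_big // ler_pdivlMr // mul1r.
  by apply: le_trans (tate_den_big x1) _; rewrite ler_weXn2l.
have [num num1 num2] := tate_num_small x1.
have [xq|xq] := leP (abs x) q.
  rewrite (tclamp_small xq) -expr2 divff ?gt_eqF // max_r; last by rewrite ltW // expr_lt1.
  apply: tclamp_big => //; rewrite Ez num1; last exact: sqr_lt_q.
  by rewrite ler_pdivlMr // mul1r tate_den_small.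
rewrite (tclamp_mid (ltW xq) (ltW x1)) -expr2.
have den := tate_den_mid xq x1; rewrite Ez den.
have x0 : 0 < abs x by apply: lt_trans xq.
set p := abs x ^+ 2 in num num1 num2 *.
have p0 : 0 < p by rewrite exprn_gt0.
have qp : q ^+ 2 < p by rewrite ltr_pXn2r ?nnegrE // ltW.
have p1 : p < 1 by rewrite expr_lt1.
have x4 : abs x ^+ 4 = p ^+ 2 by rewrite -exprM.
have qlep : (q ^+ 2 / p <= q) = (q <= p) by rewrite ler_pdivrMr // expr2 ler_pM2l.
have [hpq|hpq|epq] := ltgtP p q.
- rewrite (num1 hpq); have h : q < q ^+ 2 / p by rewrite ltNge qlep -ltNge.
  rewrite max_r; last exact: ltW (lt_trans hpq h).
  by rewrite tclamp_mid ?ltW // ltr_pdivrMr // mul1r.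
- rewrite (num2 hpq) x4 expr2 mulfK ?gt_eqF // tclamp_mid ?ltW // max_l //.
  by apply: le_trans (ltW hpq); rewrite qlep ltW.
- rewrite tclamp_small; last first.
    rewrite ler_pdivrMr // epq -expr2; apply: le_trans num _.
    by rewrite x4 epq maxxx.
  by rewrite epq expr2 mulfK ?maxxx // gt_eqF.
Qed.

Lemma tate_disc : abs (bdisc (tateb b)) = q ^+ 2.
Proof.
have -> : bdisc (tateb b) = - (b * (1 + 432%:R * b)).
  by rewrite /bdisc /tateb /c2 /c4 /c6 /c8; ring.
rewrite (absN na) (absM na) (absDl na) (abs1 na) ?mulr1 //.
by apply: (abs_natM_lt na); rewrite -qb expr_lt1.
Qed.

Lemma bern2_sym m : bern2 V (V - m) = bern2 V m.
Proof.
rewrite /bern2; move: V tateV_gt0 => v v0.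
by field; rewrite gt_eqF.
Qed.

Lemma bern2_double m : bern2 V (m *+ 2) = V / 12%:R - m + 2%:R * m ^+ 2 / V.
Proof.
rewrite /bern2; move: V tateV_gt0 => v v0.
by field; rewrite gt_eqF.
Qed.

Lemma bern2_le m : 0 <= m -> m <= V / 2%:R -> bern2 V m <= V / 12%:R.
Proof.
rewrite /bern2; move: V tateV_gt0 => v v0 m0 mv.
have -> : v / 12%:R - m / 2%:R + m ^+ 2 / (2%:R * v) =
  v / 12%:R - m * (v - m) / (2%:R * v) by field; rewrite gt_eqF.
rewrite gerBl divr_ge0 ?mulr_ge0 //; lra.
Qed.

Definition tm (a : R) := - ln (tclamp q a).

Lemma tm_ge0 a : 0 <= tm a.
Proof. by rewrite /tm oppr_ge0 ln_le0 // tclamp_le1. Qed.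
Lemma tm_le a : tm a <= V / 2%:R.
Proof.
have : ln q <= ln (tclamp q a) by rewrite ler_ln ?posrE ?tclamp_gt0 ?tclamp_ge.
rewrite /tm mulr2n; lra.
Qed.

Variables (G : zmodType) (lam : G -> R) (X : G -> option K).
Hypothesis kum : kummer abs lam (tateb b) X.

(** Tate's explicit formula for the local height; the logarithm contributes only near O, where |x| >
    1. *)
Definition tlow x := 2%:R^-1 * ln (Num.max 1 (abs x)) + bern2 V (tm (abs x)).

(** For q < |x| < 1 this is the comparison of B_2 at m and 2m together with log max(1, |z|) >= 0.
    For |x| >= 1 and for |x| <= q it is log max(1, |z|) >= log |z|. *)
Lemma tlow_dbl x z : c6 (bshift (tateb b) x) != 0 ->
  z * c6 (bshift (tateb b) x) = bnum (tateb b) x ->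
  4%:R * tlow x - 2%:R^-1 * ln (abs (c6 (bshift (tateb b) x)))
                  + 4%:R^-1 * ln (abs (bdisc (tateb b))) <= tlow z.
Proof.
move=> ne ez; have Ecl := tclamp_dbl ne ez.
have dp : 0 < abs (c6 (bshift (tateb b) x)) by rewrite abs_gt0.
have Ez : abs z = abs (bnum (tateb b) x) / abs (c6 (bshift (tateb b) x)).
  by rewrite -ez (absM na) mulfK // gt_eqF.
rewrite tate_disc lnXn //.
have q20 : 0 < q ^+ 2 by rewrite exprn_gt0.
have zmax : ln (abs z) <= ln (Num.max 1 (abs z)).
  have [z0|z0] := eqVneq (abs z) 0.
    by rewrite z0 max_l // ln1 ln_le0.
  rewrite ler_ln ?posrE ?lt_max ?ltr01 // ?le_max ?lexx ?orbT //.
  by rewrite lt_neqAle eq_sym z0 ag0.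
have max0 : 0 <= ln (Num.max 1 (abs z)) by rewrite ln_ge0 // le_max lexx.
have [x1|x1] := leP 1 (abs x).
  have x0 : 0 < abs x by apply: lt_le_trans x1.
  rewrite /tlow /tm (tclamp_big q1 x1) Ecl (tclamp_big q1 x1) mulr1 divr1.
  rewrite [Num.max 1 (q ^+ 2)]max_l; last by rewrite ltW // expr_lt1.
  rewrite ln1 oppr0 [Num.max 1 (abs x)]max_r //.
  move: zmax; rewrite Ez tate_num_big // ln_div ?posrE ?exprn_gt0 // lnXn //.
  rewrite /bern2 expr0n /= !mul0r subr0 addr0.
  by set u := ln (abs x); set w := ln (abs (c6 _)); set t := ln (Num.max _ _); set s := ln q; lra.
have [num num1 num2] := tate_num_small x1.
have bq : bern2 V (- ln q) = - V / 24%:R.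
  have -> : - ln q = V / 2%:R by rewrite mulr2n; field.
  by rewrite /bern2; move: V tateV_gt0 => v v0; field; rewrite gt_eqF.
have [xq|xq] := leP (abs x) q.
  have x0 : 0 <= abs x by [].
  have n0 : abs (bnum (tateb b) x) = q ^+ 2.
    by apply: num1; apply: sqr_lt_q.
  move: zmax; rewrite Ez n0 ln_div ?posrE // lnXn //.
  rewrite /tlow /tm Ecl (tclamp_small xq) -expr2 divff ?gt_eqF //.
  have -> : Num.max (q ^+ 2) 1 = 1 by rewrite max_r // ltW // expr_lt1.
  have -> : Num.max 1 (abs x) = 1 by rewrite max_l // ltW.
  rewrite ln1 oppr0 mulr0 add0r.
  rewrite bq /bern2 expr0n /= !mul0r subr0 addr0 Ez n0.
  by set w := ln (abs (c6 _)); set t := ln (Num.max _ _); set s := ln q; lra.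
have x0 : 0 < abs x by apply: lt_trans xq.
have den := tate_den_mid xq x1; rewrite den lnXn //.
have Em : tm (abs x) = - ln (abs x) by rewrite /tm (tclamp_mid (ltW xq) (ltW x1)).
have -> : tlow x = bern2 V (tm (abs x)).
  by rewrite /tlow max_l ?ltW // ln1 mulr0 add0r.
have p0 : 0 < abs x * abs x by apply: mulr_gt0.
(* Folding 2m back to V - 2m does not matter, since B_2 is symmetric. *)
have Ez2 : bern2 V (tm (abs z)) = bern2 V (tm (abs x) *+ 2).
  rewrite [in LHS]/tm Ecl (tclamp_mid (ltW xq) (ltW x1)) Em.
  have [h|h] := leP (q ^+ 2 / (abs x * abs x)) (abs x * abs x).
    by rewrite lnM ?posrE //; congr (bern2 _ _); rewrite mulr2n; ring.
  rewrite ln_div ?posrE // lnXn // lnM ?posrE //.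
  by rewrite -[RHS]bern2_sym; congr (bern2 _ _); rewrite !mulr2n; ring.
rewrite /tlow Ez2 bern2_double Em /bern2.
move: max0; set t := ln (Num.max _ _); set s := ln q; set u := ln (abs x) => t0.
have key (v : R) : 0 < v -> (- u) ^+ 2 / (2%:R * v) = (2%:R * (- u) ^+ 2 / v) / 4%:R.
  by move=> v0; field; rewrite gt_eqF.
rewrite key; last exact: tateV_gt0.
set Q := 2%:R * (- u) ^+ 2 / _; rewrite -[s *+ 2]mulr_natr -[u *+ 2]mulr_natr; lra.
Qed.

Lemma tate_lower P x : X P = Some x -> tlow x <= lam P.
Proof.
move=> EP; apply: (kummer_lower (S := fun => True) kum _ _ _ EP I).
- exists (V / 12%:R) => y _; rewrite /tlow lerD2l.
  exact: bern2_le (tm_ge0 _) (tm_le _).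
- by move=> y z _ ne ez; split => //; apply: tlow_dbl.
(* A move by less than q either stays in |x| <= q or preserves |x|, so [tlow] is locally
   constant. *)
- move=> y _ _; exists q => // z hz; split => //.
  rewrite /tlow /tm; have [yq|yq] := leP (abs y) q.
    have zq : abs z <= q.
      by rewrite -(subrK y z); apply: (absD_le na) => //; apply: ltW.
    by rewrite !tclamp_small // !max_l // (le_trans _ (ltW q1)).
  by rewrite (abs_close na (lt_trans hz yq)).
Qed.

Definition km P := if X P is Some x then tm (abs x) else 0.

Lemma km_ge0 P : 0 <= km P.
Proof. by rewrite /km; case: (X P) => // x; apply: tm_ge0. Qed.
Lemma km_le P : km P <= V / 2%:R.
Proof.
rewrite /km; case: (X P) => [x|]; first exact: tm_le.
by rewrite divr_ge0 // ltW // tateV_gt0.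
Qed.
Lemma km0 : km 0 = 0. Proof. by rewrite /km (kummer_0 kum). Qed.

Lemma km_lower P : P != 0 -> bern2 V (km P) <= lam P.
Proof.
move=> P0; rewrite /km; case EP: (X P) => [x|]; last first.
  by rewrite (kummer_None kum EP) eqxx in P0.
apply: le_trans (tate_lower EP); rewrite /tlow; apply: ler_wpDl => //.
by rewrite mulr_ge0 ?invr_ge0 // ln_ge0 // le_max lexx.
Qed.

Definition krel V (m1 m2 n1 n2 : R) :=
  (n1 = `|m1 - m2| /\ n2 = Num.min (m1 + m2) (V - (m1 + m2))) \/
  (n2 = `|m1 - m2| /\ n1 = Num.min (m1 + m2) (V - (m1 + m2))).

Lemma ln_tmin (r1 r2 : R) : 0 < r1 -> 0 < r2 ->
  - ln (Num.min (r1 / r2) (r2 / r1)) = `|- ln r1 - - ln r2|.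
Proof.
move=> p1 p2; have h : (r1 <= r2) = (r1 / r2 <= r2 / r1).
  by rewrite ler_pdivrMr // mulrAC ler_pdivlMr // -!expr2 ler_pXn2r ?nnegrE // ltW.
have [l12|l21] := leP r1 r2.
  rewrite min_l -?h // ln_div ?posrE // ger0_norm; first ring.
  by rewrite opprK addrC subr_ge0 ler_ln ?posrE.
rewrite min_r; last by rewrite ltW // ltNge -h -ltNge.
rewrite ln_div ?posrE // ler0_norm; first ring.
by rewrite opprK addrC subr_le0 ler_ln ?posrE // ltW.
Qed.

Lemma ln_tmax (r1 r2 : R) : 0 < r1 -> 0 < r2 ->
  - ln (Num.max (r1 * r2) (q ^+ 2 / (r1 * r2))) =
  Num.min (- ln r1 + - ln r2) (V - (- ln r1 + - ln r2)).
Proof.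
move=> p1 p2; have p12 : 0 < r1 * r2 by apply: mulr_gt0.
have q20 : 0 < q ^+ 2 by rewrite exprn_gt0.
have p3 : 0 < q ^+ 2 / (r1 * r2) by apply: divr_gt0.
have e1 : ln (r1 * r2) = ln r1 + ln r2 by rewrite lnM.
have e2 : ln (q ^+ 2 / (r1 * r2)) = ln q *+ 2 - (ln r1 + ln r2).
  by rewrite ln_div ?posrE // lnXn // e1.
have [h|h] := leP (q ^+ 2 / (r1 * r2)) (r1 * r2).
  rewrite e1 min_l; first ring.
  by move: h; rewrite -ler_ln ?posrE // e1 e2; lra.
rewrite e2 min_r; first ring.
by move: h; rewrite -ltr_ln ?posrE // e1 e2; lra.
Qed.

Lemma trel_krel r1 r2 s1 s2 : 0 < r1 -> 0 < r2 -> trel q r1 r2 s1 s2 ->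
  krel V (- ln r1) (- ln r2) (- ln s1) (- ln s2).
Proof.
by move=> p1 p2 [] [-> ->]; [left|right]; split; rewrite ?ln_tmin ?ln_tmax.
Qed.

Lemma km_opp P : km (- P) = km P. Proof. by rewrite /km (kummer_opp kum). Qed.

Lemma krel0 m : 0 <= m -> m <= V / 2%:R -> krel V m 0 m m.
Proof.
by move=> m0 mV; left; rewrite addr0 subr0 ger0_norm // min_l //; lra.
Qed.

Lemma krel_sym m1 m2 n1 n2 : krel V m1 m2 n1 n2 -> krel V m2 m1 n1 n2.
Proof. by rewrite /krel distrC [m1 + m2]addrC. Qed.

Lemma krel_swap m1 m2 n1 n2 : krel V m1 m2 n1 n2 -> krel V m1 m2 n2 n1.
Proof. by case=> -[? ?]; [right | left]. Qed.

Lemma km_dbl P : krel V (km P) (km P) 0 (km (P + P)).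
Proof.
left; rewrite subrr normr0; split => //.
have V0 := tateV_gt0.
rewrite {2 3 4 5}/km; case EP: (X P) => [x|]; last first.
  by rewrite (kummer_None kum EP) addr0 km0 addr0 subr0 min_l // ltW.
(* A 2-torsion point has m = 0 or m = V/2: strictly between, |c6| = |x|^2 is nonzero. *)
have [e0|ne] := eqVneq (c6 (bshift (tateb b) x)) 0.
  have -> : km (P + P) = 0 by rewrite (kummer_dbl0 kum EP e0) km0.
  have [x1|x1] := leP 1 (abs x).
    by rewrite /tm (tclamp_big q1 x1) ln1 oppr0 addr0 subr0 min_l // ltW.
  have [xq|xq] := leP (abs x) q.
    rewrite /tm (tclamp_small xq) min_r; first by rewrite mulr2n; ring.
    by rewrite mulr2n; lra.
  have := tate_den_mid xq x1; rewrite e0 (abs0 na) => /esym/eqP.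
  by rewrite expf_eq0 /= gt_eqF // (lt_trans q0).
have [z EZ ez] := kummer_dbl kum EP ne.
rewrite /km EZ /tm (tclamp_dbl ne ez) ln_tmax ?tclamp_gt0 //.
Qed.

Lemma km_rel P Q : krel V (km P) (km Q) (km (P + Q)) (km (P - Q)).
Proof.
case EP: (X P) => [x|]; last first.
  rewrite (kummer_None kum EP) add0r sub0r km_opp km0; apply: krel_sym.
  exact: krel0 (km_ge0 _) (km_le _).
case EQ: (X Q) => [y|]; last first.
  rewrite (kummer_None kum EQ) addr0 subr0 km0.
  exact: krel0 (km_ge0 _) (km_le _).
have [exy|ne] := eqVneq x y; last first.
  have [z [w [EZ EW es ep]]] := kummer_add kum EP EQ ne.
  rewrite /km EP EQ EZ EW; apply: trel_krel; rewrite ?tclamp_gt0 //.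
  exact: (tclamp_add na q0 q1 qb ne es ep).
have e : X P = X Q by rewrite EP EQ exy.
have [->|->] := kummer_inj kum e.
  by rewrite subrr km0; apply: krel_swap; apply: km_dbl.
rewrite addNr km0 -opprD !km_opp; exact: km_dbl.
Qed.

End TateHeight.

(** * Energy of finite sets *)

Section Combinatorics.
Variable R : realType.

Lemma sum_sum_prod N (I : finType) (f : 'I_N -> I -> R) :
  \sum_(i < N) \sum_(j < N) \sum_k f i k * f j k = \sum_k (\sum_(i < N) f i k) ^+ 2.
Proof.
transitivity (\sum_(i < N) \sum_k f i k * \sum_(j < N) f j k).
  apply: eq_bigr => i _; rewrite exchange_big; apply: eq_bigr => k _.
  by rewrite mulr_sumr.
rewrite exchange_big; apply: eq_bigr => k _.
by rewrite -mulr_suml expr2.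
Qed.

Lemma cauchy_sum n (s : 'I_n -> R) : (\sum_k s k) ^+ 2 <= n%:R * \sum_k s k ^+ 2.
Proof.
case: n s => [|n] s; first by rewrite !big_ord0 expr0n mulr0.
set S := \sum_k s k; set n' : R := n.+1%:R.
have n0 : 0 < n' by rewrite ltr0n.
have : 0 <= \sum_k (s k - S / n') ^+ 2 by apply: sumr_ge0 => k _; apply: sqr_ge0.
have -> : \sum_k (s k - S / n') ^+ 2 = \sum_k s k ^+ 2 - S ^+ 2 / n'.
  transitivity (\sum_k (s k ^+ 2 - 2%:R * (S / n') * s k + (S / n') ^+ 2)).
    by apply: eq_bigr => k _; ring.
  rewrite !big_split /= sumrN -mulr_sumr sumr_const card_ord -/S -[_ *+ n.+1]mulr_natl.
  by rewrite -/n'; move: n' n0 => n' n0; field; rewrite gt_eqF.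
by rewrite subr_ge0 ler_pdivrMr // mulrC.
Qed.

Lemma sum_le_nat (f : nat -> R) n k : (k < n)%N ->
  \sum_(t < n) (t <= k)%:R * f t = \sum_(t < k.+1) f t.
Proof.
move=> kn; rewrite -(big_mkord xpredT f) -(big_mkord xpredT (fun t => (t <= k)%:R * f t)).
rewrite (@big_cat_nat _ _ _ k.+1) //=.
have -> : \sum_(k.+1 <= t < n) (t <= k)%:R * f t = 0.
  rewrite big_nat_cond big1 // => t /andP[/andP[kt _] _].
  by rewrite leqNgt kt mul0r.
by rewrite addr0; apply: eq_big_nat => t; rewrite ltnS => /andP[_ ->]; rewrite mul1r.
Qed.

Lemma sum_id n : \sum_(t < n) t%:R = n%:R * (n%:R - 1) / 2%:R :> R.
Proof.
elim: n => [|n IHn]; first by rewrite big_ord0 mul0r mul0r.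
by rewrite big_ord_recr /= IHn -natr1; field.
Qed.

Lemma sum_sq n : \sum_(t < n) t%:R ^+ 2 = n%:R * (n%:R - 1) * (2%:R * n%:R - 1) / 6%:R :> R.
Proof.
elim: n => [|n IHn]; first by rewrite big_ord0 !mul0r.
by rewrite big_ord_recr /= IHn -natr1; field.
Qed.

(* [phi_t k = [t <= k] + t / n] turns the discrete kernel [B_2 (d / n)] into a Gram
   matrix up to a constant. *)
Lemma bernoulli_gram n (k l : 'I_n) (phi := fun (t : 'I_n) (k : nat) => (t <= k)%:R + t%:R / n%:R : R) :
  n%:R * \sum_t phi t k * phi t l - (\sum_t phi t k) * (\sum_t phi t l) =
  (n%:R ^+ 2 - 1) / 12%:R - n%:R * `|k%:R - l%:R| / 2%:R + (k%:R - l%:R) ^+ 2 / 2%:R :> R.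
Proof.
have n0 : 0 < n%:R :> R by rewrite ltr0n (leq_trans _ (ltn_ord k)).
have s1 (j : 'I_n) : \sum_t phi t j = j%:R + 1 + (n%:R - 1) / 2%:R.
  rewrite big_split /= -mulr_suml sum_id; congr (_ + _); last by field; rewrite gt_eqF.
  transitivity (\sum_(t < n) (t <= j)%:R * 1 : R); first by apply: eq_bigr => t _; rewrite mulr1.
  by rewrite (sum_le_nat (fun=> 1)) // sumr_const card_ord natr1.
have s2 (j : 'I_n) : \sum_(t < n) (t <= j)%:R * t%:R = j%:R * (j%:R + 1) / 2%:R :> R.
  by rewrite (sum_le_nat (fun t => t%:R)) // sum_id -natr1; field.
have s3 : \sum_(t < n) (t <= k)%:R * (t <= l)%:R = (k%:R + l%:R - `|k%:R - l%:R|) / 2%:R + 1 :> R.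
  wlog kl : k l / (k <= l)%N.
    move=> H; case/orP: (leq_total k l) => h; first exact: H.
    by rewrite distrC [k%:R + _]addrC -H //; apply: eq_bigr => t _; rewrite mulrC.
  rewrite (sum_le_nat (fun t => (t <= l)%:R)) //.
  transitivity (\sum_(t < k.+1) 1 : R).
    by apply: eq_bigr => t _; rewrite (leq_trans _ kl) // -ltnS.
  rewrite sumr_const card_ord -natr1 distrC ger0_norm ?subr_ge0 ?ler_nat //.
  by field.
have -> : \sum_t phi t k * phi t l = \sum_(t < n) (t <= k)%:R * (t <= l)%:R
  + (\sum_(t < n) (t <= k)%:R * t%:R + \sum_(t < n) (t <= l)%:R * t%:R) / n%:R
  + (\sum_(t < n) t%:R ^+ 2) / n%:R ^+ 2.
  rewrite -big_split !mulr_suml -!big_split /=; apply: eq_bigr => t _.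
  by rewrite /phi; field; rewrite gt_eqF.
rewrite !s1 !s2 s3 sum_sq; field; by rewrite gt_eqF.
Qed.

(** By [bernoulli_gram], n^2 times the kernel is 1/12 plus a form that is nonnegative by
    Cauchy-Schwarz over the n indices t. The left-hand side is what the constant 1/12
    contributes. *)
Lemma bernoulli_sum N n (k : 'I_N -> 'I_n) : (0 < n)%N ->
  N%:R ^+ 2 / (12%:R * n%:R ^+ 2) <= \sum_(i < N) \sum_(j < N)
    (12%:R^-1 - `|(k i)%:R - (k j)%:R| / (2%:R * n%:R)
      + ((k i)%:R - (k j)%:R) ^+ 2 / (2%:R * n%:R ^+ 2)) :> R.
Proof.
move=> n_gt0; have n0 : 0 < n%:R :> R by rewrite ltr0n.
pose phi (t : 'I_n) (k : nat) : R := (t <= k)%:R + t%:R / n%:R.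
have pos : 0 <= \sum_(i < N) \sum_(j < N) (n%:R * (\sum_t phi t (k i) * phi t (k j))
    - (\sum_t phi t (k i)) * (\sum_t phi t (k j))).
  have -> : \sum_(i < N) \sum_(j < N) (n%:R * (\sum_t phi t (k i) * phi t (k j))
    - (\sum_t phi t (k i)) * (\sum_t phi t (k j))) =
    n%:R * \sum_t (\sum_(i < N) phi t (k i)) ^+ 2 - (\sum_t \sum_(i < N) phi t (k i)) ^+ 2.
    rewrite -(sum_sum_prod (fun i t => phi t (k i))) [X in _ - X ^+ 2]exchange_big /=.
    rewrite expr2 mulr_suml mulr_sumr -sumrB; apply: eq_bigr => i _.
    by rewrite !mulr_sumr -sumrB.
  by rewrite subr_ge0; apply: cauchy_sum.
set S := (X in _ <= X).
have E : \sum_(i < N) \sum_(j < N) (n%:R * (\sum_t phi t (k i) * phi t (k j))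
    - (\sum_t phi t (k i)) * (\sum_t phi t (k j))) = n%:R ^+ 2 * S - N%:R ^+ 2 / 12%:R.
  have -> : N%:R ^+ 2 / 12%:R = \sum_(i < N) \sum_(j < N) 12%:R^-1 :> R.
    under eq_bigr do rewrite sumr_const card_ord.
    rewrite sumr_const card_ord -[_ *+ N *+ N]mulr_natr -[12%:R^-1 *+ N]mulr_natr; ring.
  rewrite /S mulr_sumr -sumrB; apply: eq_bigr => i _.
  rewrite mulr_sumr -sumrB; apply: eq_bigr => j _.
  by rewrite bernoulli_gram; field; rewrite gt_eqF.
rewrite E subr_ge0 in pos.
by rewrite invfM mulrA ler_pdivrMr ?exprn_gt0 // [S * _]mulrC.
Qed.

End Combinatorics.

(** * Classes modulo E_0 and the cyclic quotient *)

Section Classes.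
Variables (R : realType) (G : zmodType) (E0 : pred G).
Hypothesis E0_sub : forall P Q, E0 P -> E0 Q -> E0 (P - Q).
Variable (reps : seq G).
Hypothesis repsP : forall P, exists2 Q, Q \in reps & E0 (P - Q).

Lemma class_index (I : Type) (P : I -> G) :
  exists f : I -> 'I_(size reps), forall i, E0 (P i - nth 0 reps (f i)).
Proof.
have h i : exists j : 'I_(size reps), E0 (P i - nth 0 reps j).
  have [Q Qr hQ] := repsP (P i).
  have lt : (index Q reps < size reps)%N by rewrite index_mem.
  by exists (Ordinal lt); rewrite nth_index.
by exists (fun i => xchoose (h i)) => i; apply: (xchooseP (h i)).
Qed.

Lemma same_class (I : Type) (P : I -> G) (f : I -> 'I_(size reps)) :
  (forall i, E0 (P i - nth 0 reps (f i))) ->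
  forall i j, f i = f j -> E0 (P i - P j).
Proof.
move=> hf i j e; have := E0_sub (hf i) (hf j); rewrite e.
by have -> : forall a b c : G, a - c - (b - c) = a - b by move=> a b c; rewrite opprB addrA subrK.
Qed.

Lemma reps_gt0 : (0 < size reps)%N.
Proof. by have [f _] := class_index (fun _ : unit => 0); apply: leq_ltn_trans (ltn_ord (f tt)). Qed.

Lemma class_count N (P : 'I_N -> G) :
  N%:R ^+ 2 / (size reps)%:R <= \sum_(i < N) \sum_(j < N) (E0 (P i - P j))%:R :> R.
Proof.
have [f hf] := class_index P.
have c0 : 0 < (size reps)%:R :> R by rewrite ltr0n reps_gt0.
pose g i (k : 'I_(size reps)) : R := (f i == k)%:R.
have gk i : \sum_k g i k = 1.
  rewrite (bigD1 (f i)) //= /g eqxx big1 ?addr0 // => k /negPf; rewrite eq_sym => ->.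
  by [].
apply: (@le_trans _ _ (\sum_(i < N) \sum_(j < N) \sum_k g i k * g j k)).
  rewrite sum_sum_prod ler_pdivrMr // mulrC.
  apply: le_trans (cauchy_sum _).
  rewrite exchange_big /=; under eq_bigr do rewrite gk.
  by rewrite sumr_const card_ord.
apply: ler_sum => i _; apply: ler_sum => j _.
rewrite (bigD1 (f i)) //= big1 ?addr0; last first.
  by move=> k /negPf; rewrite /g eq_sym => ->; rewrite mul0r.
rewrite /g eqxx mul1r; case: eqP => [e|_]; last by rewrite ler0n.
by rewrite (same_class hf) // e.
Qed.

Variables (V : R) (m : G -> R).
Hypothesis V0 : 0 < V.
Hypothesis m_ge0 : forall P, 0 <= m P.
Hypothesis m_le : forall P, m P <= V / 2%:R.
Hypothesis m_rel : forall P Q, krel V (m P) (m Q) (m (P + Q)) (m (P - Q)).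
Hypothesis m0 : m 0 = 0.
Hypothesis E0_m : forall P, E0 P -> m P = 0.

(** When m(Q) = 0 both alternatives of the relation coincide. Thus m descends to the quotient by its
    zeros. *)
Lemma m_addr P Q : m Q = 0 -> m (P + Q) = m P.
Proof.
move=> hQ; have := m_rel P Q; rewrite hQ /krel subr0 addr0 ger0_norm //.
rewrite min_l; last by have := m_le P; lra.
by case=> -[].
Qed.

Lemma m_opp P : m (- P) = m P.
Proof.
have := m_rel 0 P; rewrite !add0r m0 /krel !add0r normrN ger0_norm //.
rewrite min_l; last by have := m_le P; lra.
by case=> -[].
Qed.

Lemma m_rep P : exists2 Q, Q \in reps & m P = m Q.
Proof.
have [Q Qr hQ] := repsP P; exists Q => //.
by rewrite -{1}(subrKC Q P) m_addr // E0_m.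
Qed.

(** All values of m are already taken on [reps], so there are finitely many. *)
Lemma m_min : (exists P, m P != 0) ->
  exists2 P0, 0 < m P0 & forall P, m P != 0 -> m P0 <= m P.
Proof.
have key (s : seq G) : has (fun P => m P != 0) s ->
    exists2 P0, 0 < m P0 & forall P, P \in s -> m P != 0 -> m P0 <= m P.
  elim: s => //= Q s IHs; have [hs _|hs] := boolP (has (fun P => m P != 0) s).
    have [P0 p0 hP0] := IHs hs.
    have [Q0|Q0] := boolP ((m Q != 0) && (m Q < m P0)).
      case/andP: Q0 => Q0 hQ; exists Q; first by rewrite lt_neqAle eq_sym Q0 m_ge0.
      move=> P; rewrite inE => /orP[/eqP->//|Ps hP].
      by apply: le_trans (ltW hQ) (hP0 _ Ps hP).
    exists P0 => // P; rewrite inE => /orP[/eqP-> hQ|]; last exact: hP0.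
    by rewrite leNgt; move: Q0; rewrite hQ.
  rewrite orbF => hQ; exists Q; first by rewrite lt_neqAle eq_sym hQ m_ge0.
  move=> P; rewrite inE => /orP[/eqP->//|Ps hP].
  by case/hasP: hs; exists P.
case=> P hP; have [Q Qr e] := m_rep P.
have hs : has (fun P => m P != 0) reps by apply/hasP; exists Q; rewrite // -e.
have [P0 p0 hP0] := key _ hs; exists P0 => // P' hP'.
have [Q' Qr' e'] := m_rep P'; rewrite e'; apply: hP0 => //; by rewrite -e'.
Qed.

Section Generator.
Variable P0 : G.
Hypothesis dl0 : 0 < m P0.
Hypothesis dl_min : forall P, m P != 0 -> m P0 <= m P.
Local Notation dl := (m P0).

(** Descent: one of Q + P0 and Q - P0 has the value |m(Q) - m(P0)|, which by minimality of m(P0) is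
    m(Q) - m(P0) as long as m(Q) is nonzero. *)
Lemma m_generator P : exists z : int, m (P - P0 *~ z) = 0.
Proof.
have key t Q : m Q < t%:R * dl -> exists z : int, m (Q - P0 *~ z) = 0.
  elim: t Q => [|t IHt] Q; first by rewrite mul0r ltNge m_ge0.
  rewrite -natr1 mulrDl mul1r => hQ.
  have [e|ne] := eqVneq (m Q) 0; first by exists 0; rewrite mulr0z subr0.
  have ge := dl_min ne.
  have h : m (Q + P0) = m Q - dl \/ m (Q - P0) = m Q - dl.
    by case: (m_rel Q P0) => -[e _]; [left|right]; rewrite e ger0_norm // subr_ge0.
  have lt : m Q - dl < t%:R * dl by rewrite ltrBlDr.
  case: h => e; rewrite -e in lt; have [z hz] := IHt _ lt.
    by exists (z - 1); rewrite mulrzBr mulr1z opprB addrA.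
  by exists (z + 1); rewrite mulrzDr mulr1z opprD addrA addrAC.
apply: (key (Num.bound (m P / dl)) P).
rewrite -ltr_pdivrMr //; apply: archi_boundP.
by rewrite divr_ge0 // ltW.
Qed.

(** Two-step induction: the relation for (k + 1) P0 and P0 gives the unordered pair of m((k + 2) P0)
    and m(k P0), and knowing the second value singles out the first. *)
Lemma m_multiple k : k%:R * dl <= V -> m (P0 *+ k) = Num.min (k%:R * dl) (V - k%:R * dl).
Proof.
have half := m_le P0; have dp := dl0.
elim/ltn_ind: k => -[|[|k]] IH hk.
- by rewrite mulr0n m0 mul0r subr0 min_l // ltW.
- by rewrite mulr1n mul1r min_l //; lra.
rewrite -!natr1 in hk *; set x := k%:R * dl.
have x0 : 0 <= x by rewrite mulr_ge0 // ltW.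
have ex (a : R) : (k%:R + a) * dl = x + a * dl by rewrite mulrDl.
have h1 := IH k.+1 (ltnSn _); have h0 := IH k (ltnW (ltnSn _)).
rewrite -natr1 ex mul1r in h1; rewrite -/x in h0.
have e2 : (k%:R + 1 + 1) * dl = x + 2%:R * dl by rewrite -addrA ex; congr (_ + _); ring.
rewrite e2 in hk *; clear IH ex e2; clearbody x.
have {}h1 : m (P0 *+ k.+1) = Num.min (x + dl) (V - (x + dl)) by apply: h1; lra.
have {}h0 : m (P0 *+ k) = Num.min x (V - x) by apply: h0; lra.
have := m_rel (P0 *+ k.+1) P0; rewrite -[P0 *+ k.+1 + P0]mulrSr.
have -> : P0 *+ k.+1 - P0 = P0 *+ k by rewrite mulrSr addrK.
rewrite h1 h0 /krel.
have [hx|hx] := leP (x + dl) (V - (x + dl)).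
  have -> : `|x + dl - dl| = x by rewrite addrK ger0_norm.
  have -> : x + dl + dl = x + 2%:R * dl by ring.
  rewrite (min_l (_ : x <= V - x)); last by lra.
  by case=> -[e1 e2]; [rewrite e1 | ].
have -> : `|V - (x + dl) - dl| = V - (x + 2%:R * dl).
  by rewrite ger0_norm; [ring | lra].
have -> : V - (V - (x + dl) + dl) = x by ring.
have -> : V - (x + dl) + dl = V - x by ring.
rewrite (min_r (_ : V - (x + 2%:R * dl) <= x + 2%:R * dl)); last by lra.
by case=> -[e1 e2]; [rewrite e1 | rewrite e2 minC].
Qed.

(** For n the integer part of V/m(P0), the value m(n P0) = V - n m(P0) lies below the least positive
    one, hence is 0. *)
Lemma period : exists2 n, (1 < n)%N & V = n%:R * dl.
Proof.
have half := m_le P0; have dp := dl0.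
have hV : 0 <= V / dl by rewrite divr_ge0 // ltW.
have [n /andP[hn1 hn2]] : exists n, (n%:R <= V / dl) && (V / dl < n.+1%:R).
  by exists (Num.truncn (V / dl)); rewrite truncn_le hV /= truncnS_gt.
rewrite ler_pdivlMr // in hn1; rewrite ltr_pdivrMr // -natr1 mulrDl mul1r in hn2.
have n2 : (1 < n)%N.
  rewrite ltnNge; apply/negP => hn.
  have : n%:R <= 1 :> R by rewrite -[1]/(1%:R) ler_nat.
  nra.
exists n => //.
have hm := m_multiple hn1.
have n2' : 2%:R <= n%:R :> R by rewrite ler_nat.
have e : m (P0 *+ n) = V - n%:R * dl by rewrite hm min_r //; nra.
have [z|nz] := eqVneq (m (P0 *+ n)) 0; first by apply/eqP; rewrite -subr_eq0 -e z.
by have := dl_min nz; rewrite e; lra.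
Qed.

Lemma m_zero_mulz P z : m P = 0 -> m (P *~ z) = 0.
Proof.
have nat_case k Q : m Q = 0 -> m (Q *+ k) = 0.
  by move=> hQ; elim: k => [|k IHk]; rewrite ?mulr0n // mulrSr m_addr.
by case: z => k h; rewrite ?NegzE ?mulrNz ?m_opp -pmulrn nat_case.
Qed.

Lemma m_residue n : (0 < n)%N -> V = n%:R * dl -> forall P,
  exists k : 'I_n, m (P - P0 *+ k) = 0.
Proof.
move=> n0 eV P; have [z hz] := m_generator P.
have hn : m (P0 *+ n) = 0.
  by rewrite m_multiple -?eV // subrr min_r // ltW.
have nz : (n%:Z != 0) by rewrite eqz_nat -lt0n.
have hk : (`|(z %% n%:Z)%Z| < n)%N.
  by rewrite -ltz_nat gez0_abs ?modz_ge0 // ltz_pmod.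
exists (Ordinal hk) => /=.
have -> : P - P0 *+ `|(z %% n%:Z)%Z| = (P - P0 *~ z) + (P0 *+ n) *~ (z %/ n%:Z)%Z.
  rewrite pmulrn gez0_abs ?modz_ge0 //.
  have := divz_eq z n%:Z; move: (z %/ _)%Z (z %% _)%Z => a c ->.
  by rewrite mulrzDr opprD addrA addrAC [P0 *+ n]pmulrn -mulrzA [n%:Z * a]mulrC subrK.
by rewrite m_addr // m_zero_mulz.
Qed.

(** The multiples k P0 with k < n lie in distinct classes, since m is positive on their differences
    and zero on E_0. *)
Lemma period_le n : (1 < n)%N -> V = n%:R * dl -> (n <= size reps)%N.
Proof.
move=> n1 eV; have [f hf] := class_index (fun k : 'I_n => P0 *+ k).
have inj : injective f.
  have key (i j : 'I_n) : (i < j)%N -> f i = f j -> False.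
    move=> ij /esym e; have := E0_m (same_class hf e); rewrite -mulrnBr ?(ltnW ij) //.
    have jn : (j - i < n)%N by apply: leq_ltn_trans (leq_subr _ _) (ltn_ord j).
    have lt : (j - i)%:R * dl < V by rewrite eV ltr_pM2r // ltr_nat.
    rewrite m_multiple ?ltW // => e0.
    have : 0 < Num.min ((j - i)%:R * dl) (V - (j - i)%:R * dl).
      by rewrite lt_min subr_gt0 lt andbT mulr_gt0 // ltr0n subn_gt0.
    by rewrite e0 ltxx.
  move=> i j e; apply/val_inj; case: (ltngtP i j) => // h; exfalso.
    exact: key h e.
  exact: key h (esym e).
by have := leq_card f inj; rewrite !card_ord.
Qed.

Lemma bern2_gen_sum N (P : 'I_N -> G) :
  N%:R ^+ 2 / (size reps)%:R ^+ 2 * (V / 12%:R) <=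
  \sum_(i < N) \sum_(j < N) bern2 V (m (P i - P j)).
Proof.
have [n n1 eV] := period; have n0 : (0 < n)%N by apply: ltnW.
have nc := period_le n1 eV.
have n0' : 0 < n%:R :> R by rewrite ltr0n.
have hk i : exists k : 'I_n, m (P i - P0 *+ k) == 0.
  by have [k hk] := m_residue n0 eV (P i); exists k; rewrite hk.
pose k i := xchoose (hk i).
have kP i : m (P i - P0 *+ k i) = 0 by apply/eqP; apply: (xchooseP (hk i)).
have symB x : bern2 V (V - x) = bern2 V x.
  by rewrite /bern2; field; rewrite gt_eqF.
have E i j : bern2 V (m (P i - P j)) = V * (12%:R^-1 - `|(k i)%:R - (k j)%:R| / (2%:R * n%:R)
      + ((k i)%:R - (k j)%:R) ^+ 2 / (2%:R * n%:R ^+ 2)).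
  have -> : m (P i - P j) = m (P0 *+ k i - P0 *+ k j).
    have -> : P i - P j = (P0 *+ k i - P0 *+ k j) + ((P i - P0 *+ k i) - (P j - P0 *+ k j)).
      by rewrite opprB addrA [_ + (P i - _)]addrAC [_ + (P i - _)]addrC subrK addrA subrK.
    by rewrite m_addr // m_addr ?kP // m_opp kP.
  have key (a c : 'I_n) : (c <= a)%N ->
     bern2 V (m (P0 *+ a - P0 *+ c)) = V * (12%:R^-1 - `|a%:R - c%:R| / (2%:R * n%:R)
      + (a%:R - c%:R) ^+ 2 / (2%:R * n%:R ^+ 2)).
    move=> ca; rewrite -mulrnBr // m_multiple; last first.
      rewrite eV ler_pM2r // ler_nat.
      by apply: leq_trans (leq_subr _ _) (ltnW (ltn_ord a)).
    rewrite -natrB // ger0_norm ?ler0n //.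
    have ed : dl = V / n%:R by rewrite eV mulrAC divff ?mul1r // gt_eqF.
    set d : R := (a - c)%:R.
    (* The symmetry of B_2 removes the minimum, so the kernel depends on |k i - k j| without
       reduction modulo n. *)
    have -> : bern2 V (Num.min (d * dl) (V - d * dl)) = bern2 V (d * dl).
      by case: leP => _; rewrite ?symB.
    rewrite ed /bern2; field.
    by rewrite !gt_eqF.
  case/orP: (leq_total (k i) (k j)) => h; last exact: key.
  by rewrite -m_opp opprB key // distrC -(sqrrN (_ - _)) opprB.
have -> : \sum_(i < N) \sum_(j < N) bern2 V (m (P i - P j)) = V * \sum_(i < N) \sum_(j < N)
    (12%:R^-1 - `|(k i)%:R - (k j)%:R| / (2%:R * n%:R)
      + ((k i)%:R - (k j)%:R) ^+ 2 / (2%:R * n%:R ^+ 2)).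
  rewrite mulr_sumr; apply: eq_bigr => i _; rewrite mulr_sumr; apply: eq_bigr => j _.
  exact: E.
apply: le_trans (_ : V * (N%:R ^+ 2 / (12%:R * n%:R ^+ 2)) <= _); last first.
  by rewrite ler_pM2l //; apply: bernoulli_sum.
have c0 : 0 < (size reps)%:R :> R by rewrite ltr0n reps_gt0.
have -> : V * (N%:R ^+ 2 / (12%:R * n%:R ^+ 2)) = N%:R ^+ 2 / n%:R ^+ 2 * (V / 12%:R).
  by field; rewrite gt_eqF.
rewrite ler_pM2r ?divr_gt0 // ler_wpM2l ?exprn_ge0 // lef_pV2 ?posrE ?exprn_gt0 //.
by rewrite lerXn2r ?nnegrE ?ler0n // ler_nat.
Qed.

End Generator.

Lemma bern2_sum N (P : 'I_N -> G) :
  N%:R ^+ 2 / (size reps)%:R ^+ 2 * (V / 12%:R) <=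
  \sum_(i < N) \sum_(j < N) bern2 V (m (P i - P j)).
Proof.
have [h|h] := pselect (exists Q, m Q != 0).
  by have [P0 dl0 dl_min] := m_min h; apply: (bern2_gen_sum dl0 dl_min).
(* With m identically zero the kernel is the constant V/12. *)
have z Q : m Q = 0 by apply/eqP; apply/negPn/negP => hQ; apply: h; exists Q.
have c1 : 1 <= (size reps)%:R :> R by rewrite -[1]/(1%:R) ler_nat reps_gt0.
have -> : \sum_(i < N) \sum_(j < N) bern2 V (m (P i - P j)) = N%:R ^+ 2 * (V / 12%:R).
  under eq_bigr => i _ do under eq_bigr => j _ do rewrite z /bern2 expr0n /= !mul0r subr0 addr0.
  under eq_bigr do rewrite sumr_const card_ord.
  by rewrite sumr_const card_ord -[_ *+ N *+ N]mulr_natr -[V / 12%:R *+ N]mulr_natr; ring.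
rewrite ler_pM2r ?divr_gt0 // ler_piMr ?exprn_ge0 //.
by rewrite invf_le1 ?exprn_gt0 ?exprn_ege1 // (lt_le_trans _ c1).
Qed.

End Classes.

Lemma energy_lower (R : realType) (G : zmodType) (E0 : pred G) (reps : seq G)
    (lam g : G -> R) (V D : R) (Z : seq G) :
  (forall P Q, E0 P -> E0 Q -> E0 (P - Q)) ->
  (forall P, exists2 Q, Q \in reps & E0 (P - Q)) ->
  0 <= V -> V <= D ->
  (forall P, P != 0 -> (E0 P)%:R * ((D - V) / 12%:R) + g P <= lam P) ->
  g 0 = V / 12%:R ->
  (forall N (P : 'I_N -> G), N%:R ^+ 2 / (size reps)%:R ^+ 2 * (V / 12%:R) <=
    \sum_(i < N) \sum_(j < N) g (P i - P j)) ->
  uniq Z -> (0 < size Z)%N ->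
  ((size reps)%:R ^- 2 - (size Z)%:R^-1) * (12%:R^-1 * D) <=
  (size Z)%:R ^- 2 *
  \sum_(i < size Z) \sum_(j < size Z | i != j) lam (nth 0 Z i - nth 0 Z j).
Proof.
move=> E0_sub repsP V0 VD hlam g0 hg uZ Z0.
have E00 : E0 0 by have [Q _ h] := repsP 0; rewrite -(subrr (0 - Q)); apply: E0_sub.
have N0 : 0 < (size Z)%:R :> R by rewrite ltr0n.
have c1 : 1 <= (size reps)%:R :> R by rewrite -[1]/(1%:R) ler_nat (reps_gt0 repsP).
have c0 : 0 < (size reps)%:R :> R by apply: lt_le_trans c1.
pose P (i : 'I_(size Z)) := nth 0 Z i.
pose h Q := (E0 Q)%:R * ((D - V) / 12%:R) + g Q.
have hall : (size Z)%:R ^+ 2 / (size reps)%:R ^+ 2 * (D / 12%:R) <=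
    \sum_(i < size Z) \sum_(j < size Z) h (P i - P j).
  have -> : \sum_(i < size Z) \sum_(j < size Z) h (P i - P j) =
     (\sum_(i < size Z) \sum_(j < size Z) (E0 (P i - P j))%:R) * ((D - V) / 12%:R)
     + \sum_(i < size Z) \sum_(j < size Z) g (P i - P j).
    rewrite mulr_suml -big_split; apply: eq_bigr => i _.
    by rewrite mulr_suml -big_split.
  have e : (size Z)%:R ^+ 2 / (size reps)%:R ^+ 2 * (D / 12%:R) =
    (size Z)%:R ^+ 2 / (size reps)%:R ^+ 2 * ((D - V) / 12%:R)
    + (size Z)%:R ^+ 2 / (size reps)%:R ^+ 2 * (V / 12%:R) by ring.
  rewrite e; apply: lerD; last exact: hg.
  apply: ler_wpM2r; first by rewrite divr_ge0 // subr_ge0.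
  apply: le_trans (class_count R E0_sub repsP P).
  (* The pair count N^2/c is weakened to N^2/c^2 to match the bound for the kernel. *)
  by rewrite ler_wpM2l ?exprn_ge0 ?ler0n // lef_pV2 ?posrE ?exprn_gt0 // ler_eXnr.
have hoff : \sum_(i < size Z) \sum_(j < size Z) h (P i - P j) - (size Z)%:R * (D / 12%:R) <=
    \sum_(i < size Z) \sum_(j < size Z | i != j) lam (P i - P j).
  have -> : (size Z)%:R * (D / 12%:R) = \sum_(i < size Z) D / 12%:R.
    by rewrite sumr_const card_ord mulr_natl.
  rewrite -sumrB; apply: ler_sum => i _.
  rewrite (bigD1 i) //= subrr /h E00 mul1r g0.
  have -> : (D - V) / 12%:R + V / 12%:R = D / 12%:R by ring.
  rewrite addrAC subrr add0r.
  under eq_bigl do rewrite eq_sym.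
  apply: ler_sum => j ij; apply: hlam.
  by rewrite subr_eq0 /P nth_uniq.
apply: le_trans (_ : (size Z)%:R ^- 2 * ((size Z)%:R ^+ 2 / (size reps)%:R ^+ 2 * (D / 12%:R)
   - (size Z)%:R * (D / 12%:R)) <= _).
  by rewrite le_eqVlt; apply/orP; left; apply/eqP; field; rewrite !gt_eqF.
rewrite ler_pM2l ?invr_gt0 ?exprn_gt0 //.
by apply: le_trans hoff; rewrite lerD2r.
Qed.

(** * Points of a Weierstrass curve *)

(** [D0] is a parameter of the type because the group axioms, and so the instance found by
    inference, depend on it. *)
Definition ecpt (K : fieldType) (W : wcoef K) (D0 : disc W != 0) :=
  {P : option (K * K) | on_curve W P}.

Section PointGroup.
Variables (K : fieldType) (W : wcoef K) (D0 : disc W != 0).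
Local Notation E := (ecpt D0).

HB.instance Definition _ := SubChoice.on E.

Definition ecmk P (CP : on_curve W P) : E := exist _ P CP.
Definition ec0 : E := @ecmk None isT.
Definition ecopp (P : E) : E := ecmk (negpt_on_curve (valP P)).
Definition ecadd (P Q : E) : E := ecmk (addpt_on_curve D0 (valP P) (valP Q)).

Lemma ecaddA : associative ecadd.
Proof. by move=> P Q T; apply/val_inj; apply: addptA; rewrite ?(valP P) ?(valP Q) ?(valP T). Qed.
Lemma ecaddC : commutative ecadd.
Proof. by move=> P Q; apply/val_inj; apply: addptC; rewrite ?(valP P) ?(valP Q). Qed.
Lemma ecadd0 : left_id ec0 ecadd.
Proof. by move=> P; apply/val_inj. Qed.
Lemma ecaddN : left_inverse ec0 ecopp ecadd.
Proof. by move=> P; apply/val_inj; apply: addpt_negl. Qed.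

HB.instance Definition _ := GRing.isZmodule.Build E ecaddA ecaddC ecadd0 ecaddN.

Lemma ec_valD (P Q : E) : val (P + Q) = addpt W (val P) (val Q). Proof. by []. Qed.
Lemma ec_valN (P : E) : val (- P) = negpt W (val P). Proof. by []. Qed.

End PointGroup.

(** * The b-invariants and x-coordinates of a Weierstrass curve *)

Section BofW.
Variables (K : fieldType) (W : wcoef K).
Local Notation a1 := (wa1 W).
Local Notation a2 := (wa2 W).
Local Notation a3 := (wa3 W).
Local Notation a4 := (wa4 W).
Local Notation a6 := (wa6 W).

Definition wbcoef := BCoef (wb2 W) (wb4 W) (wb6 W) (wb8 W).

Lemma wbcoef_rel : brel wbcoef.
Proof. by rewrite /brel /wbcoef /c2 /c4 /c6 /c8 /wb2 /wb4 /wb6 /wb8; ring. Qed.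

Lemma wbcoef_disc : bdisc wbcoef = disc W.
Proof. by []. Qed.

Lemma curve_a6 x y : on_curve W (Some (x, y)) ->
  a6 = y ^+ 2 + a1 * x * y + a3 * y - (x ^+ 3 + a2 * x ^+ 2 + a4 * x).
Proof. by move=> /eqP ->; ring. Qed.

Lemma wbcoef_c6 x y : on_curve W (Some (x, y)) ->
  c6 (bshift wbcoef x) = (2%:R * y + a1 * x + a3) ^+ 2.
Proof.
move=> /curve_a6 e; rewrite c6_shift /wbcoef /c2 /c4 /c6 /wb2 /wb4 /wb6 e; ring.
Qed.

(** Together with [wbcoef_c6] this expresses b_6 and b_8 at x as quadratic forms in the two partial
    derivatives, so that singular reduction can be read off x alone. *)
Lemma wbcoef_c8 x y : on_curve W (Some (x, y)) ->
  c8 (bshift wbcoef x) =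
   (a2 + 3%:R * x) * (2%:R * y + a1 * x + a3) ^+ 2
   - a1 * (2%:R * y + a1 * x + a3) * (3%:R * x ^+ 2 + 2%:R * a2 * x + a4 - a1 * y)
   - (3%:R * x ^+ 2 + 2%:R * a2 * x + a4 - a1 * y) ^+ 2.
Proof.
move=> /curve_a6 e.
by rewrite c8_shift /wbcoef /c2 /c4 /c6 /c8 /wb2 /wb4 /wb6 /wb8 e; ring.
Qed.

Lemma addpt_chord x1 y1 x2 y2 : x1 != x2 ->
  exists y, addpt W (Some (x1, y1)) (Some (x2, y2)) =
    Some (((y2 - y1) / (x2 - x1)) ^+ 2 + a1 * ((y2 - y1) / (x2 - x1)) - a2 - x1 - x2, y).
Proof. by move=> /negPf ne /=; rewrite ne /=; eexists. Qed.

(** The two values come from the chords to Q and to -Q. As x1 != x2, the curve equations at both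
    points can be solved for a4 and a6, which leaves an identity of rational functions. *)
Lemma chord_sum_prod x1 y1 x2 y2 : x1 != x2 ->
  on_curve W (Some (x1, y1)) -> on_curve W (Some (x2, y2)) ->
  let y2' := - y2 - a1 * x2 - a3 in
  let z := ((y2 - y1) / (x2 - x1)) ^+ 2 + a1 * ((y2 - y1) / (x2 - x1)) - a2 - x1 - x2 in
  let w := ((y2' - y1) / (x2 - x1)) ^+ 2 + a1 * ((y2' - y1) / (x2 - x1)) - a2 - x1 - x2 in
  (z + w) * (x1 - x2) ^+ 2 = bsum wbcoef x1 x2 /\
  z * w * (x1 - x2) ^+ 2 = bprod wbcoef x1 x2.
Proof.
move=> ne C1 C2; have d0 : x2 - x1 != 0 by rewrite subr_eq0 eq_sym.
have e6 := curve_a6 C1; have e6' := curve_a6 C2.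
have e4 : a4 = ((y2 ^+ 2 + a1 * x2 * y2 + a3 * y2 - (x2 ^+ 3 + a2 * x2 ^+ 2)) -
   (y1 ^+ 2 + a1 * x1 * y1 + a3 * y1 - (x1 ^+ 3 + a2 * x1 ^+ 2))) / (x2 - x1).
  apply: (mulIf d0); rewrite divfK //.
  transitivity (a4 * x2 - a4 * x1); first ring.
  have -> : a4 * x2 = y2 ^+ 2 + a1 * x2 * y2 + a3 * y2 - (x2 ^+ 3 + a2 * x2 ^+ 2) - a6.
    by rewrite e6'; ring.
  have -> : a4 * x1 = y1 ^+ 2 + a1 * x1 * y1 + a3 * y1 - (x1 ^+ 3 + a2 * x1 ^+ 2) - a6.
    by rewrite e6; ring.
  ring.
move=> y2' z w; rewrite /z /w /y2' /bsum /bprod /wbcoef /c2 /c4 /c6 /c8 /wb2 /wb4 /wb6 /wb8.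
by split; rewrite e6 e4; field.
Qed.

Lemma dbl_x x y : on_curve W (Some (x, y)) -> 2%:R * y + a1 * x + a3 != 0 ->
  exists z y', addpt W (Some (x, y)) (Some (x, y)) = Some (z, y') /\
    z * c6 (bshift wbcoef x) = bnum wbcoef x.
Proof.
move=> C n0 /=; rewrite eqxx /=.
have -> : (y + y + a1 * x + a3 == 0) = false.
  by apply/negP => /eqP e; case/eqP: n0; rewrite -e; ring.
do 2!eexists; split; first by [].
rewrite (wbcoef_c6 C) /bnum /wbcoef /c4 /c6 /c8 /wb4 /wb6 /wb8 (curve_a6 C).
by field.
Qed.

Lemma dbl_None x y : 2%:R * y + a1 * x + a3 = 0 ->
  addpt W (Some (x, y)) (Some (x, y)) = None.
Proof.
move=> e /=; rewrite eqxx /=.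
have -> : y + y + a1 * x + a3 = 0 by rewrite -e; ring.
by rewrite eqxx.
Qed.

End BofW.

(** * Heights and E_0 of a Weierstrass curve on the x-line *)

Section KummerOfW.
Variables (R : realType) (K : fieldType) (abs : K -> R).
Hypothesis na : is_nonarch_abs abs.
Hypothesis cpl : abs_complete abs.
Hypothesis two0 : (2%:R : K) != 0.
Variable pi : K.
Hypotheses (pi0 : pi != 0) (pi1 : abs pi < 1).
Let ag0 x : 0 <= abs x := abs_ge0 na x.
Variables (W : wcoef K) (D0 : disc W != 0) (lam : K * K -> R).
Hypothesis ner : is_neron_local_height abs W lam.
Local Notation a1 := (wa1 W).
Local Notation a2 := (wa2 W).
Local Notation a3 := (wa3 W).

(* If [x0] is a root of the 2-division polynomial [c6], then for small [eta] its value at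
   [x0 + g eta ^+ 2], with [g] its derivative at [x0], is a square. *)
Lemma torsion_approx x0 y0 (d : R) : on_curve W (Some (x0, y0)) ->
  2%:R * y0 + a1 * x0 + a3 = 0 -> 0 < d -> exists x y,
  [/\ on_curve W (Some (x, y)), abs (x - x0) < d, abs (y - y0) < d
    & c6 (bshift (wbcoef W) x) != 0].
Proof.
move=> C e0 dp; have e6 := wbcoef_c6 C; rewrite e0 expr0n /= in e6.
set B := bshift (wbcoef W) x0 in e6.
have hr : brel B by apply: brel_shift; apply: wbcoef_rel.
have n4 : (4%:R : K) != 0.
  by rewrite (_ : 4%:R = 2%:R * 2%:R :> K) ?mulf_neq0 //; ring.
(* The root x0 is simple: b_4 = b_6 = 0 would give b_8 = 0 and a vanishing discriminant. *)
have c40 : c4 B != 0.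
  apply: contraNneq D0 => e4; rewrite -wbcoef_disc -(bdisc_shift x0 (wbcoef_rel W)).
  move: hr; rewrite /brel e6 mulr0 e4 expr0n subr0 => /eqP.
  rewrite mulf_eq0 (negPf n4) /= => /eqP e8.
  by rewrite /bdisc -/B e4 e6 e8; apply/eqP; ring.
pose g := 2%:R * c4 B.
have g0 : g != 0 by rewrite mulf_neq0.
pose C1 : R := 1 + abs (c2 B / 4%:R) + abs g + abs (g / 2%:R) + abs (a1 * g / 2%:R).
have [q1 q2 q3 q4] : [/\ 0 <= abs (c2 B / 4%:R), 0 <= abs g, 0 <= abs (g / 2%:R)
  & 0 <= abs (a1 * g / 2%:R)] by [].
have C1p : 0 < C1 by rewrite /C1; lra.
pose e := Num.min 1 d / C1.
have ep : 0 < e by rewrite divr_gt0 // lt_min ltr01.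
have [n Hn] := exprn_small (ag0 pi) pi1 ep.
pose eta := pi ^+ n.+1.
have eta0 : eta != 0 by rewrite expf_neq0.
have etae : abs eta < e by rewrite (absX na); apply: Hn.
have eta1 : abs eta <= 1 by rewrite (absX na) exprn_ile1 // ltW.
have small c : abs c <= C1 -> abs (c * eta) < Num.min 1 d.
  move=> cC; apply: (@le_lt_trans _ _ (C1 * abs eta)).
    by rewrite (absM na) ler_wpM2r.
  by rewrite mulrC -ltr_pdivlMr.
have small1 c v : abs c <= C1 -> abs v <= 1 -> abs (c * eta * v) < Num.min 1 d.
  move=> cC v1; apply: le_lt_trans (small _ cC).
  by rewrite (absM na) ler_piMr.
(* For t = g eta^2 the value 4 t^3 + b_2 t^2 + g t is (g eta)^2 (1 + 4f), and 1 + 4f = (1 +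
   2w)^2. *)
pose f := c2 B / 4%:R * eta ^+ 2 + g * eta ^+ 4.
have f1 : abs f < 1.
  have : abs f < Num.min 1 d; last by rewrite lt_min => /andP[].
  apply: (absD_lt na).
    have -> : c2 B / 4%:R * eta ^+ 2 = c2 B / 4%:R * eta * eta by ring.
    by apply: small1 => //; rewrite /C1; lra.
  have -> : g * eta ^+ 4 = g * eta * eta ^+ 3 by ring.
  apply: small1; first by rewrite /C1; lra.
  by rewrite (absX na) exprn_ile1.
have [w [ew hw]] := artin_schreier_root na cpl f1.
have w1 : abs (1 + 2%:R * w) = 1.
  rewrite (absDl na) ?(abs1 na) //.
  by apply: (abs_natM_lt na); apply: le_lt_trans f1.
pose Y := g * eta * (1 + 2%:R * w).
pose x := x0 + g * eta ^+ 2.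
pose y := (Y - a1 * x - a3) / 2%:R.
have EY : c6 (bshift (wbcoef W) x) = Y ^+ 2.
  rewrite /x -bshiftD c6_shift -/B e6.
  transitivity ((g * eta) ^+ 2 * (1 + 4%:R * (w ^+ 2 + w))); last by rewrite /Y; ring.
  by rewrite ew /f /g; field.
have Y0 : Y != 0.
  by rewrite !mulf_neq0 // -(abs_eq0 na) w1 oner_eq0.
have ey0 : y0 = (- a1 * x0 - a3) / 2%:R.
  apply: (mulIf two0); rewrite divfK //; apply/eqP; rewrite -subr_eq0 -e0; apply/eqP; ring.
exists x, y; split.
- have E : 2%:R * y + a1 * x + a3 = Y by rewrite /y; field.
  apply/eqP; apply: (mulfI n4); apply/eqP; rewrite -subr_eq0; apply/eqP.
  transitivity ((2%:R * y + a1 * x + a3) ^+ 2 - c6 (bshift (wbcoef W) x)).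
    by rewrite c6_shift /wbcoef /c2 /c4 /c6 /wb2 /wb4 /wb6; ring.
  by rewrite E EY subrr.
- have -> : x - x0 = g * eta * eta by rewrite /x; ring.
  have : abs (g * eta * eta) < Num.min 1 d by apply: small1 => //; rewrite /C1; lra.
  by rewrite lt_min => /andP[].
- have -> : y - y0 = g / 2%:R * eta * (1 + 2%:R * w) - a1 * g / 2%:R * eta * eta.
    by rewrite ey0 /y /Y /x; field.
  have : abs (g / 2%:R * eta * (1 + 2%:R * w) - a1 * g / 2%:R * eta * eta) < Num.min 1 d.
    apply: (absB_lt na); apply: small1; rewrite ?w1 //; rewrite /C1; lra.
  by rewrite lt_min => /andP[].
- by rewrite EY expf_neq0.
Qed.

Definition ecX (P : ecpt D0) : option K := omap fst (val P).
Definition eclam (P : ecpt D0) : R := lamE lam (val P).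

Lemma ecX_Some P x : ecX P = Some x -> exists2 y, val P = Some (x, y) & on_curve W (Some (x, y)).
Proof.
rewrite /ecX; case: P => [[[x' y]|] C] //= [<-]; by exists y.
Qed.

Lemma kummer_ec : kummer abs eclam (wbcoef W) ecX.
Proof.
case: ner => hcont hbnd [L hL] hdbl.
split => //.
- exact: wbcoef_rel.
- by case=> [[[x y]|] C] //= _; apply/val_inj.
- by case=> [[[x y]|] C].
- move=> P Q; rewrite /ecX => h.
  case EP: (val P) h => [[x1 y1]|]; case EQ: (val Q) => [[x2 y2]|] //=; last first.
    by move=> _; left; apply/val_inj; rewrite EP EQ.
  case=> ex; have C1 := valP P; have C2 := valP Q; rewrite /= EP ex in C1; rewrite /= EQ in C2.
  have : (y1 - y2) * (y1 + y2 + a1 * x2 + a3) == 0.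
    apply/eqP; transitivity ((y1 ^+ 2 + a1 * x2 * y1 + a3 * y1) - (y2 ^+ 2 + a1 * x2 * y2 + a3 * y2)).
      by ring.
    by rewrite (eqP C1) (eqP C2) subrr.
  rewrite mulf_eq0 => /orP[/eqP h|/eqP h]; [left|right]; apply/val_inj.
    by rewrite EP EQ ex; congr (Some (_, _)); apply/eqP; rewrite -subr_eq0 h.
  rewrite ec_valN EP EQ ex /=; congr (Some (_, _)); apply/eqP; rewrite -subr_eq0 -h.
  by apply/eqP; ring.
- move=> P Q x1 x2 /ecX_Some[y1 EP C1] /ecX_Some[y2 EQ C2] ne.
  have [yz ez] := addpt_chord W y1 y2 ne.
  have [yw ew] := addpt_chord W y1 (- y2 - a1 * x2 - a3) ne.
  have [hs hp] := chord_sum_prod ne C1 C2.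
  eexists; eexists; split; [| | exact: hs | exact: hp].
    by rewrite /ecX ec_valD EP EQ ez.
  by rewrite /ecX ec_valD ec_valN EP EQ [negpt _ _]/= ew.
- move=> P x /ecX_Some[y EP C]; rewrite (wbcoef_c6 C) expf_eq0 /= => n0.
  have [z [y' [e1 e2]]] := dbl_x C n0; exists z; last by rewrite -(wbcoef_c6 C).
  by rewrite /ecX ec_valD EP e1.
- move=> P x /ecX_Some[y EP C]; rewrite (wbcoef_c6 C) => /eqP; rewrite expf_eq0 /= => /eqP e.
  by apply/val_inj; rewrite ec_valD EP dbl_None.
(* The limit condition near O, taken with error 1, and boundedness elsewhere give the lower
   bound. *)
- have [M hM] := hL _ ltr01; set M1 := Num.max M 1.
  have [b hb] := hbnd M1.
  have M11 : 1 <= M1 by rewrite le_max lexx orbT.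
  exists (Num.max (1 - L) (b + 2%:R^-1 * ln M1)) => P x /ecX_Some[y EP C].
  rewrite /eclam EP /=; set c := Num.max _ (b + _).
  have c1 : 1 - L <= c by rewrite le_max lexx.
  have c2 : b + 2%:R^-1 * ln M1 <= c by rewrite le_max lexx orbT.
  have [xM|xM] := leP (abs x) M1.
    have := hb _ _ C xM; rewrite ler_norml => /andP[h _].
    have : ln (Num.max 1 (abs x)) <= ln M1.
      by rewrite ler_ln ?posrE ?lt_max ?ltr01 ?orbT // ge_max M11.
    lra.
  have xM' : M < abs x by apply: le_lt_trans xM; rewrite le_max lexx.
  have x1 : 1 <= abs x by apply: le_trans M11 (ltW xM).
  have := hM _ _ C xM'; rewrite ltr_norml => /andP[h _].
  rewrite max_r //; lra.
- move=> P x /ecX_Some[y EP C]; rewrite (wbcoef_c6 C) expf_eq0 /= => n0.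
  have [z [y' [e1 e2]]] := dbl_x C n0.
  have := hdbl x y C; rewrite e1 => /(_ isT).
  rewrite /eclam ec_valD EP e1 /= => ->.
  have p0 : 0 < abs (2%:R * y + a1 * x + a3) by rewrite abs_gt0.
  rewrite (absX na) lnXn // wbcoef_disc mulr2n; lra.
- move=> P x /ecX_Some[y EP C]; rewrite (wbcoef_c6 C) => /eqP; rewrite expf_eq0 /= => /eqP e0.
  move=> d e dp ep; have [d' dp' hd] := hcont _ _ C _ ep.
  have mp : 0 < Num.min d d' by rewrite lt_min dp.
  have [x' [y' [C' hx hy ne]]] := torsion_approx C e0 mp.
  move: hx hy; rewrite !lt_min => /andP[hx hx'] /andP[hy hy'].
  exists (ecmk D0 C'), x'; split => //.
  by rewrite /eclam EP /=; apply: hd.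
Qed.

Variables (u r s t : K).
Hypothesis u0 : u != 0.
Hypothesis intW : integral_model abs (chg W u r s t).

Definition minX (P : ecpt D0) := omap (fun x => (x - r) / u ^+ 2) (ecX P).

Lemma wbcoef_chg : wbcoef (chg W u r s t) = bscale (bshift (wbcoef W) r) (u ^+ 2).
Proof.
rewrite /wbcoef /bscale /bshift /c2 /c4 /c6 /c8 /wb2 /wb4 /wb6 /wb8 /chg /=.
by congr BCoef; field.
Qed.

Lemma kummer_min : kummer abs eclam (wbcoef (chg W u r s t)) minX.
Proof. by rewrite wbcoef_chg; apply: kummer_affine kummer_ec; rewrite // expf_neq0. Qed.

Lemma bintegral_min : bintegral abs (wbcoef (chg W u r s t)).
Proof.
case: intW; set M := chg W u r s t => h1 h2 h3 h4 h6.
have mul1 v w : abs v <= 1 -> abs w <= 1 -> abs (v * w) <= 1.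
  by move=> ? ?; rewrite (absM na) mulr_ile1.
have n1 n := abs_nat na n.
have sq v : abs v <= 1 -> abs (v ^+ 2) <= 1 by move=> ?; rewrite (absX na) exprn_ile1.
split; rewrite /wbcoef /c2 /c4 /c6 /c8 /wb2 /wb4 /wb6 /wb8.
- exact: (absD_le na (sq _ h1) (mul1 _ _ (n1 _) h2)).
- exact: (absD_le na (mul1 _ _ (n1 _) h4) (mul1 _ _ h1 h3)).
- exact: (absD_le na (sq _ h3) (mul1 _ _ (n1 _) h6)).
- exact: (absB_le na (absD_le na (absB_le na (absD_le na (mul1 _ _ (sq _ h1) h6)
    (mul1 _ _ (mul1 _ _ (n1 _) h2) h6)) (mul1 _ _ (mul1 _ _ h1 h3) h4))
    (mul1 _ _ h2 (sq _ h3))) (sq _ h4)).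
Qed.

Lemma chg_on_curve x y : on_curve W (Some (x, y)) ->
  on_curve (chg W u r s t) (Some ((x - r) / u ^+ 2, (y - s * (x - r) - t) / u ^+ 3)).
Proof.
move=> /curve_a6 e; apply/eqP; rewrite /chg /= e; by field.
Qed.

(** If |x| > 1 both sides hold. Otherwise y is integral too, and the formulas for b_6 and b_8 in the
    partial derivatives translate one condition into the other. *)
Lemma in_E0_min (P : ecpt D0) :
  in_E0 abs W u r s t (val P) <-> kE0 abs (wbcoef (chg W u r s t)) minX P.
Proof.
rewrite /kE0 /minX /in_E0; case EX: (ecX P) => [x|] /=; last first.
  by case: P EX => [[[x y]|] C]; split.
have [y EP C] := ecX_Some EX; rewrite EP /=.
have := chg_on_curve C; have hB := bintegral_min; have := intW.
move: (_ / u ^+ 2) (_ / u ^+ 3) => x' y'; set M := chg W u r s t in hB *.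
case=> h1 h2 h3 h4 h6 C'.
have mul1 v w : abs v <= 1 -> abs w <= 1 -> abs (v * w) <= 1.
  by move=> ? ?; rewrite (absM na) mulr_ile1.
have mul1l v w : abs v < 1 -> abs w <= 1 -> abs (v * w) < 1.
  by move=> ? ?; rewrite mulrC (absM na) -[X in _ < X]mulr1; apply: ler_ltM.
have n1 n := abs_nat na n.
have sq n v : abs v <= 1 -> abs (v ^+ n) <= 1 by move=> ?; rewrite (absX na) exprn_ile1.
have [x1|x1] := ltP 1 (abs x').
  split=> _; last by left.
  by apply: le_trans (bmu_big na hB x1); rewrite exprn_ege1 // ltW.
(* For integral x, a y of size above 1 would make y^2 dominate the equation. *)
have y1 : abs y' <= 1.
  rewrite leNgt; apply/negP => y1.
  have y2 : abs y' < abs y' ^+ 2 by rewrite expr2 ltr_pMr // (lt_trans ltr01).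
  have lhs : abs (y' ^+ 2 + wa1 M * x' * y' + wa3 M * y') = abs y' ^+ 2.
    rewrite -addrA (absDl na) (absX na) //; apply: (absD_lt na); apply: le_lt_trans y2.
      by rewrite (absM na); apply: ler_piMl => //; apply: mul1.
    by rewrite (absM na); apply: ler_piMl.
  move: C' => /eqP C'; have : abs y' ^+ 2 <= 1.
    rewrite -lhs C'.
    exact: (absD_le na (absD_le na (absD_le na (sq _ _ x1) (mul1 _ _ h2 (sq _ _ x1)))
      (mul1 _ _ h4 x1)) h6).
  by rewrite leNgt exprn_egt1.
have fx1 : abs (3%:R * x' ^+ 2 + 2%:R * wa2 M * x' + wa4 M - wa1 M * y') <= 1.
  exact: (absB_le na (absD_le na (absD_le na (mul1 _ _ (n1 _) (sq _ _ x1))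
    (mul1 _ _ (mul1 _ _ (n1 _) h2) x1)) h4) (mul1 _ _ h1 y1)).
have a2x : abs (wa2 M + 3%:R * x') <= 1 by apply: (absD_le na h2 (mul1 _ _ (n1 _) x1)).
rewrite /bmu (wbcoef_c6 C') (wbcoef_c8 C').
move: (2%:R * y' + _ + _) (3%:R * x' ^+ 2 + _ + _ - _) fx1 => py px fx1.
have [[hy hx]|h] := pselect (abs py < 1 /\ abs px < 1).
  split; first by case=> // -[].
  have py2 : abs (py ^+ 2) < 1 by rewrite (absX na) exprn_ilt1.
  have px2 : abs (px ^+ 2) < 1 by rewrite (absX na) exprn_ilt1.
  rewrite leNgt gt_max !exprn_ilt1 //.
  apply: (absB_lt na (absB_lt na _ _) px2); first by rewrite mulrC; apply: mul1l.
  by rewrite [wa1 M * py]mulrC -mulrA; apply: mul1l => //; apply: mul1.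
split=> _; last by right.
rewrite leNgt gt_max; apply/negP => /andP[]; rewrite !expr_lt1 // (absX na) expr_lt1 // => hy h8.
apply: h; split=> //; rewrite -(@expr_lt1 _ 2) // -(absX na).
have py2 : abs (py ^+ 2) < 1 by rewrite (absX na) exprn_ilt1.
set A := (wa2 M + _) * _ in h8; set B := _ * px in h8.
(* The terms of b_8 containing [py] are small, so a small b_8 forces a small [px]. *)
have -> : px ^+ 2 = A - B - (A - B - px ^+ 2) by ring.
apply: (absB_lt na _ h8); apply: (absB_lt na).
  by rewrite /A mulrC; apply: mul1l.
by rewrite /B [wa1 M * py]mulrC -mulrA; apply: mul1l => //; apply: mul1.
Qed.

End KummerOfW.

(** * The energy bound on the x-line and on E *)

Section KummerEnergy.
Variables (R : realType) (K : fieldType) (abs : K -> R).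
Hypothesis na : is_nonarch_abs abs.
Hypothesis cpl : abs_complete abs.
Hypothesis two0 : (2%:R : K) != 0.
Hypothesis three0 : (3%:R : K) != 0.
Let ag0 x : 0 <= abs x := abs_ge0 na x.

(** By contraposition: if |x| < 1 on the Tate curve, then x reduces to the node and b_6, b_8 at x
    are small. Returning to B multiplies them by k^3 and k^4, which keeps them small as |k| <= 1. *)
Lemma kE0_tate (G : zmodType) (B : bcoef K) (X : G -> option K) x0 k b q :
  k != 0 -> abs k <= 1 -> 0 < q -> q < 1 -> q ^+ 2 = abs b ->
  bscale (bshift B x0) k = tateb b -> forall P, kE0 abs B X P ->
  km abs q (fun P => omap (fun x => (x - x0) / k) (X P)) P = 0.
Proof.
move=> k0 k1 q0 q1 qb eT P; rewrite /kE0 /km; case: (X P) => [x|] //= hx.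
rewrite /tm tclamp_big ?ln1 ?oppr0 // leNgt; apply/negP => xs.
move: hx; rewrite leNgt => /negP[].
have := bshift_affine B x0 ((x - x0) / k) k0; rewrite eT.
rewrite [k * _]mulrC divfK // [x0 + _]addrC subrK; move: (_ / k) xs => v v1 e.
have b1 : abs b < 1 by rewrite -qb expr_lt1 // ltW.
have v1' n : abs (v ^+ n.+1) < 1 by rewrite (absX na) exprn_ilt1.
have kn n (c : K) : abs c < 1 -> abs (c * k ^+ n) < 1.
  move=> c1; rewrite mulrC (absM na) (absX na) -[X in _ < X]mulr1.
  by apply: ler_ltM => //; rewrite exprn_ile1.
have kf n : k ^+ n != 0 by rewrite expf_neq0.
have e6 : c6 (bshift B x) = c6 (bshift (tateb b) v) * k ^+ 3.
  by rewrite e /bscale [c6 (BCoef _ _ _ _)]/c6 divfK.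
have e8 : c8 (bshift B x) = c8 (bshift (tateb b) v) * k ^+ 4.
  by rewrite e /bscale [c8 (BCoef _ _ _ _)]/c8 divfK.
rewrite /bmu gt_max !exprn_ilt1 //.
  rewrite e8; apply: kn.
  have -> : c8 (bshift (tateb b) v) = b + 12%:R * (b * v) + v ^+ 3 + 3%:R * v ^+ 4.
    by rewrite c8_shift /tateb /c2 /c4 /c6 /c8; ring.
  apply: (absD_lt na (absD_lt na (absD_lt na b1 (abs_natM_lt na _ _)) (v1' _))
     (abs_natM_lt na _ (v1' _))).
  by rewrite (absM na) mulr_ilt1.
rewrite e6; apply: kn.
have -> : c6 (bshift (tateb b) v) = 4%:R * b + v ^+ 2 + 4%:R * v ^+ 3.
  by rewrite c6_shift /tateb /c2 /c4 /c6; ring.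
exact: (absD_lt na (absD_lt na (abs_natM_lt na _ b1) (v1' _)) (abs_natM_lt na _ (v1' _))).
Qed.

Lemma kummer_energy (G : zmodType) (lam : G -> R) (B : bcoef K) (X : G -> option K)
    (reps Z : seq G) :
  kummer abs lam B X -> bintegral abs B ->
  (forall P, exists2 Q, Q \in reps & kE0 abs B X (P - Q)) ->
  uniq Z -> (0 < size Z)%N ->
  ((size reps)%:R ^- 2 - (size Z)%:R^-1) * (12%:R^-1 * - ln (abs (bdisc B))) <=
  (size Z)%:R ^- 2 *
  \sum_(i < size Z) \sum_(j < size Z | i != j) lam (nth 0 Z i - nth 0 Z j).
Proof.
move=> kum hB repsP uZ Z0.
have E0_sub := kE0_sub na kum hB.
have d0 := kummer_disc kum; have hr := kummer_rel kum.
have dp : 0 < abs (bdisc B) by rewrite abs_gt0.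
have E0_lam P : P != 0 -> kE0 abs B X P -> - ln (abs (bdisc B)) / 12%:R <= lam P.
  move=> P0; rewrite /kE0; case EP: (X P) => [x|]; last by rewrite (kummer_None kum EP) eqxx in P0.
  by move=> /(kummer_E0_lower na kum hB EP); lra.
(* The dichotomy |j| <= 1 or |j| > 1. *)
have [hc|hc] := leP (abs (c2 B ^+ 2 - 24%:R * c4 B) ^+ 3) (abs (bdisc B)).
  have d1 : abs (bdisc B) <= 1.
    have [i2 i4 i6 i8] := hB.
    have mul1 v w : abs v <= 1 -> abs w <= 1 -> abs (v * w) <= 1.
      by move=> ? ?; rewrite (absM na) mulr_ile1.
    have n1 n := abs_nat na n.
    have sq n v : abs v <= 1 -> abs (v ^+ n) <= 1 by move=> ?; rewrite (absX na) exprn_ile1.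
    rewrite /bdisc mulNr.
    apply: (absD_le na (absB_le na (absB_le na _ (mul1 _ _ (n1 _) (sq _ _ i4)))
      (mul1 _ _ (n1 _) (sq _ _ i6))) (mul1 _ _ (mul1 _ _ (mul1 _ _ (n1 _) i2) i4) i6)).
    by rewrite (absN na); apply: mul1 => //; apply: sq.
  apply: (energy_lower (g := fun=> 0) (V := 0) E0_sub repsP) => //.
  - by rewrite oppr_ge0 ln_le0.
  - move=> P P0; rewrite addr0 subr0; case E: (kE0 abs B X P); rewrite ?mul1r ?mul0r.
      exact: E0_lam.
    exact: (kummer_potgood_lower na kum hB hc).
  - by rewrite mul0r.
  - by move=> N P; rewrite mul0r mulr0 big1 // => i _; rewrite big1.
have [x0 [k [b [k0 b0 b1 k1 [eT eD]]]]] := tate_model na cpl two0 three0 hr d0 hB hc.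
have kumT := kummer_affine na x0 k0 kum; rewrite eT in kumT.
set XT := (fun P => _) in kumT.
have bp : 0 < abs b by rewrite abs_gt0.
pose q := Num.sqrt (abs b).
have q0 : 0 < q by rewrite sqrtr_gt0.
have qb : q ^+ 2 = abs b by rewrite sqr_sqrtr // ltW.
have q1 : q < 1 by rewrite -(@expr_lt1 _ 2) ?qb // ltW.
have E0_m P : kE0 abs B X P -> km abs q XT P = 0.
  exact: (kE0_tate k0 k1 q0 q1 qb eT).
set V := - (ln q *+ 2).
have V0 : 0 < V := tateV_gt0 q0 q1.
have m_ge0 P : 0 <= km abs q XT P by apply: km_ge0.
have m_le P : km abs q XT P <= V / 2%:R by apply: km_le.
have kp : 0 < abs k by rewrite abs_gt0.
have VD : V <= - ln (abs (bdisc B)).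
  rewrite /V -lnXn // qb eD lerN2 ler_ln ?posrE ?mulr_gt0 ?exprn_gt0 //.
  by rewrite ger_pMr // exprn_ile1.
apply: (energy_lower (g := fun P => bern2 V (km abs q XT P)) (V := V) E0_sub repsP) => //.
- exact: ltW.
- move=> P P0; case E: (kE0 abs B X P); rewrite ?mul1r ?mul0r ?add0r.
    (* On E_0 the kernel is at most V/12, so the two terms together stay below D/12. *)
    have := E0_lam _ P0 E; have := bern2_le q0 q1 (m_ge0 P) (m_le P); rewrite -/V; lra.
  exact: (km_lower na q0 q1 qb kumT).
- by rewrite (km0 _ kumT) /bern2 expr0n /= !mul0r subr0 addr0.
- move=> N P; apply: (bern2_sum E0_sub repsP V0 m_ge0 m_le _ (km0 _ kumT) E0_m).
  exact: (km_rel na q0 q1 qb kumT).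
Qed.

End KummerEnergy.

Theorem lemma3p1 (R : realType) (k : fieldExtType rat) (K : fieldType)
  (abs : K -> R) (iota : {rmorphism k -> K}) (p : nat) (E : wcoef k)
  (u r s t : K) (lam : K * K -> R) (cv : nat) (Z : seq (option (K * K))) :
  prime p ->
  is_nonarch_abs abs ->
  abs p%:R = p%:R^-1 ->
  abs_complete abs ->
  abs_dense abs iota ->
  disc E != 0 ->
  is_minimal_change abs (map_wcoef iota E) u r s t ->
  is_neron_local_height abs (map_wcoef iota E) lam ->
  is_tamagawa abs (map_wcoef iota E) u r s t cv ->
  uniq Z ->
  all (on_curve (map_wcoef iota E)) Z ->
  (0 < size Z)%N ->
  Lambda (map_wcoef iota E) lam Z >=
    (cv%:R ^- 2 - (size Z)%:R^-1) *
    (12%:R^-1 * ln (abs ((disc (chg (map_wcoef iota E) u r s t))^-1))).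
Proof.
move=> p_prime na absp cpl _ D0' [u0 intW _] ner [reps [szr Cr _ repsP]] uZ CZ Z0.
set W := map_wcoef iota E in intW ner Cr repsP CZ *.
have D0 : disc W != 0.
  have -> : disc W = iota (disc E).
    by rewrite /disc /wb8 /wb6 /wb4 /wb2 /W /=; ring.
  by rewrite fmorph_eq0.
(* K contains the number field k, so it has characteristic 0. *)
have nat0 n : (0 < n)%N -> (n%:R : K) != 0.
  move=> n0; rewrite -(rmorph_nat iota) fmorph_eq0.
  have -> : (n%:R : k) = (n%:R : rat)%:A by rewrite scaler_nat.
  by rewrite scaler_eq0 oner_eq0 orbF pnatr_eq0 -lt0n.
have p0 : (p%:R : K) != 0 by apply: nat0; apply: prime_gt0.
(* The prime p serves as the small element whose powers approximate 2-torsion points. *)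
have p1 : abs p%:R < 1.
  by rewrite absp invf_lt1 ?ltr1n ?ltr0n ?prime_gt0 ?prime_gt1.
have kum := kummer_min na cpl (nat0 2%N isT) p0 p1 D0 ner r s t u0.
have hB := bintegral_min na intW.
set B1 := wbcoef _ in kum hB.
have E0P P := in_E0_min na (D0 := D0) u0 intW P.
(* The default 0 is taken off the curve only; all members of [Z] and [reps] lie on it. *)
pose lift (P : option (K * K)) : ecpt D0 := insubd (0 : ecpt D0) P.
have liftK P : on_curve W P -> val (lift P) = P by move=> CP; apply: insubdK.
have reps'P P : exists2 Q, Q \in map lift reps & kE0 abs B1 (minX u r) (P - Q).
  have [Q Qr hQ] := repsP _ (valP P); exists (lift Q); first exact: map_f.
  apply/E0P; rewrite ec_valD ec_valN liftK //; exact: (allP Cr).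
have uZ' : uniq (map lift Z).
  rewrite map_inj_in_uniq // => P Q /(allP CZ) CP /(allP CZ) CQ e.
  by rewrite -(liftK _ CP) e liftK.
have := @kummer_energy _ _ _ na cpl (nat0 2%N isT) (nat0 3%N isT) _ _ _ _
  (map lift reps) (map lift Z) kum hB reps'P uZ'.
rewrite !size_map szr => /(_ Z0).
rewrite wbcoef_disc (absV na) lnV; last first.
  by rewrite posrE abs_gt0 // -wbcoef_disc (kummer_disc kum).
move=> h; apply: le_trans h _; rewrite /Lambda le_eqVlt; apply/orP; left; apply/eqP.
congr (_ * _); apply: eq_bigr => i _; apply: eq_bigr => j _.
rewrite /eclam ec_valD ec_valN !(nth_map None) // !liftK //; apply: (allP CZ); exact: mem_nth.
Qed.
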